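(* Let $\mathbf{x}\in\mathbb{C}^d$ be an arbitrary fixed vector and let $\mathbf{b}=(b_1,\ldots,b_m)^\top\in\mathbb{C}^m$ satisfy $\|\mathbf{b}\|_2\ge c_0\sqrt{m}\,\|\mathbf{x}\|_2$, $\sum_{j=1}^m|b_j|^4\lesssim m\|\mathbf{x}\|_2^4$ and $\|\mathbf{b}\|_\infty\lesssim\sqrt{\log m}\,\|\mathbf{x}\|_2$, where $c_0>\sqrt{4.4/1.96}$ is a positive constant. Let $\mathbf{a}_1,\ldots,\mathbf{a}_m\in\mathbb{C}^d$ be i.i.d. complex Gaussian random vectors and $y_j=|\mathbf{a}_j^*\mathbf{x}+b_j|^2$, $j=1,\ldots,m$. There are positive universal constants $C,c_a,c_b,c_c,c_d$ such that if $m\ge Cd\log d$, then with probability at least $1-c_am^{-1}-18\exp(-c_dd)-c_b\exp(-c_cm/\log m)$, \[ \begin{pmatrix}\mathbf{v}\\ \bar{\mathbf{v}}\end{pmatrix}^*\nabla^2 f(\mathbf{z})\begin{pmatrix}\mathbf{v}\\ \bar{\mathbf{v}}\end{pmatrix}\ \ge\ (1.96c_0^2-4.4)\,\|\mathbf{x}\|_2^2\quad\text{for all } \mathbf{v}\in\mathbb{C}^d \text{ with }\|\mathbf{v}\|_2=1 \text{ and all } \mathbf{z}\in\mathbb{C}^d, \] where $\nabla^2 f$ is the Wirtinger Hessian of $f(\mathbf{z})=\frac1{2m}\sum_{j=1}^m\big(|\mathbf{a}_j^*\mathbf{z}+b_j|^2-y_j\big)^2$.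
   Context: A complex Gaussian random vector $\mathbf{a}\in\mathbb{C}^d$ means $\mathbf{a}\sim\frac{1}{\sqrt2}\mathcal{N}(0,I_d)+\frac{i}{\sqrt2}\mathcal{N}(0,I_d)$. $A\lesssim B$ means $A\le C_0B$ for an absolute constant $C_0>0$. The Wirtinger Hessian of $f$ is the $2d\times 2d$ matrix \[ \nabla^2 f(\mathbf{z})=\frac1m\sum_{j=1}^m\begin{pmatrix}(2|\mathbf{a}_j^*\mathbf{z}+b_j|^2-y_j)\mathbf{a}_j\mathbf{a}_j^* & (\mathbf{a}_j^*\mathbf{z}+b_j)^2\mathbf{a}_j\mathbf{a}_j^\top\\ (\mathbf{z}^*\mathbf{a}_j+\bar b_j)^2\bar{\mathbf{a}}_j\mathbf{a}_j^* & (2|\mathbf{a}_j^*\mathbf{z}+b_j|^2-y_j)\bar{\mathbf{a}}_j\mathbf{a}_j^\top\end{pmatrix}. \] *)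

(* Defs.v *)
From HB Require Import structures.
From mathcomp Require Import all_boot all_order all_algebra.
From mathcomp Require Import all_classical all_reals all_analysis.
From mathcomp Require Import complex.
Set Implicit Arguments. Unset Strict Implicit. Unset Printing Implicit Defensive.
Import Order.TTheory GRing.Theory Num.Theory.
Local Open Scope classical_set_scope.
Local Open Scope ring_scope.

Section Defs.
Variable R : realType.
Local Notation C := R[i].

Definition rC (r : R) : C := Complex r 0.

Definition cabs (z : C) : R := Num.sqrt (complex.Re z ^+ 2 + complex.Im z ^+ 2).

Definition mxadj p q (A : 'M[C]_(p, q)) : 'M[C]_(q, p) := map_mx conjc A^T.

Definition mxconj p q (A : 'M[C]_(p, q)) : 'M[C]_(p, q) := map_mx conjc A.

Definition sc (A : 'M[C]_1) : C := A 0 0.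

Definition vnorm n (v : 'cV[C]_n) : R := Num.sqrt (\sum_(i < n) cabs (v i 0) ^+ 2).

Definition vinfnorm n (v : 'cV[C]_n) : R := \big[Num.max/0]_(i < n) cabs (v i 0).

Definition meas m d (a : 'I_m -> 'cV[C]_d) (b : 'cV[C]_m) (x : 'cV[C]_d) (j : 'I_m) : R :=
  cabs (sc (mxadj (a j) *m x) + b j 0) ^+ 2.

(* Wirtinger Hessian (2d x 2d) of
   f(z) = 1/(2m) sum_j (|a_j^* z + b_j|^2 - y_j)^2, given by the explicit formula
   of the paper. *)
Definition wirtinger_hessian m d (a : 'I_m -> 'cV[C]_d) (b : 'cV[C]_m) (y : 'I_m -> R)
    (z : 'cV[C]_d) : 'M[C]_(d + d) :=
  (rC (m%:R))^-1 *: \sum_(j < m)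
    let u := sc (mxadj (a j) *m z) + b j 0 in
    let u' := sc (mxadj z *m a j) + conjc (b j 0) in
    let al := rC (2 * cabs u ^+ 2 - y j) in
    block_mx (al *: (a j *m mxadj (a j))) ((u ^+ 2) *: (a j *m (a j)^T))
             ((u' ^+ 2) *: (mxconj (a j) *m mxadj (a j))) (al *: (mxconj (a j) *m (a j)^T)).

Definition hess_form d (H : 'M[C]_(d + d)) (v : 'cV[C]_d) : C :=
  let w := col_mx v (mxconj v) in sc (mxadj w *m H *m w).

Definition mutually_independent dT (T : measurableType dT) (P : probability T R)
    (I : finType) (X : I -> T -> R) : Prop :=
  forall B : I -> set R, (forall i, measurable (B i)) ->
    P (\bigcap_(i in [set: I]) (X i @^-1` B i)) = (\prod_(i : I) P (X i @^-1` B i))%E.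

(* X (j,k,false), X (j,k,true) : real and imaginary parts of the k-th entry of
   a_j; all i.i.d. N(0, 1/2) (standard deviation sqrt(1/2)), i.e. the a_j are
   i.i.d. complex Gaussian vectors  N(0,I)/sqrt2 + i N(0,I)/sqrt2. *)
Definition iid_complex_gaussian dT (T : measurableType dT) (P : probability T R)
    m d (X : 'I_m * 'I_d * bool -> T -> R) : Prop :=
  [/\ forall i, measurable_fun setT (X i),
      forall i (B : set R), measurable B ->
        P (X i @^-1` B) = normal_prob 0 (Num.sqrt (2^-1)) B
    & mutually_independent P X].

Definition gvec dT (T : measurableType dT) m d (X : 'I_m * 'I_d * bool -> T -> R)
    (w : T) (j : 'I_m) : 'cV[C]_d :=
  \col_(k < d) Complex (X (j, k, false) w) (X (j, k, true) w).

End Defs.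

(* Main.v *)
(** With s_j = a_j^* v and u_j = a_j^* z + b_j, the Hessian form at z in
    direction v equals (2/m) sum_j (G(s_j, u_j) - y_j |s_j|^2), where
    G(s, u) = |s|^2 |u|^2 + 2 (Re (u conj s))^2.  If |x| = 1 the mean over j of
    G has expectation at least |z|^2 + 2 |b|^2/m, and that of y_j |s_j|^2 has
    expectation at most |b|^2/m + 2; the difference of these two bounds, minus
    a small error, is what the theorem asserts.

    Since G is nonnegative and quadratic in u, z ranges over a compact set once
    the pair (z, 1) is scaled to the unit sphere.  G dominates its radially
    clipped version, which is bounded and Lipschitz and differs from G by
    O(M^-2) in expectation at clipping level M; the Chernoff bound over a net
    gives the uniform lower bound.

    For the upper bound y_j is truncated at a multiple of log m.  Away from an
    event of probability O(1/m) this changes nothing, and the truncated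
    quadratic forms in v have small exponential moments, so that Chernoff over
    a net suffices again: v |-> (sum_j min(y_j, L) |s_j|^2)^(1/2) is a seminorm.
    The mixed Gaussian moments are obtained by comparing Taylor coefficients
    in the moment generating function.

    The factors D^d counting the nets are absorbed in exp (- c m / log m)
    because m >= C d log d; for d <= 1 this fails, but there
    18 exp (- d) exceeds 1 and the claim is void. *)
Require Import Defs.
From HB Require Import structures.
From mathcomp Require Import all_boot all_order all_algebra.
From mathcomp Require Import all_classical all_reals all_analysis.
From mathcomp Require Import complex measurable_realfun ring lra.
Set Implicit Arguments. Unset Strict Implicit. Unset Printing Implicit Defensive.
Import Order.TTheory GRing.Theory Num.Theory.
Local Open Scope classical_set_scope.
Local Open Scope ring_scope.
Import numFieldNormedType.Exports.

(** * Elementary estimates for the exponential and uniqueness of Taylor coefficients *)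

Section RealAnalysis.
Context {R : realType}.
Implicit Types (x y t : R) (n k : nat).

(** The two sides need different cuts. For the lower bound, exp (- lam G) is harmless; clipping
    serves the net, since unclipped G has no uniform modulus of continuity. As a cut only decreases
    G, its level M may be a constant, and the failure exponent is of order m. For the upper bound,
    y_j |s_j|^2 has no exponential moments, and the cut must change nothing with probability 1 -
    O(1/m). This takes a level of order ln m, hence a Chernoff parameter of order 1 / ln m: the
    origin of m / ln m.

    A Lipschitz estimate replaces it, resting on sum_j |a_j^* c|^2 <= 4 m |c|^2, which is itself an
    instance of the upper bound.

    Each a_j enters only through the moment generating function of its real linear forms. Each side
    is allowed an error m/20, so that the Hessian form is at least (2 c_0^2 - 4.2) |x|^2, which
    leaves room for the stated constants. *)

Lemma expR_taylor n y :
  `|expR y - \sum_(k < n) y ^+ k / k`!%:R| <= `|y| ^+ n * expR `|y|.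
Proof.
have cv : series (exp_coeff y) @ \oo --> expR y.
  exact: is_cvg_series_exp_coeff.
have cv' : (series (exp_coeff y) N - \sum_(k < n) y ^+ k / k`!%:R) @[N --> \oo]
    --> expR y - \sum_(k < n) y ^+ k / k`!%:R.
  by apply: cvgB cv _; exact: cvg_cst.
have cvn : `|series (exp_coeff y) N - \sum_(k < n) y ^+ k / k`!%:R| @[N --> \oo]
    --> `|expR y - \sum_(k < n) y ^+ k / k`!%:R|.
  exact: cvg_norm cv'.
rewrite -(cvg_lim _ cvn)//; apply: limr_le.
  by apply/cvg_ex; eexists; exact: cvn.
near=> N.
have nN : (n <= N)%N by near: N; exact: nbhs_infty_ge.
rewrite /series/= -(big_mkord xpredT (fun k => y ^+ k / k`!%:R)).
rewrite (@big_cat_nat _ _ _ n)//= [X in `|X|]addrC addKr.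
rewrite -{1}(add0n n) big_addn.
apply: (le_trans (ler_norm_sum _ _ _)).
apply: (@le_trans _ _ (`|y| ^+ n * \sum_(0 <= i < (N - n)%N) exp_coeff `|y| i)).
  rewrite mulr_sumr; apply: ler_sum => i _.
  rewrite /exp_coeff/= normrM normfV normrX [`|_%:R|]ger0_norm ?ler0n//.
  rewrite exprD mulrA (mulrC (`|y| ^+ n)) ler_wpM2l ?mulr_ge0 ?exprn_ge0//.
  rewrite lef_pV2 ?posrE ?ltr0n ?fact_gt0// ler_nat.
  by apply: leq_fact; rewrite leq_addr.
rewrite ler_wpM2l ?exprn_ge0//.
apply: (@nondecreasing_cvgn_le _ (series (exp_coeff `|y|))).
  by apply: nondecreasing_series => i _ _; exact: exp_coeff_ge0.
exact: is_cvg_series_exp_coeff.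
Unshelve. all: by end_near. Qed.

(** Letting t tend to 0 kills the constant coefficient; dividing by t then shifts the sequence and
    lowers n. This later identifies moments without differentiating under the integral sign. *)
Lemma coef_eq0_of_big_oh n (a : nat -> R) (C : R) :
  (forall t, 0 < t -> t <= 1 -> `|\sum_(k < n) a k * t ^+ k| <= C * t ^+ n) ->
  forall k, (k < n)%N -> a k = 0.
Proof.
elim: n a => // n IH a H.
have a0 : a 0%N = 0.
  pose B := \sum_(k < n) `|a k.+1| + `|C|.
  have B0 : 0 <= B by rewrite addr_ge0// sumr_ge0.
  have key t : 0 < t -> t <= 1 -> `|a 0%N| <= B * t.
    move=> t0 t1; have := H t t0 t1; rewrite big_ord_recl expr0 mulr1 => Ht.
    have -> : a 0%N = (a 0%N + \sum_(i < n) a (lift ord0 i) * t ^+ lift ord0 i)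
        - \sum_(i < n) a (lift ord0 i) * t ^+ lift ord0 i by rewrite addrK.
    apply: (le_trans (ler_normB _ _)); rewrite /B mulrDl addrC lerD//.
      rewrite mulr_suml; apply: (le_trans (ler_norm_sum _ _ _)).
      apply: ler_sum => i _; rewrite normrM /= /bump/= add1n ler_wpM2l//.
      by rewrite normrX ger0_norm ?(ltW t0)// exprS ler_piMr ?(ltW t0)// exprn_ile1// ltW.
    apply: (le_trans Ht); apply: (@le_trans _ _ (`|C| * t ^+ n.+1)).
      by apply: ler_wpM2r; [exact/exprn_ge0/ltW|exact: ler_norm].
    by rewrite ler_wpM2l// exprS ler_piMr ?(ltW t0)// exprn_ile1// ltW.
  apply/eqP; rewrite -normr_le0; apply/ler_addgt0Pl => e e0; rewrite addr0.
  pose t := Num.min 1 (e / (B + 1)).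
  have B1 : 0 < B + 1 by rewrite ltr_wpDl.
  have t0 : 0 < t by rewrite lt_min ltr01 divr_gt0.
  apply: (le_trans (key t t0 _)); first by rewrite ge_min lexx.
  apply: (@le_trans _ _ ((B + 1) * t)); first by rewrite ler_wpM2r ?lerDl// ltW.
  by rewrite -ler_pdivlMl// mulrC ge_min lexx orbT.
case=> [_|k]; first exact: a0.
rewrite ltnS; apply: (IH (fun k => a k.+1)) => t t0 t1.
have := H t t0 t1; rewrite big_ord_recl a0 mul0r add0r.
have -> : \sum_(i < n) a (lift ord0 i) * t ^+ lift ord0 i =
    t * \sum_(k0 < n) a k0.+1 * t ^+ k0.
  by rewrite mulr_sumr; apply: eq_bigr => i _; rewrite /= /bump/= add1n exprS mulrCA.
by rewrite normrM gtr0_norm// exprS mulrCA ler_pM2l.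
Qed.

Lemma expRN_le_quadratic x : 0 <= x -> expR (- x) <= 1 - x + x ^+ 2.
Proof.
move=> x0; have x1 : 0 < 1 + x by rewrite ltr_pwDl.
rewrite expRN; apply: (@le_trans _ _ (1 + x)^-1).
  by rewrite lef_pV2 ?posrE ?expR_gt0 ?expR_ge1Dx.
rewrite -div1r ler_pdivrMr//.
have -> : (1 - x + x ^+ 2) * (1 + x) = 1 + x ^+ 3 by ring.
by rewrite lerDl exprn_ge0.
Qed.

(** Multiply 1 - x <= exp (- x) by (1 + x) exp x. Keeping the exponential in the remainder avoids
    any upper bound on x. *)
Lemma expR_le_quadratic x : 0 <= x -> expR x <= 1 + x + x ^+ 2 * expR x.
Proof.
move=> x0; have := expR_ge1Dx (- x).
rewrite -(ler_pM2r (expR_gt0 x)) -expRD addNr expR0 => H.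
rewrite -subr_ge0.
have -> : 1 + x + x ^+ 2 * expR x - expR x = (1 + x) * (1 - (1 + - x) * expR x).
  by ring.
by rewrite mulr_ge0 ?subr_ge0// addr_ge0.
Qed.

Lemma expR_ge_monomial k x : 0 <= x -> x ^+ k <= k`!%:R * expR x.
Proof.
move=> x0; case: k => [|k].
  by rewrite expr0 fact0 mul1r -expR0 ler_expR.
rewrite -ler_pdivrMl ?ltr0n ?fact_gt0// mulrC.
by apply: le_trans (expR_ge1Dxn k x0); rewrite lerDr.
Qed.

End RealAnalysis.

(** * Independence *)

Section Independence.
Context {R : realType} {dT : measure_display} {T : measurableType dT}.
Variable P : probability T R.

(** With A' fixed, both sides are finite measures in A that agree on a pi-system, hence on the
    sigma-algebra it generates. *)
Lemma indep_g_sigma_algebra (G : set (set T)) (A' : set T) :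
  G `<=` measurable -> setI_closed G -> G setT -> measurable A' ->
  (forall A, G A -> P (A `&` A') = (P A * P A')%E) ->
  forall A, <<s G >> A -> P (A `&` A') = (P A * P A')%E.
Proof.
move=> Gm GI GT mA' GP.
have pA' : (0 <= fine (P A'))%R by exact: fine_ge0.
pose m1 := mrestr P mA'.
pose m2 := mscale (NngNum pA') P.
move=> A sA.
have -> : (P A * P A')%E = m2 A.
  by rewrite /m2/= /mscale/= fineK ?fin_num_measure// muleC.
apply: (@g_sigma_algebra_measure_unique _ R _ G Gm (fun=> setT) _ _ m1 m2) => //.
- by rewrite bigcup_const//; exists 0%N.
- move=> B GB; rewrite /m1 /m2/= /mscale/= /mrestr/= GP//.
  by rewrite fineK ?fin_num_measure// muleC.
- by move=> _; rewrite /m1/= /mrestr/= setTI (le_lt_trans (probability_le1 _ _))// ltry.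
Qed.

End Independence.

Section ProductRule.
Context {R : realType} {dT : measure_display} {T : measurableType dT}.
Variable P : probability T R.
Variables V1 V2 : T -> R.
Hypotheses (mV1 : measurable_fun setT V1) (mV2 : measurable_fun setT V2).
HB.instance Definition _ := isMeasurableFun.Build _ _ _ _ V1 mV1.
HB.instance Definition _ := isMeasurableFun.Build _ _ _ _ V2 mV2.
Let V w : R * R := (V1 w, V2 w).
Let mV : measurable_fun setT V. Proof. exact: measurable_fun_pair. Qed.
HB.instance Definition _ := isMeasurableFun.Build _ _ _ _ V mV.

Lemma ge0_integralM_indep :
  (forall w, 0 <= V1 w) -> (forall w, 0 <= V2 w) ->
  (forall A B, measurable A -> measurable B ->
    P (V1 @^-1` A `&` V2 @^-1` B) = (P (V1 @^-1` A) * P (V2 @^-1` B))%E) ->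
  (\int[P]_w (V1 w * V2 w)%:E = (\int[P]_w (V1 w)%:E) * (\int[P]_w (V2 w)%:E))%E.
Proof.
move=> V10 V20 ind.
(* The positive part makes the integrand nonnegative on all of the plane, so that Tonelli applies;
   on the values of V1 and V2 it is the identity. *)
pose f (x : R) : \bar R := (Num.max x 0)%:E.
have mf : measurable_fun setT f.
  by apply/measurable_EFinP; exact: measurable_maxr.
have f0 x : (0 <= f x)%E by rewrite lee_fin le_max lexx orbT.
pose F (z : R * R) : \bar R := (f z.1 * f z.2)%E.
have mF : measurable_fun setT F.
  apply: emeasurable_funM.
    exact: (measurableT_comp mf measurable_fst).
  exact: (measurableT_comp mf measurable_snd).
have F0 z : (0 <= F z)%E by rewrite mule_ge0.
transitivity (\int[distribution P V]_z F z)%E.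
  rewrite ge0_integral_distribution//; apply: eq_integral => w _.
  by rewrite /F /f/= !max_l.
transitivity (\int[distribution P V1 \x distribution P V2]_z F z)%E.
  apply/esym/eq_measure_integral => A mA _; apply: product_measure_unique => // A1 A2 mA1 mA2.

rewrite fubini_tonelli1//.
transitivity (\int[distribution P V1]_x (f x * \int[distribution P V2]_y f y))%E.
  by apply: eq_integral => x _; rewrite /fubini_F /F/= ge0_integralZl.
rewrite ge0_integralZr//; last by apply: integral_ge0.
by congr (_ * _)%E; rewrite ge0_integral_distribution//; apply: eq_integral => w _;
  rewrite /f/= max_l.
Qed.

End ProductRule.

Section CylinderAlgebra.
Context {R : realType} {dT : measure_display} {T : measurableType dT}.
Variables (I : finType) (X : I -> T -> R).
Hypothesis mX : forall i, measurable_fun setT (X i).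

Definition cylinder (D : {set I}) : set (set T) :=
  [set A | exists2 B : I -> set R, (forall i, measurable (B i)) &
     A = \bigcap_(i in [set` D]) (X i @^-1` B i)].

Lemma cylinder_measurable D : cylinder D `<=` measurable.
Proof.
move=> _ [B mB ->]; apply: fin_bigcap_measurable; first exact: finite_finset.
by move=> i _; rewrite -[X in measurable X]setTI; exact: mX.
Qed.

Lemma setI_closed_cylinder D : setI_closed (cylinder D).
Proof.
move=> _ _ [B mB ->] [B' mB' ->]; exists (fun i => B i `&` B' i).
  by move=> i; exact: measurableI.
by rewrite -bigcapI.
Qed.

Lemma cylinderT D : cylinder D setT.
Proof.
by exists (fun=> setT) => //; apply/esym/seteqP; split.
Qed.

Lemma cylinderS (D D' : {set I}) : D \subset D' -> cylinder D `<=` cylinder D'.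
Proof.
move=> sD _ [B mB ->]; exists (fun i => if i \in D then B i else setT).
  by move=> i; case: ifP.
apply/seteqP; split => w H i /= iD; last first.
  by have /= := H i (fintype.subsetP sD _ iD); rewrite iD.
by case: ifP => // iD'; exact: H.
Qed.

Lemma sigma_cylinder_measurable D : <<s cylinder D >> `<=` measurable.
Proof.
by apply: smallest_sub; [exact: sigma_algebra_measurable|exact: cylinder_measurable].
Qed.

(** Phrased as measurability on a generated space, so that every closure lemma for measurable
    functions also proves dependence on the coordinates in D alone. *)
Definition depends_on (D : {set I}) (V : T -> R) :=
  measurable_fun [set: g_sigma_algebraType (cylinder D)] V.

Lemma depends_onS (D D' : {set I}) V : D \subset D' -> depends_on D V -> depends_on D' V.
Proof.
move=> sD mV _ B mB; have := mV measurableT B mB; rewrite !setTI.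
by apply: sub_sigma_algebra2; exact: cylinderS.
Qed.

Lemma depends_on_measurable D V : depends_on D V -> measurable_fun [set: T] V.
Proof.
move=> mV _ B mB; have := mV measurableT B mB; rewrite !setTI.
exact: sigma_cylinder_measurable.
Qed.

Lemma depends_on_coord i : depends_on [set i] (X i).
Proof.
move=> _ B mB; rewrite setTI; apply: sub_sigma_algebra.
exists (fun=> B) => //; apply/seteqP; split => w /=.
  by move=> Bw j /=; rewrite inE => /eqP ->.
by move=> /(_ i); apply; rewrite /= inE.
Qed.

End CylinderAlgebra.

Section IndependentProducts.
Context {R : realType} {dT : measure_display} {T : measurableType dT}.
Variables (P : probability T R) (I : finType) (X : I -> T -> R).
Hypothesis mX : forall i, measurable_fun setT (X i).
Hypothesis indX : mutually_independent P X.

Lemma cylinder_indep (D1 D2 : {set I}) (A1 A2 : set T) : [disjoint D1 & D2]%B ->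
  cylinder X D1 A1 -> cylinder X D2 A2 -> P (A1 `&` A2) = (P A1 * P A2)%E.
Proof.
move=> D12 [B1 mB1 ->] [B2 mB2 ->].
(* Independence is given for the full family only; putting [setT] outside D extends a partial family
   and changes neither the event nor the product. *)
have cut (D : {set I}) (B : I -> set R) : (forall i, measurable (B i)) ->
    P (\bigcap_(i in [set` D]) (X i @^-1` B i)) =
    (\prod_i (if i \in D then P (X i @^-1` B i) else 1))%E.
  move=> mB; pose B' i := if i \in D then B i else setT.
  have -> : \bigcap_(i in [set` D]) (X i @^-1` B i) =
      \bigcap_(i in [set: I]) (X i @^-1` B' i).
    apply/seteqP; split => w H i /= iD.
      by rewrite /B'; case: ifP => // iD'; exact: H.
    by have /= := H i Logic.I; rewrite /B' iD.
  rewrite indX; last by move=> i; rewrite /B'; case: ifP.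
  apply: eq_bigr => i _; rewrite /B'; case: ifP => // _.
  by rewrite preimage_setT probability_setT.
rewrite !cut// -big_split/=.
pose B i := if i \in D1 then B1 i else B2 i.
have -> : \bigcap_(i in [set` D1]) (X i @^-1` B1 i) `&`
    \bigcap_(i in [set` D2]) (X i @^-1` B2 i) =
    \bigcap_(i in [set` D1 :|: D2]) (X i @^-1` B i).
  apply/seteqP; split => w /=.
    move=> [H1 H2] i /=; rewrite inE => /orP[iD|iD]; rewrite /B.
      by rewrite iD; exact: H1.
    by rewrite (disjointFl D12 iD); exact: H2.
  move=> H; split => i /= iD.
    by have /= := H i; rewrite inE iD => /(_ isT); rewrite /B iD.
  by have /= := H i; rewrite inE iD orbT => /(_ isT); rewrite /B (disjointFl D12 iD).
rewrite cut; last by move=> i; rewrite /B; case: ifP.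
apply: eq_bigr => i _; rewrite inE /B.
have [iD1|iD1]/= := boolP (i \in D1); first by rewrite (disjointFr D12 iD1) mule1.
by rewrite mul1e.
Qed.

(** The pi-system argument is used once per side: first A2 is held fixed in its sigma-algebra, then
    A1 is a cylinder. *)
Lemma sigma_cylinder_indep (D1 D2 : {set I}) (A1 A2 : set T) : [disjoint D1 & D2]%B ->
  <<s cylinder X D1 >> A1 -> <<s cylinder X D2 >> A2 ->
  P (A1 `&` A2) = (P A1 * P A2)%E.
Proof.
move=> D12 sA1 sA2.
have := @indep_g_sigma_algebra _ _ _ P (cylinder X D1) A2.
apply => //.
- exact: cylinder_measurable.
- exact: setI_closed_cylinder.
- exact: cylinderT.
- exact: sigma_cylinder_measurable sA2.
move=> {sA1}A1 cA1; rewrite setIC muleC.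
have := @indep_g_sigma_algebra _ _ _ P (cylinder X D2) A1.
apply => //.
- exact: cylinder_measurable.
- exact: setI_closed_cylinder.
- exact: cylinderT.
- exact: (cylinder_measurable mX) cA1.
by move=> {sA2}A2 cA2; rewrite setIC muleC; exact: cylinder_indep D12 _ _.
Qed.

Lemma ge0_integral_prod_indep (J : eqType) (s : seq J) (D : J -> {set I})
    (V : J -> T -> R) :
  uniq s -> (forall j j', j != j' -> [disjoint D j & D j']%B) ->
  (forall j, depends_on X (D j) (V j)) -> (forall j w, 0 <= V j w) ->
  (\int[P]_w (\prod_(j <- s) V j w)%:E = \prod_(j <- s) \int[P]_w (V j w)%:E)%E.
Proof.
move=> us dD dV V0.
(* The induction must also carry the measurability of the partial product, since this is what makes
   it independent of the next factor. *)
suff [] : depends_on X (\bigcup_(j <- s) D j) (fun w => \prod_(j <- s) V j w) /\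
  (\int[P]_w (\prod_(j <- s) V j w)%:E = \prod_(j <- s) \int[P]_w (V j w)%:E)%E by [].
elim: s us => [_|j s IH /= /andP[js us]].
  split.
    rewrite /depends_on (_ : (fun _ => _) = cst 1); first exact: measurable_cst.
    by apply/funext => w; rewrite big_nil.
  rewrite big_nil (eq_integral (cst 1%E)); last by move=> w _; rewrite big_nil.
  by rewrite integral_cst// mul1e; exact: probability_setT.
have [dS IHE] := IH us.
have dis : [disjoint D j & \bigcup_(j <- s) D j]%B.
  elim: s js {us dS IHE IH} => [_|k s IH]; first by rewrite big_nil finset.disjoints_subset finset.setC0 finset.subsetT.
  rewrite inE negb_or => /andP[jk js]; rewrite big_cons.
  rewrite finset.disjoints_subset finset.setCU finset.subsetI.
  by rewrite -!finset.disjoints_subset dD// IH.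
split.
  rewrite /depends_on big_cons.
  rewrite (_ : (fun _ => _) = (fun w => V j w * \prod_(j0 <- s) V j0 w)); last first.
    by apply/funext => w; rewrite big_cons.
  apply: measurable_funM.
    by apply: depends_onS (dV j); exact: finset.subsetUl.
  by apply: depends_onS dS; exact: finset.subsetUr.
rewrite big_cons -IHE; under eq_integral do rewrite big_cons.
apply: ge0_integralM_indep.
- exact: depends_on_measurable (dV j).
- exact: depends_on_measurable dS.
- by [].
- by move=> w; apply: prodr_ge0.
move=> A B mA mB; apply: sigma_cylinder_indep dis _ _.
- by have := dV j measurableT A mA; rewrite setTI.
- by have := dS measurableT B mB; rewrite setTI.
Qed.

End IndependentProducts.

(** * Gaussian moments *)

Section NormalMgf.
Context {R : realType}.
Local Notation mu := (@lebesgue_measure R).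

(** The Radon-Nikodym derivative of the normal law and the Gaussian density have the same integral
    over every measurable set, hence agree almost everywhere. *)
Lemma ge0_integral_normal (m s : R) (f : R -> \bar R) :
  (forall x, (0 <= f x)%E) -> measurable_fun setT f ->
  (\int[normal_prob m s]_x f x = \int[mu]_x (f x * (normal_pdf m s x)%:E))%E.
Proof.
move=> f0 mf; have dom := normal_prob_dominates m s.
rewrite -(Radon_Nikodym_SigmaFinite.change_of_variables dom)//.
have mRN : measurable_fun setT
    (Radon_Nikodym_SigmaFinite.f (normal_prob m s) mu).
  exact: measurable_int (Radon_Nikodym_SigmaFinite.f_integrable dom).
have mpdf : measurable_fun setT (fun x => (normal_pdf m s x)%:E).
  by apply/measurable_EFinP; exact: measurable_normal_pdf.
apply: ae_eq_integral => //.
- exact: emeasurable_funM.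
- exact: emeasurable_funM.
apply: ae_eqe_mul2l.
apply: integral_ae_eq => //.
- exact: Radon_Nikodym_SigmaFinite.f_integrable.
- by move=> A _ mA; rewrite -Radon_Nikodym_SigmaFinite.f_integral.
Qed.

Lemma normal_mgf (s t : R) : s != 0 ->
  (\int[normal_prob 0 s]_x (expR (t * x))%:E = (expR (t ^+ 2 * s ^+ 2 / 2))%:E)%E.
Proof.
move=> s0; rewrite ge0_integral_normal; last 2 first.
- by move=> x; rewrite lee_fin expR_ge0.
- by apply/measurable_EFinP; apply: measurableT_comp => //; exact: measurable_funM.
(* Completing the square: the exponentially tilted density is a multiple of the density with mean t
   s^2. *)
transitivity (\int[mu]_x ((expR (t ^+ 2 * s ^+ 2 / 2))%:E *
    (normal_pdf (t * s ^+ 2) s x)%:E))%E.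
  apply: eq_integral => x _; rewrite -!EFinM !normal_pdfE//; congr EFin.
  rewrite mulrCA [RHS]mulrCA; congr (_ * _).
  by rewrite /normal_fun -!expRD; congr expR; field; rewrite ?s0.
rewrite ge0_integralZl//.
- by rewrite integral_normal_pdf mule1.
- by apply/measurable_EFinP; exact: measurable_normal_pdf.
- by move=> x _; rewrite lee_fin normal_pdf_ge0.
Qed.

Lemma normal_exp_sqr_quarter :
  (\int[normal_prob 0 1]_x (expR (x ^+ 2 / 4))%:E <= (3 / 2 : R)%:E)%E.
Proof.
rewrite ge0_integral_normal; last 2 first.
- by move=> x; rewrite lee_fin expR_ge0.
- apply/measurable_EFinP; apply: measurableT_comp => //.
  by apply: measurable_funM => //; exact: measurable_funX.
have s0 : Num.sqrt 2 != 0 :> R by rewrite gt_eqF// sqrtr_gt0.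
(* exp (x^2/4) times the standard density is sqrt 2 times the density of variance 2, so the integral
   is sqrt 2, at most 3/2. *)
rewrite (_ : integral _ _ _ = \int[mu]_x ((Num.sqrt 2)%:E *
    (normal_pdf 0 (Num.sqrt 2) x)%:E))%E; last first.
  apply: eq_integral => x _; rewrite -!EFinM !normal_pdfE ?oner_neq0//; congr EFin.
  rewrite mulrCA [RHS]mulrA; congr (_ * _).
    rewrite /normal_peak expr1n mul1r sqr_sqrtr// -mulrnAr sqrtrM// invfM.
    by rewrite mulrA divff// mul1r.
  by rewrite /normal_fun -!expRD sqr_sqrtr//; congr expR; rewrite subr0; field.
rewrite ge0_integralZl//.
- rewrite integral_normal_pdf mule1 lee_fin.
  rewrite -(@ler_pXn2r _ 2)// ?nnegrE//; rewrite sqr_sqrtr//; lra.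
- by apply/measurable_EFinP; exact: measurable_normal_pdf.
- by move=> x _; rewrite lee_fin normal_pdf_ge0.
Qed.

End NormalMgf.

Section Moments.
Context {R : realType} {dT : measure_display} {T : measurableType dT}.
Variable P : probability T R.
Implicit Types f g : T -> R.

(** Unlike integrability, this is closed under products as well as sums, so the side conditions for
    polynomials in Gaussians follow from their shape. *)
Definition finite_moments f :=
  measurable_fun setT f /\
  forall k, (\int[P]_w (`|f w| ^+ k)%:E < +oo)%E.

Definition Ex f : R := \int[P]_w f w.

Lemma finite_moments_measurable f : finite_moments f -> measurable_fun setT f.
Proof. by case. Qed.

Lemma measurable_normX f k : measurable_fun setT f ->
  measurable_fun setT (fun w => (`|f w| ^+ k)%:E).
Proof.
move=> mf; apply/measurable_EFinP; apply: measurable_funX.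
exact: measurableT_comp.
Qed.

Lemma finite_moments_dominated f (h : nat -> T -> R) : measurable_fun setT f ->
  (forall k, measurable_fun setT (h k)) ->
  (forall k w, `|f w| ^+ k <= h k w) ->
  (forall k, (\int[P]_w (h k w)%:E < +oo)%E) -> finite_moments f.
Proof.
move=> mf mh fh hoo; split => // k; apply: le_lt_trans (hoo k).
by apply: ge0_le_integral => //; [exact: measurable_normX|exact/measurable_EFinP|
  move=> w _; rewrite lee_fin].
Qed.

Lemma finite_moments_integrable f : finite_moments f ->
  P.-integrable setT (EFin \o f).
Proof.
move=> [mf /(_ 1%N) foo]; apply/integrableP; split; first exact/measurable_EFinP.
by apply: le_lt_trans foo; apply: ge0_le_integral => //;
  [exact/measurable_EFinP/measurableT_comp|exact: measurable_normX].
Qed.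

Lemma finite_moments_cst (c : R) : finite_moments (fun=> c).
Proof.
split; first exact: measurable_cst.
move=> k; rewrite integral_cst//.
rewrite [X in (_ * X)%E](_ : _ = 1%E) ?mule1 ?ltry//; exact: probability_setT.
Qed.

Lemma finite_momentsD f g : finite_moments f -> finite_moments g ->
  finite_moments (fun w => f w + g w).
Proof.
move=> [mf ff] [mg fg].
apply: (@finite_moments_dominated _
  (fun k w => 2 ^+ k * (`|f w| ^+ k + `|g w| ^+ k))).
- exact: measurable_funD.
- move=> k; apply: measurable_funM => //.
  by apply: measurable_funD; apply: measurable_funX; exact: measurableT_comp.
- move=> k w; apply: (@le_trans _ _ ((2 * Num.max `|f w| `|g w|) ^+ k)).
    rewrite lerXn2r ?nnegrE ?mulr_ge0 ?le_max ?normr_ge0//.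
    rewrite (le_trans (ler_normD _ _))// mulr_natl mulr2n lerD// le_max lexx//.
    by rewrite orbT.
  rewrite exprMn ler_wpM2l ?exprn_ge0//.
  by case: (leP `|f w| `|g w|) => _; rewrite ?lerDl ?lerDr exprn_ge0.
- move=> k; under eq_integral do rewrite EFinM.
  rewrite ge0_integralZl//; try solve [by rewrite lee_fin exprn_ge0|
    by move=> w _; rewrite lee_fin addr_ge0// exprn_ge0|
    by apply/measurable_EFinP; apply: measurable_funD; apply: measurable_funX;
      exact: measurableT_comp].
  apply: lte_mul_pinfty; rewrite ?lee_fin ?exprn_ge0//.
  under eq_integral do rewrite EFinD.
  rewrite ge0_integralD//; try exact: measurable_normX.
  by rewrite lte_add_pinfty.
Qed.

Lemma finite_momentsM f g : finite_moments f -> finite_moments g ->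
  finite_moments (fun w => f w * g w).
Proof.
move=> [mf ff] [mg fg].
apply: (@finite_moments_dominated _
  (fun k w => `|f w| ^+ k.*2 + `|g w| ^+ k.*2)).
- exact: measurable_funM.
- by move=> k; apply: measurable_funD; apply: measurable_funX; exact: measurableT_comp.
- move=> k w; rewrite normrM exprMn -!muln2 !exprM.
  set a := `|f w| ^+ k; set b := `|g w| ^+ k.
  by have := sqr_ge0 (a - b); have := sqr_ge0 (a + b); nra.
- move=> k; under eq_integral do rewrite EFinD.
  rewrite ge0_integralD//; try exact: measurable_normX.
  by rewrite lte_add_pinfty.
Qed.

Lemma finite_momentsX f k : finite_moments f -> finite_moments (fun w => f w ^+ k).
Proof.
move=> ff; elim: k => [|k IH].
  by under eq_fun do rewrite expr0; exact: finite_moments_cst.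
by under eq_fun do rewrite exprS; exact: finite_momentsM.
Qed.

Lemma finite_momentsN f : finite_moments f -> finite_moments (fun w => - f w).
Proof.
move=> ff; under eq_fun do rewrite -mulN1r.
by apply: finite_momentsM ff; exact: finite_moments_cst.
Qed.

Lemma finite_moments_norm f : finite_moments f -> finite_moments (fun w => `|f w|).
Proof.
move=> [mf ff]; split; first exact: measurableT_comp.
by move=> k; under eq_integral do rewrite normr_id.
Qed.

Lemma finite_moments_sum (K : finType) (F : K -> T -> R) :
  (forall i, finite_moments (F i)) -> finite_moments (fun w => \sum_i F i w).
Proof.
move=> fF; elim: (index_enum K) => [|i s IH].
  by under eq_fun do rewrite big_nil; exact: finite_moments_cst.
by under eq_fun do rewrite big_cons; exact: finite_momentsD.
Qed.

Lemma EFin_Ex f : finite_moments f -> (\int[P]_w (f w)%:E)%E = (Ex f)%:E.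
Proof.
by move=> ff; rewrite fineK//; apply: integrable_fin_num => //; exact: finite_moments_integrable.
Qed.

Lemma ExD f g : finite_moments f -> finite_moments g ->
  Ex (fun w => f w + g w) = Ex f + Ex g.
Proof. by move=> ff fg; rewrite /Ex RintegralD//; exact: finite_moments_integrable. Qed.

Lemma ExZ (c : R) f : finite_moments f -> Ex (fun w => c * f w) = c * Ex f.
Proof. by move=> ff; rewrite /Ex RintegralZl//; exact: finite_moments_integrable. Qed.

Lemma Ex_cst (c : R) : Ex (fun=> c) = c.
Proof.
apply: EFin_inj; rewrite -EFin_Ex; last exact: finite_moments_cst.
rewrite integral_cst//.
rewrite [X in (_ * X)%E](_ : _ = 1%E) ?mule1//; exact: probability_setT.
Qed.

Lemma Ex_le f g : finite_moments f -> finite_moments g ->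
  (forall w, f w <= g w) -> Ex f <= Ex g.
Proof. by move=> ff fg fg'; rewrite /Ex le_Rintegral//; exact: finite_moments_integrable. Qed.

Lemma ler_norm_Ex f : finite_moments f -> `|Ex f| <= Ex (fun w => `|f w|).
Proof.
by move=> ff; apply: le_normr_Rintegral => //; exact: finite_moments_integrable.
Qed.

End Moments.

Section Coordinates.
Context {R : realType} {K : finType}.
Implicit Types a c e : K -> R.

Definition dotf a c : R := \sum_k a k * c k.
Definition sqnorm c : R := \sum_k c k ^+ 2.

Lemma sqnorm_ge0 c : 0 <= sqnorm c.
Proof. by apply: sumr_ge0 => k _; exact: sqr_ge0. Qed.

Lemma sqnormE c : sqnorm c = dotf c c.
Proof. by apply: eq_bigr => k _; rewrite expr2. Qed.

Lemma dotfC a c : dotf a c = dotf c a.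
Proof. by apply: eq_bigr => k _; rewrite mulrC. Qed.

Lemma dotfDl a c e : dotf (fun k => a k + c k) e = dotf a e + dotf c e.
Proof. by rewrite /dotf -big_split; apply: eq_bigr => k _; rewrite mulrDl. Qed.

Lemma dotfBl a c e : dotf (fun k => a k - c k) e = dotf a e - dotf c e.
Proof. by rewrite /dotf -sumrB; apply: eq_bigr => k _; rewrite mulrBl. Qed.

Lemma dotfZl (t : R) c e : dotf (fun k => t * c k) e = t * dotf c e.
Proof. by rewrite /dotf mulr_sumr; apply: eq_bigr => k _; rewrite mulrA. Qed.

Lemma sqnormZ t c : sqnorm (fun k => t * c k) = t ^+ 2 * sqnorm c.
Proof. by rewrite !sqnormE dotfZl dotfC dotfZl; ring. Qed.

Lemma sqnormD a c : sqnorm (fun k => a k + c k) = sqnorm a + 2 * dotf a c + sqnorm c.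
Proof. by rewrite !sqnormE dotfDl !(dotfC _ (fun k => a k + c k)) !dotfDl (dotfC c a); ring. Qed.

Lemma sqnormB a c : sqnorm (fun k => a k - c k) = sqnorm a - 2 * dotf a c + sqnorm c.
Proof. by rewrite !sqnormE dotfBl !(dotfC _ (fun k => a k - c k)) !dotfBl (dotfC c a); ring. Qed.

End Coordinates.

Section GaussianFamily.
Context {R : realType} {dT : measure_display} {T : measurableType dT}.
Variables (P : probability T R) (K : finType) (g : K -> T -> R).
Hypothesis mg : forall k, measurable_fun setT (g k).

(** The transform assumed for these forms is that of variance |c|^2 / 2, as for independent
    coordinates of law N(0, 1/2); all moments below are derived from it. *)
Definition lin (c : K -> R) w := dotf c (g ^~ w).

Hypothesis mgf : forall c,
  (\int[P]_w (expR (lin c w))%:E = (expR (sqnorm c / 4))%:E)%E.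

Lemma linD a c w : lin (fun k => a k + c k) w = lin a w + lin c w.
Proof. exact: dotfDl. Qed.

Lemma linB a c w : lin (fun k => a k - c k) w = lin a w - lin c w.
Proof. exact: dotfBl. Qed.

Lemma linZ t c w : lin (fun k => t * c k) w = t * lin c w.
Proof. exact: dotfZl. Qed.

Lemma measurable_lin c : measurable_fun setT (lin c).
Proof. by apply: measurable_sum => k; exact: measurable_funM. Qed.

Lemma mgf_scaled t c :
  (\int[P]_w (expR (t * lin c w))%:E = (expR (t ^+ 2 * (sqnorm c / 4)))%:E)%E.
Proof.
under eq_integral do rewrite -linZ.
by rewrite mgf sqnormZ mulrA.
Qed.

Lemma finite_moments_expR_lin c : finite_moments P (fun w => expR (lin c w)).
Proof.
split; first by apply: measurableT_comp => //; exact: measurable_lin.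
move=> k; under eq_integral do rewrite ger0_norm ?expR_ge0// -expRM_natl.
by rewrite mgf_scaled ltry.
Qed.

Lemma finite_moments_lin c : finite_moments P (lin c).
Proof.
apply: (@finite_moments_dominated _ _ _ _ _
  (fun k w => k`!%:R * (expR (lin c w) + expR (- lin c w)))).
- exact: measurable_lin.
- move=> k; apply: measurable_funM => //; apply: measurable_funD;
    apply: measurableT_comp => //; first exact: measurable_lin.
  by apply: measurableT_comp => //; exact: measurable_lin.
- move=> k w; apply: (le_trans (expR_ge_monomial _ (normr_ge0 _))).
  rewrite ler_wpM2l//; case: (ger0P (lin c w)) => _.
    by rewrite lerDl expR_ge0.
  by rewrite lerDr expR_ge0.
- move=> k.
  have fm : finite_moments P (fun w => k`!%:R * (expR (lin c w) + expR (- lin c w))).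
    apply: finite_momentsM; first exact: finite_moments_cst.
    apply: finite_momentsD; first exact: finite_moments_expR_lin.
    under eq_fun do rewrite -mulN1r -linZ.
    exact: finite_moments_expR_lin.
  by rewrite EFin_Ex// ltry.
Qed.

Lemma Ex_expR_lin t c : Ex P (fun w => expR (t * lin c w)) = expR (t ^+ 2 * (sqnorm c / 4)).
Proof.
apply: EFin_inj; rewrite -EFin_Ex ?mgf_scaled//.
by under eq_fun do rewrite -linZ; exact: finite_moments_expR_lin.
Qed.

(** This is k! times the coefficient of t^k in exp (v t^2); v is half the variance. *)
Definition gauss_moment (v : R) k :=
  if odd k then 0 else k`!%:R * (v ^+ k./2 / (k./2)`!%:R).

(** Expanding E exp (t s) and exp (v t^2) leaves remainders O(t^6) on both sides, so the
    coefficients below order 6 agree. Order 6 covers the fourth moments, is even, and matches three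
    terms of the series in t^2. *)
Lemma Ex_lin_exp c k : (k < 6)%N ->
  Ex P (fun w => lin c w ^+ k) = gauss_moment (sqnorm c / 4) k.
Proof.
move=> k6; set v := sqnorm c / 4.
have v0 : 0 <= v by rewrite divr_ge0// sqnorm_ge0.
pose a k := Ex P (fun w => lin c w ^+ k) / k`!%:R -
  (if odd k then 0 else v ^+ k./2 / (k./2)`!%:R).
have fS := finite_moments_lin c.
(* For t in (0, 1] the Taylor remainder of exp (t s) is at most t^6 times this variable, whose
   expectation does not depend on t. *)
pose Q w := lin c w ^+ 6 * expR `|lin c w|.
suff /(_ k k6) : forall k, (k < 6)%N -> a k = 0.
  move/eqP; rewrite subr_eq0 => /eqP.
  move/(congr1 (fun x => k`!%:R * x)); rewrite mulrC divfK ?pnatr_eq0 -?lt0n ?fact_gt0//.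
  by move=> ->; rewrite /gauss_moment; case: ifP => //; rewrite mulr0.
have fE : finite_moments P (fun w => expR `|lin c w|).
  apply: (@finite_moments_dominated _ _ _ _ _
    (fun k w => expR (lin (fun i => k%:R * c i) w) + expR (lin (fun i => - k%:R * c i) w))).
  - apply: measurableT_comp => //; apply: measurableT_comp => //; exact: measurable_lin.
  - by move=> j; apply: measurable_funD; apply: measurableT_comp => //; exact: measurable_lin.
  - move=> j w; rewrite ger0_norm ?expR_ge0// -expRM_natl !linZ.
    case: (ger0P (lin c w)) => _; first by rewrite lerDl expR_ge0.
    by rewrite mulNr mulrN lerDr expR_ge0.
  - move=> j; rewrite EFin_Ex ?ltry//.
    by apply: finite_momentsD; exact: finite_moments_expR_lin.
have fQ : finite_moments P Q by apply: finite_momentsM => //; exact: finite_momentsX.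
apply: (@coef_eq0_of_big_oh _ _ _ (Ex P Q + v ^+ 3 * expR v)) => t t0 t1.
pose p1 := \sum_(k < 6) (Ex P (fun w => lin c w ^+ k) / k`!%:R) * t ^+ k.
pose p2 := \sum_(i < 3) (t ^+ 2 * v) ^+ i / i`!%:R.
have -> : \sum_(k < 6) a k * t ^+ k = (p1 - expR (t ^+ 2 * v)) + (expR (t ^+ 2 * v) - p2).
  rewrite /a /p1 /p2 !big_ord_recl !big_ord0/= /bump/= !fact0 !factS.
  by field.
rewrite (le_trans (ler_normD _ _))// mulrDl lerD//.
- have fexp : finite_moments P (fun w => expR (t * lin c w)).
    by under eq_fun do rewrite -linZ; exact: finite_moments_expR_lin.
  pose q w := \sum_(k < 6) (t * lin c w) ^+ k / k`!%:R.
  have fq : finite_moments P q.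
    apply: finite_moments_sum => i; apply: finite_momentsM; last exact: finite_moments_cst.
    apply: finite_momentsX; apply: finite_momentsM => //; exact: finite_moments_cst.
  have fNexp : finite_moments P (fun w => - 1 * expR (t * lin c w)).
    exact: (finite_momentsM (finite_moments_cst P _) fexp).
  have fdiff := finite_momentsD fq fNexp.
  have -> : p1 - expR (t ^+ 2 * v) = Ex P (fun w => q w + - 1 * expR (t * lin c w)).
    rewrite (ExD fq fNexp).
    rewrite ExZ// Ex_expR_lin mulN1r; congr (_ - _).
    have fk (x : R) j : finite_moments P (fun w => x * lin c w ^+ j).
      by apply: finite_momentsM; [exact: finite_moments_cst|exact: finite_momentsX].
    have -> : q = fun w => (t ^+ 0 / 0`!%:R) * lin c w ^+ 0 +
      ((t ^+ 1 / 1`!%:R) * lin c w ^+ 1 +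
      ((t ^+ 2 / 2`!%:R) * lin c w ^+ 2 + ((t ^+ 3 / 3`!%:R) * lin c w ^+ 3 +
      ((t ^+ 4 / 4`!%:R) * lin c w ^+ 4 + (t ^+ 5 / 5`!%:R) * lin c w ^+ 5)))).
      apply/funext => w; rewrite /q !big_ord_recl big_ord0/= /bump/= !fact0 !factS;
        field; rewrite ?pnatr_eq0 -?lt0n ?fact_gt0 //.
    cbv beta.
    do 5! (rewrite ExD; [|by do ? [exact: fk | apply: finite_momentsD]
                         |by do ? [exact: fk | apply: finite_momentsD]]).
    rewrite !ExZ; try exact: finite_momentsX.
    rewrite /p1 !big_ord_recl big_ord0 /= /bump/= !fact0 !factS;
        field; rewrite ?pnatr_eq0 -?lt0n ?fact_gt0 //.
  apply: le_trans (ler_norm_Ex fdiff) _.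
  rewrite mulrC -ExZ//; apply: Ex_le.
  - exact: finite_moments_norm fdiff.
  - exact: (finite_momentsM (finite_moments_cst P _) fQ).
  move=> w; rewrite mulN1r distrC; apply: (le_trans (expR_taylor 6 _)).
  rewrite normrM (gtr0_norm t0) exprMn -mulrA ler_wpM2l ?exprn_ge0 ?(ltW t0)//.
  rewrite /Q -[X in _ <= X * _](@ger0_norm _ (lin c w ^+ 6)) ?normrX; last first.
    by rewrite -[6%N]/(2 * 3)%N exprM exprn_ge0// sqr_ge0.
  rewrite ler_wpM2l ?exprn_ge0// ler_expR.
  by rewrite ler_piMl.
- have tv0 : 0 <= t ^+ 2 * v by rewrite mulr_ge0// sqr_ge0.
  apply: (le_trans (expR_taylor 3 _)); rewrite (ger0_norm tv0).
  have -> : v ^+ 3 * expR v * t ^+ 6 = (t ^+ 2 * v) ^+ 3 * expR v by ring.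
  apply: ler_wpM2l; first exact: exprn_ge0.
  by rewrite ler_expR ler_piMl// exprn_ile1// ltW.
Qed.


Lemma Ex_lin2 c : Ex P (fun w => lin c w ^+ 2) = sqnorm c / 2.
Proof.
by rewrite Ex_lin_exp//= /gauss_moment/= (_ : 2`! = 2)%N// (_ : 1`! = 1)%N//; field.
Qed.

Lemma Ex_lin4 c : Ex P (fun w => lin c w ^+ 4) = 3 / 4 * sqnorm c ^+ 2.
Proof.
by rewrite Ex_lin_exp//= /gauss_moment/= (_ : 4`! = 24)%N// (_ : 2`! = 2)%N//; field.
Qed.

Lemma Ex_lin3 c : Ex P (fun w => lin c w ^+ 3) = 0.
Proof. by rewrite Ex_lin_exp. Qed.

Let fl := finite_moments_lin.

(** This and the next mixed moments come from polarization: the product is a combination of powers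
    of sums and differences, which are again linear forms. *)
Lemma Ex_linM a c : Ex P (fun w => lin a w * lin c w) = dotf a c / 2.
Proof.
have -> : (fun w => lin a w * lin c w) = (fun w =>
    4^-1 * lin (fun k => a k + c k) w ^+ 2 + (- 4^-1) * lin (fun k => a k - c k) w ^+ 2).
  by apply/funext => w; rewrite linD linB; field.
have fZ (x : R) e : finite_moments P (fun w => x * lin e w ^+ 2).
  by apply: finite_momentsM; [exact: finite_moments_cst|exact: finite_momentsX].
rewrite ExD// !ExZ; try exact: finite_momentsX.
by rewrite !Ex_lin2 sqnormD sqnormB; field.
Qed.

Lemma Ex_lin_sqrM a c :
  Ex P (fun w => lin a w ^+ 2 * lin c w ^+ 2) =
  (sqnorm a * sqnorm c + 2 * dotf a c ^+ 2) / 4.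
Proof.
have -> : (fun w => lin a w ^+ 2 * lin c w ^+ 2) = (fun w =>
    12^-1 * lin (fun k => a k + c k) w ^+ 4 + (12^-1 * lin (fun k => a k - c k) w ^+ 4
    + (- 6^-1 * lin a w ^+ 4 + - 6^-1 * lin c w ^+ 4))).
  by apply/funext => w; rewrite linD linB; field.
have fZ (x : R) e : finite_moments P (fun w => x * lin e w ^+ 4).
  by apply: finite_momentsM; [exact: finite_moments_cst|exact: finite_momentsX].
do 3! (rewrite ExD; [|by do ? [exact: fZ | apply: finite_momentsD]
                     |by do ? [exact: fZ | apply: finite_momentsD]]).
rewrite !ExZ; try exact: finite_momentsX.
by rewrite !Ex_lin4 sqnormD sqnormB; field.
Qed.

Lemma Ex_lin_lin_sqr a c : Ex P (fun w => lin a w * lin c w ^+ 2) = 0.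
Proof.
have -> : (fun w => lin a w * lin c w ^+ 2) = (fun w =>
    6^-1 * lin (fun k => a k + c k) w ^+ 3 + (6^-1 * lin (fun k => a k - c k) w ^+ 3
    + - 3^-1 * lin a w ^+ 3)).
  by apply/funext => w; rewrite linD linB; field.
have fZ (x : R) e : finite_moments P (fun w => x * lin e w ^+ 3).
  by apply: finite_momentsM; [exact: finite_moments_cst|exact: finite_momentsX].
do 2! (rewrite ExD; [|by do ? [exact: fZ | apply: finite_momentsD]
                     |by do ? [exact: fZ | apply: finite_momentsD]]).
rewrite !ExZ; try exact: finite_momentsX.
by rewrite !Ex_lin3; field.
Qed.

Lemma Ex_lin_linM a c e : Ex P (fun w => lin a w * (lin c w * lin e w)) = 0.
Proof.
have -> : (fun w => lin a w * (lin c w * lin e w)) = (fun w =>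
    4^-1 * (lin a w * lin (fun k => c k + e k) w ^+ 2) +
    - 4^-1 * (lin a w * lin (fun k => c k - e k) w ^+ 2)).
  by apply/funext => w; rewrite linD linB; field.
have fM c' : finite_moments P (fun w => lin a w * lin c' w ^+ 2).
  by apply: finite_momentsM => //; exact: finite_momentsX.
have fZ (x : R) c' : finite_moments P (fun w => x * (lin a w * lin c' w ^+ 2)).
  by apply: finite_momentsM => //; exact: finite_moments_cst.
by rewrite ExD// !ExZ// !Ex_lin_lin_sqr; field.
Qed.

End GaussianFamily.

(** * The quartic form and its clipping *)

Section Quartic.
Context {R : realType}.

(** With s = s1 + i s2 and u = u1 + i u2, the two squares are those of the real and imaginary parts
    of u conj(s). Their sum is |s|^2 |u|^2, and twice the first one is the remaining term of G. *)
Definition quartic (s1 s2 u1 u2 : R) : R :=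
  3 * (u1 * s1 + u2 * s2) ^+ 2 + (u2 * s1 - u1 * s2) ^+ 2.

(** Factor of the radial retraction onto a square of half-side M. A factor common to both components
    can be pulled out of the quartic, so the clipped form is the quartic times a number at most
    1. *)
Definition shrink (M s1 s2 : R) : R := M / Num.max M (Num.max `|s1| `|s2|).

Definition clipped_quartic (M s1 s2 u1 u2 : R) : R :=
  quartic (shrink M s1 s2 * s1) (shrink M s1 s2 * s2)
          (shrink M u1 u2 * u1) (shrink M u1 u2 * u2).

Lemma quartic_ge0 s1 s2 u1 u2 : 0 <= quartic s1 s2 u1 u2.
Proof. by rewrite addr_ge0 ?sqr_ge0// mulr_ge0 ?sqr_ge0. Qed.

Lemma quarticZ (k l : R) s1 s2 u1 u2 :
  quartic (k * s1) (k * s2) (l * u1) (l * u2) = k ^+ 2 * l ^+ 2 * quartic s1 s2 u1 u2.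
Proof. by rewrite /quartic; ring. Qed.

Lemma quartic_le s1 s2 u1 u2 :
  quartic s1 s2 u1 u2 <= 3 * ((s1 ^+ 2 + s2 ^+ 2) * (u1 ^+ 2 + u2 ^+ 2)).
Proof.
rewrite /quartic -subr_ge0.
have -> : 3 * ((s1 ^+ 2 + s2 ^+ 2) * (u1 ^+ 2 + u2 ^+ 2)) -
  (3 * (u1 * s1 + u2 * s2) ^+ 2 + (u2 * s1 - u1 * s2) ^+ 2) =
  2 * (u2 * s1 - u1 * s2) ^+ 2 by ring.
by rewrite mulr_ge0// sqr_ge0.
Qed.

Section Clip.
Variable M : R.
Hypothesis M0 : 0 < M.

Let dn (s1 s2 : R) : R := Num.max M (Num.max `|s1| `|s2|).

Let dn_gt0 s1 s2 : 0 < dn s1 s2.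
Proof. by rewrite lt_max M0. Qed.

Lemma shrink_ge0 s1 s2 : 0 <= shrink M s1 s2.
Proof. by rewrite divr_ge0 ?ltW ?dn_gt0. Qed.

Lemma shrink_le1 s1 s2 : shrink M s1 s2 <= 1.
Proof. by rewrite /shrink ler_pdivrMr ?dn_gt0// mul1r le_max lexx. Qed.

Lemma shrink_norm_le s1 s2 :
  `|shrink M s1 s2 * s1| <= M /\ `|shrink M s1 s2 * s2| <= M.
Proof.
by split; rewrite normrM (ger0_norm (shrink_ge0 _ _)) /shrink mulrAC ler_pdivrMr ?dn_gt0// ler_wpM2l ?(ltW M0)//
  !le_max !lexx ?orbT//.
Qed.

(** The left side vanishes unless a component exceeds M, and then the right side is at least 1: a
    pointwise Markov inequality. *)
Lemma one_sub_sqr_shrink_le s1 s2 :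
  1 - shrink M s1 s2 ^+ 2 <= (s1 ^+ 2 + s2 ^+ 2) / M ^+ 2.
Proof.
have M20 : 0 < M ^+ 2 by rewrite exprn_gt0.
have s12 : 0 <= s1 ^+ 2 + s2 ^+ 2 by rewrite addr_ge0 ?sqr_ge0.
have [le|lt] := leP (Num.max `|s1| `|s2|) M.
  rewrite /shrink max_l// divff ?gt_eqF// expr1n subrr.
  by rewrite divr_ge0// ltW.
apply: (@le_trans _ _ 1); first by rewrite lerBlDr lerDl sqr_ge0.
rewrite ler_pdivlMr// mul1r.
move: lt; rewrite lt_max => /orP[] h.
  apply: (@le_trans _ _ (s1 ^+ 2)); last by rewrite lerDl sqr_ge0.
  by rewrite -(real_normK (num_real s1)); apply: lerXn2r; rewrite ?nnegrE// ltW.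
apply: (@le_trans _ _ (s2 ^+ 2)); last by rewrite lerDr sqr_ge0.
by rewrite -(real_normK (num_real s2)); apply: lerXn2r; rewrite ?nnegrE// ltW.
Qed.

Lemma shrink_lipschitz s1 s2 s1' s2' :
  let h := `|s1 - s1'| + `|s2 - s2'| in
  `|shrink M s1 s2 * s1 - shrink M s1' s2' * s1'| <= 2 * h /\
  `|shrink M s1 s2 * s2 - shrink M s1' s2' * s2'| <= 2 * h.
Proof.
move=> h; set n := dn s1 s2; set n' := dn s1' s2'.
have n0 : 0 < n by exact: dn_gt0.
have n'0 : 0 < n' by exact: dn_gt0.
have h0 : 0 <= h by rewrite addr_ge0.
have nh s t s' t' : `|s - s'| + `|t - t'| = h -> dn s t <= dn s' t' + h.
  move=> hE; rewrite /dn !ge_max; apply/and3P; split.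
  - by rewrite (@le_trans _ _ M)// ler_wpDr// le_max lexx.
  - apply: (@le_trans _ _ (`|s'| + h)); last by rewrite lerD2r !le_max lexx orbT.
    rewrite -hE addrA; apply: (@le_trans _ _ (`|s'| + `|s - s'|)); last by rewrite lerDl.
    by rewrite -{1}(subrK s' s) addrC (le_trans (ler_normD _ _)).
  - apply: (@le_trans _ _ (`|t'| + h)); last by rewrite lerD2r !le_max lexx !orbT.
    rewrite -hE addrCA; apply: (@le_trans _ _ (`|t'| + `|t - t'|)); last first.
      by rewrite lerDr.
    by rewrite -{1}(subrK t' t) addrC (le_trans (ler_normD _ _)).
have nn' : `|n' - n| <= h.
  rewrite ler_norml; apply/andP; split.
    by rewrite lerBrDl lerBlDr; apply: nh.
  by rewrite lerBlDl; apply: nh; rewrite (distrC s1') (distrC s2').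
have Mn : M <= n by rewrite /n /dn le_max lexx.
suff key s s' : `|s - s'| <= h -> `|s'| <= n' ->
    `|M / n * s - M / n' * s'| <= 2 * h.
  by split; apply: key; rewrite ?lerDl ?lerDr// /n' /dn !le_max lexx ?orbT.
move=> ss' s'n'.
(* M / n and |s'| / n' are at most 1 and the denominator is 1-Lipschitz, so each of the two terms
   costs at most h. *)
have -> : M / n * s - M / n' * s' = M / n * ((s - s') + s' / n' * (n' - n)).
  by field; rewrite !gt_eqF.
have Mn0 : 0 <= M / n by exact: divr_ge0 (ltW M0) (ltW n0).
rewrite normrM (ger0_norm Mn0).
apply: (@le_trans _ _ (1 * `|s - s' + s' / n' * (n' - n)|)).
  by rewrite ler_wpM2r// ler_pdivrMr// mul1r.
rewrite mul1r (le_trans (ler_normD _ _))// mulr_natl mulr2n lerD// normrM.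
rewrite -[leRHS]mul1r ler_pM// normrM normfV (gtr0_norm n'0).
by rewrite ler_pdivrMr// mul1r.
Qed.

Lemma clipped_quarticE s1 s2 u1 u2 : clipped_quartic M s1 s2 u1 u2 =
  shrink M s1 s2 ^+ 2 * shrink M u1 u2 ^+ 2 * quartic s1 s2 u1 u2.
Proof. exact: quarticZ. Qed.

Lemma clipped_quartic_ge0 s1 s2 u1 u2 : 0 <= clipped_quartic M s1 s2 u1 u2.
Proof. exact: quartic_ge0. Qed.

Lemma clipped_quartic_le s1 s2 u1 u2 :
  clipped_quartic M s1 s2 u1 u2 <= quartic s1 s2 u1 u2.
Proof.
rewrite clipped_quarticE ler_piMl ?quartic_ge0//.
by rewrite mulr_ile1 ?sqr_ge0// exprn_ile1 ?shrink_ge0 ?shrink_le1.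
Qed.

Lemma quartic_bounded s1 s2 u1 u2 :
  `|s1| <= M -> `|s2| <= M -> `|u1| <= M -> `|u2| <= M ->
  quartic s1 s2 u1 u2 <= 12 * M ^+ 4.
Proof.
move=> h1 h2 h3 h4; apply: (le_trans (quartic_le _ _ _ _)).
have sq s : `|s| <= M -> s ^+ 2 <= M ^+ 2.
  move=> h; rewrite -(real_normK (num_real s)); apply: lerXn2r; rewrite ?nnegrE//.
  exact: ltW.
have -> : 12 * M ^+ 4 = 3 * ((M ^+ 2 + M ^+ 2) * (M ^+ 2 + M ^+ 2)) by ring.
by rewrite ler_pM2l// ler_pM ?addr_ge0 ?sqr_ge0// lerD// sq.
Qed.

Lemma clipped_quartic_bounded s1 s2 u1 u2 : clipped_quartic M s1 s2 u1 u2 <= 12 * M ^+ 4.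
Proof.
have [? ?] := shrink_norm_le s1 s2; have [? ?] := shrink_norm_le u1 u2.
exact: quartic_bounded.
Qed.

(** For squared factors a, b at most 1, 1 - a b <= (1 - a) + (1 - b), and each term is paid by
    [one_sub_sqr_shrink_le]. The gain M^-2 is bought with two more degrees. *)
Lemma quartic_sub_clipped_le s1 s2 u1 u2 :
  quartic s1 s2 u1 u2 - clipped_quartic M s1 s2 u1 u2 <=
  3 / M ^+ 2 * ((s1 ^+ 2 + s2 ^+ 2) * (u1 ^+ 2 + u2 ^+ 2) *
    ((s1 ^+ 2 + s2 ^+ 2) + (u1 ^+ 2 + u2 ^+ 2))).
Proof.
rewrite clipped_quarticE.
have := one_sub_sqr_shrink_le s1 s2; have := one_sub_sqr_shrink_le u1 u2.
have := quartic_le s1 s2 u1 u2; have := quartic_ge0 s1 s2 u1 u2.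
have : shrink M s1 s2 ^+ 2 <= 1 by rewrite exprn_ile1 ?shrink_ge0 ?shrink_le1.
have : shrink M u1 u2 ^+ 2 <= 1 by rewrite exprn_ile1 ?shrink_ge0 ?shrink_le1.
have : 0 <= s1 ^+ 2 + s2 ^+ 2 by rewrite addr_ge0 ?sqr_ge0.
have : 0 <= u1 ^+ 2 + u2 ^+ 2 by rewrite addr_ge0 ?sqr_ge0.
set a := shrink M s1 s2 ^+ 2; set b := shrink M u1 u2 ^+ 2.
set S := s1 ^+ 2 + s2 ^+ 2; set U := u1 ^+ 2 + u2 ^+ 2; set Q := quartic _ _ _ _.
move=> U0 S0 b1 a1 Q0 QSU bU aS.
have -> : 3 / M ^+ 2 * (S * U * (S + U)) = 3 * (S * U) * (S / M ^+ 2 + U / M ^+ 2).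
  by ring.
apply: (@le_trans _ _ (Q * ((1 - a) + (1 - b)))).
  have : 0 <= Q * ((1 - a) * (1 - b)).
    by rewrite mulr_ge0// mulr_ge0// subr_ge0.
  by lra.
apply: ler_pM => //; last exact: lerD.
by rewrite addr_ge0// subr_ge0.
Qed.

Lemma quartic_lipschitz s1 s2 u1 u2 s1' s2' u1' u2' (h : R) :
  `|s1| <= M -> `|s2| <= M -> `|u1| <= M -> `|u2| <= M ->
  `|s1'| <= M -> `|s2'| <= M -> `|u1'| <= M -> `|u2'| <= M ->
  `|s1 - s1'| <= h -> `|s2 - s2'| <= h -> `|u1 - u1'| <= h -> `|u2 - u2'| <= h ->
  `|quartic s1 s2 u1 u2 - quartic s1' s2' u1' u2'| <= 64 * M ^+ 3 * h.
Proof.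
move=> S1 S2 U1 U2 S1' S2' U1' U2' d1 d2 d3 d4.
have M0' := ltW M0.
have prod x y x' y' : `|x| <= M -> `|y'| <= M -> `|x - x'| <= h -> `|y - y'| <= h ->
    `|x * y - x' * y'| <= 2 * (M * h).
  move=> xM y'M dx dy; have -> : x * y - x' * y' = x * (y - y') + (x - x') * y' by ring.
  have -> : 2 * (M * h) = M * h + h * M by ring.
  by rewrite (le_trans (ler_normD _ _))// !normrM lerD// ler_pM.
have bd x y : `|x| <= M -> `|y| <= M -> `|x * y| <= M ^+ 2.
  by move=> xM yM; rewrite normrM expr2 ler_pM.
have sqd a b (k l : R) : `|a| <= k -> `|b| <= k -> `|a - b| <= l ->
    `|a ^+ 2 - b ^+ 2| <= 2 * k * l.
  move=> ak bk abl; rewrite subr_sqr normrM mulrC ler_pM//.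
  have -> : 2 * k = k + k by ring.
  by rewrite (le_trans (ler_normD _ _))// lerD.
have q1 := prod _ _ _ _ U1 S1' d3 d1.
have q2 := prod _ _ _ _ U2 S2' d4 d2.
have q3 := prod _ _ _ _ U2 S1' d4 d1.
have q4 := prod _ _ _ _ U1 S2' d3 d2.
have A : `|(u1 * s1 + u2 * s2) ^+ 2 - (u1' * s1' + u2' * s2') ^+ 2| <=
    2 * (M ^+ 2 + M ^+ 2) * (2 * (M * h) + 2 * (M * h)).
  apply: sqd; [by rewrite (le_trans (ler_normD _ _))// lerD// bd|
    by rewrite (le_trans (ler_normD _ _))// lerD// bd|].
  have -> : u1 * s1 + u2 * s2 - (u1' * s1' + u2' * s2') =
    (u1 * s1 - u1' * s1') + (u2 * s2 - u2' * s2') by ring.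
  by rewrite (le_trans (ler_normD _ _))// lerD.
have B : `|(u2 * s1 - u1 * s2) ^+ 2 - (u2' * s1' - u1' * s2') ^+ 2| <=
    2 * (M ^+ 2 + M ^+ 2) * (2 * (M * h) + 2 * (M * h)).
  apply: sqd; [by rewrite (le_trans (ler_normB _ _))// lerD// bd|
    by rewrite (le_trans (ler_normB _ _))// lerD// bd|].
  have -> : u2 * s1 - u1 * s2 - (u2' * s1' - u1' * s2') =
    (u2 * s1 - u2' * s1') - (u1 * s2 - u1' * s2') by ring.
  by rewrite (le_trans (ler_normB _ _))// lerD.
rewrite /quartic.
set X := _ ^+ 2 in A *; set X' := _ ^+ 2 in A *.
set Y := _ ^+ 2 in B *; set Y' := _ ^+ 2 in B *.
have -> : 3 * X + Y - (3 * X' + Y') = 3 * (X - X') + (Y - Y') by ring.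
rewrite (le_trans (ler_normD _ _))// normrM (ger0_norm (ler0n _ 3)).
have -> : 64 * M ^+ 3 * h = 3 * (2 * (M ^+ 2 + M ^+ 2) * (2 * (M * h) + 2 * (M * h)))
  + 2 * (M ^+ 2 + M ^+ 2) * (2 * (M * h) + 2 * (M * h)) by ring.
by rewrite lerD// ler_wpM2l.
Qed.

Lemma clipped_quartic_lipschitz s1 s2 u1 u2 s1' s2' u1' u2' :
  `|clipped_quartic M s1 s2 u1 u2 - clipped_quartic M s1' s2' u1' u2'| <=
  128 * M ^+ 3 * ((`|s1 - s1'| + `|s2 - s2'|) + (`|u1 - u1'| + `|u2 - u2'|)).
Proof.
have [? ?] := shrink_norm_le s1 s2; have [? ?] := shrink_norm_le u1 u2.
have [? ?] := shrink_norm_le s1' s2'; have [? ?] := shrink_norm_le u1' u2'.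
have /=[a1 a2] := shrink_lipschitz s1 s2 s1' s2'.
have /=[b1 b2] := shrink_lipschitz u1 u2 u1' u2'.
set hs := `|s1 - s1'| + _ in a1 a2 *; set hu := `|u1 - u1'| + _ in b1 b2 *.
have hs0 : 0 <= hs by rewrite addr_ge0.
have hu0 : 0 <= hu by rewrite addr_ge0.
have -> : 128 * M ^+ 3 * (hs + hu) = 64 * M ^+ 3 * (2 * (hs + hu)) by ring.
by apply: quartic_lipschitz => //; lra.
Qed.

End Clip.
End Quartic.

Section GaussianSample.
Context {R : realType} {dT : measure_display} {T : measurableType dT}.
Variables (P : probability T R) (K : finType) (g : K -> T -> R).
Hypothesis mg : forall k, measurable_fun setT (g k).
Hypothesis mgf : forall c,
  (\int[P]_w (expR (lin g c w))%:E = (expR (sqnorm c / 4))%:E)%E.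
Local Notation lin := (lin g).

(** Linearization of the square: exp (s^2/2) is the transform of a standard normal N at s. After
    Tonelli the known transform of s leaves E exp (N^2 |c|^2 / 4). *)
Lemma integral_exp_sqr_half c : sqnorm c <= 1 ->
  (\int[P]_w (expR (lin c w ^+ 2 / 2))%:E <= (3 / 2 : R)%:E)%E.
Proof.
move=> c1; pose N := (normal_prob 0 1 : probability (measurableTypeR R) R).
pose F (z : T * R) := (expR (lin c z.1 * z.2))%:E.
have mF : measurable_fun setT F.
  apply/measurable_EFinP; apply: measurableT_comp => //.
  apply: measurable_funM; last exact: measurable_snd.
  exact: (measurableT_comp (measurable_lin mg c) measurable_fst).
have F0 z : (0 <= F z)%E by rewrite lee_fin expR_ge0.
have -> : (\int[P]_w (expR (lin c w ^+ 2 / 2))%:E = \int[P]_w \int[N]_x F (w, x))%E.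
  apply: eq_integral => w _; rewrite /F /= normal_mgf ?oner_neq0//.
  by rewrite expr1n mulr1.
rewrite fubini_tonelli//.
apply: le_trans (normal_exp_sqr_quarter).
apply: ge0_le_integral => //.
- by move=> x _; apply: integral_ge0.
- exact: measurable_fun_fubini_tonelli_G.
- apply/measurable_EFinP; apply: measurableT_comp => //.
  by apply: measurable_funM => //; exact: measurable_funX.
move=> x _; rewrite /F/=.
under eq_integral do rewrite mulrC.
rewrite mgf_scaled// lee_fin ler_expR.
by rewrite mulrA ler_pM2r// ler_piMr ?sqr_ge0.
Qed.

Definition sqmod c c' w := lin c w ^+ 2 + lin c' w ^+ 2.

Lemma sqmod_ge0 c c' w : 0 <= sqmod c c' w.
Proof. by rewrite addr_ge0 ?sqr_ge0. Qed.

Lemma measurable_sqmod c c' : measurable_fun setT (sqmod c c').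
Proof. by apply: measurable_funD; apply: measurable_funX; exact: measurable_lin. Qed.

Lemma measurable_exp_sqmod (t : R) c c' :
  measurable_fun setT (fun w => expR (sqmod c c' w * t)).
Proof.
by apply: measurableT_comp => //; apply: measurable_funM => //; exact: measurable_sqmod.
Qed.

(** exp ((a + b)/4) is at most the mean of exp (a/2) and exp (b/2), so only the marginal laws of the
    two forms matter. *)
Lemma integral_exp_sqmod c c' : sqnorm c <= 1 -> sqnorm c' <= 1 ->
  (\int[P]_w (expR (sqmod c c' w / 4))%:E <= (3 / 2 : R)%:E)%E.
Proof.
move=> c1 c1'.
have me x : measurable_fun setT (fun w => (expR (lin x w ^+ 2 / 2))%:E).
  apply/measurable_EFinP; apply: measurableT_comp => //.
  by apply: measurable_funM => //; apply: measurable_funX; exact: measurable_lin.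
apply: (@le_trans _ _ (\int[P]_w ((1 / 2 : R)%:E * ((expR (lin c w ^+ 2 / 2))%:E +
    (expR (lin c' w ^+ 2 / 2))%:E)))%E).
  apply: ge0_le_integral => //.
  - by apply/measurable_EFinP; exact: measurable_exp_sqmod.
  - by apply: emeasurable_funM => //; exact: emeasurable_funD.
  move=> w _; rewrite -EFinD -EFinM lee_fin /sqmod.
  set a := lin c w ^+ 2; set b := lin c' w ^+ 2.
  have -> : (a + b) / 4 = a / 4 + b / 4 by ring.
  have -> : a / 2 = a / 4 + a / 4 by field.
  have -> : b / 2 = b / 4 + b / 4 by field.
  rewrite !expRD; have := sqr_ge0 (expR (a / 4) - expR (b / 4)).
  by nra.
rewrite ge0_integralZl//; try solve [exact: emeasurable_funD|by rewrite lee_fin|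
  by move=> w _; rewrite -EFinD lee_fin addr_ge0 ?expR_ge0].
rewrite ge0_integralD//; try by move=> w _; rewrite lee_fin expR_ge0.
have -> : (3 / 2 : R)%:E = ((1 / 2 : R)%:E * ((3 / 2 : R)%:E + (3 / 2 : R)%:E))%E.
  by rewrite -EFinD -EFinM; congr EFin; field.
apply: lee_wpmul2l; first by rewrite lee_fin.
by apply: leeD; exact: integral_exp_sqr_half.
Qed.

(** Common shape of the estimates that follow: [h] carries a part with known expectation, and the
    errors are dominated by two exponentials. *)
Lemma ge0_integral_le_affine (f h e1 e2 : T -> R) (A B : R) :
  measurable_fun setT f -> finite_moments P h ->
  measurable_fun setT e1 -> measurable_fun setT e2 ->
  0 <= A -> 0 <= B ->
  (forall w, 0 <= f w) -> (forall w, 0 <= h w) ->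
  (forall w, 0 <= e1 w) -> (forall w, 0 <= e2 w) ->
  (\int[P]_w (e1 w)%:E <= (3 / 2 : R)%:E)%E ->
  (\int[P]_w (e2 w)%:E <= (3 / 2 : R)%:E)%E ->
  (forall w, f w <= h w + (A * e1 w + B * e2 w)) ->
  (\int[P]_w (f w)%:E <= (Ex P h + (A + B) * (3 / 2))%:E)%E.
Proof.
move=> mf fh me1 me2 A0 B0 f0 h0 e10 e20 ie1 ie2 H.
have mh := finite_moments_measurable fh.
apply: (@le_trans _ _ (\int[P]_w ((h w)%:E + (A%:E * (e1 w)%:E + B%:E * (e2 w)%:E)))%E).
  apply: ge0_le_integral => //; try solve [exact/measurable_EFinP|
    by move=> w _; rewrite ?[(_ * _)%E]EFinM -?EFinD lee_fin].
  apply: emeasurable_funD; first exact/measurable_EFinP.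
  by apply: emeasurable_funD; apply: emeasurable_funM => //; exact/measurable_EFinP.
rewrite ge0_integralD//; try solve [exact/measurable_EFinP|
  by move=> w _; rewrite lee_fin|
  by move=> w _; rewrite -!EFinM -!EFinD lee_fin addr_ge0// mulr_ge0|
  by apply: emeasurable_funD; apply: emeasurable_funM => //; exact/measurable_EFinP].
rewrite EFin_Ex// EFinD leeD2l// mulrDl EFinD.
rewrite ge0_integralD//; try solve [by move=> w _; rewrite -!EFinM lee_fin mulr_ge0|
  by apply: emeasurable_funM => //; exact/measurable_EFinP].
rewrite !ge0_integralZl//; try solve [by move=> w _; rewrite lee_fin|exact/measurable_EFinP].
by rewrite !EFinM; apply: leeD; apply: lee_wpmul2l; rewrite ?lee_fin.
Qed.


Let cst := finite_moments_cst P.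
Let fl := finite_moments_lin mg mgf.

Ltac fmom := repeat first [exact: cst | exact: fl | apply: finite_momentsD |
  apply: finite_momentsX | apply: finite_momentsM].

(** * Exponential moments of one sample *)

Section OneSample.
Variables (x x' c c' e e' : K -> R) (b1 b2 : R).
Hypotheses (nx : sqnorm x <= 1) (nx' : sqnorm x' = sqnorm x) (dx : dotf x x' = 0).
Hypotheses (nc : sqnorm c <= 1) (nc' : sqnorm c' = sqnorm c) (dc : dotf c c' = 0).
Hypotheses (ne : sqnorm e <= 1) (ne' : sqnorm e' = sqnorm e) (de : dotf e e' = 0).

Local Notation beta := (b1 ^+ 2 + b2 ^+ 2).

Definition intensity w := (lin x w + b1) ^+ 2 + (lin x' w + b2) ^+ 2.

Lemma intensity_ge0 w : 0 <= intensity w.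
Proof. by rewrite addr_ge0 ?sqr_ge0. Qed.

Lemma finite_moments_intensity : finite_moments P (fun w => intensity w * sqmod c c' w).
Proof. rewrite /intensity /sqmod; fmom. Qed.

Lemma measurable_intensity : measurable_fun setT intensity.
Proof.
by apply: measurable_funD; apply: measurable_funX; apply: measurable_funD => //;
  exact: measurable_lin.
Qed.

(** |a^* x|^2 |a^* v|^2 is replaced by half the sum of the fourth powers, which is exact for v = x;
    E |a^* v|^4 = 2 |v|^4 then gives the 2. Terms linear in b have odd degree in the Gaussians and
    vanish. *)
Lemma Ex_intensity_le : Ex P (fun w => intensity w * sqmod c c' w) <= beta + 2.
Proof.
pose h w := 1 / 2 * lin x w ^+ 4 + (1 / 2 * lin x' w ^+ 4 + (1 / 2 * lin c w ^+ 4 +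
  (1 / 2 * lin c' w ^+ 4 + (1 * (lin x w ^+ 2 * lin x' w ^+ 2) +
  (1 * (lin c w ^+ 2 * lin c' w ^+ 2) +
  (2 * b1 * (lin x w * lin c w ^+ 2) + (2 * b1 * (lin x w * lin c' w ^+ 2) +
  (2 * b2 * (lin x' w * lin c w ^+ 2) + (2 * b2 * (lin x' w * lin c' w ^+ 2) +
  (beta * lin c w ^+ 2 + beta * lin c' w ^+ 2)))))))))).
apply: (@le_trans _ _ (Ex P h)).
  apply: Ex_le; [exact: finite_moments_intensity|rewrite /h; fmom|].
  move=> w; rewrite /intensity /sqmod /h.
  have := sqr_ge0 (lin x w ^+ 2 + lin x' w ^+ 2 - (lin c w ^+ 2 + lin c' w ^+ 2)).
  by nra.
have -> : Ex P h = 1 / 2 * (3 / 4 * sqnorm x ^+ 2) + (1 / 2 * (3 / 4 * sqnorm x ^+ 2) +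
  (1 / 2 * (3 / 4 * sqnorm c ^+ 2) + (1 / 2 * (3 / 4 * sqnorm c ^+ 2) +
  (1 * (sqnorm x * sqnorm x / 4) + (1 * (sqnorm c * sqnorm c / 4) +
  beta * sqnorm c))))).
  rewrite /h; do 11! (rewrite ExD; [|fmom|fmom]); rewrite !ExZ; try fmom.
  rewrite !Ex_lin4// !Ex_lin_sqrM// !Ex_lin_lin_sqr// !Ex_lin2//.
  by rewrite nx' nc' dx dc; field.
have := sqnorm_ge0 x; have := sqnorm_ge0 c.
have : 0 <= beta by rewrite addr_ge0 ?sqr_ge0.
move: (sqnorm x) (sqnorm c) nx nc beta => X C X1 C1 B B0 C0 X0.
have X2 : X ^+ 2 <= 1 by rewrite exprn_ile1.
have C2 : C ^+ 2 <= 1 by rewrite exprn_ile1.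
have BC : B * C <= B by rewrite ler_piMr.
by nra.
Qed.

End OneSample.
End GaussianSample.

Lemma chernoff {R : realType} {dT : measure_display} {T : measurableType dT}
    (P : probability T R) (f : T -> R) (a A : R) :
  measurable_fun setT f -> (\int[P]_w (expR (f w))%:E <= A%:E)%E ->
  (P [set w | (a <= f w)%R] <= (A * expR (- a))%:E)%E.
Proof.
move=> mf fA; set E := [set w | _].
have mE : measurable E.
  rewrite [X in measurable X](_ : _ = setT `&` f @^-1` `[a, +oo[).
    exact: mf.
  by rewrite setTI; apply/seteqP; split => w; rewrite /E/= in_itv/= andbT.
have : ((expR a)%:E * P E <= A%:E)%E.
  apply: le_trans fA; rewrite -integral_cst//.
  apply: (@le_trans _ _ (\int[P]_(w in E) (expR (f w))%:E)%E).
    apply: ge0_le_integral => //; try solve [by move=> w Ew; rewrite lee_fin ?expR_ge0 ?ler_expR|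
      by apply/measurable_EFinP; apply: measurable_funTS; exact: measurableT_comp].
  apply: ge0_subset_integral => //.
  by apply/measurable_EFinP; exact: measurableT_comp.
rewrite muleC -lee_pdivlMr ?expR_gt0// expRN.
by rewrite EFinM.
Qed.

Section SampleTails.
Context {R : realType} {dT : measure_display} {T : measurableType dT}.
Variables (P : probability T R) (K : finType) (g : K -> T -> R).
Hypothesis mg : forall k, measurable_fun setT (g k).
Hypothesis mgf : forall c,
  (\int[P]_w (expR (lin g c w))%:E = (expR (sqnorm c / 4))%:E)%E.
Local Notation lin := (lin g).
Local Notation sqmod := (sqmod g).

Let cst := finite_moments_cst P.
Let fl := finite_moments_lin mg mgf.

Ltac fmom := repeat first [exact: cst | exact: fl | apply: finite_momentsD |
  apply: finite_momentsX | apply: finite_momentsM].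

Variables (x x' c c' : K -> R) (b1 b2 : R).
Hypotheses (nx : sqnorm x <= 1) (nx' : sqnorm x' = sqnorm x) (dx : dotf x x' = 0).
Hypotheses (nc : sqnorm c <= 1) (nc' : sqnorm c' = sqnorm c) (dc : dotf c c' = 0).

Local Notation beta := (b1 ^+ 2 + b2 ^+ 2).
Local Notation y := (intensity g x x' b1 b2).

Let beta_ge0 : 0 <= beta. Proof. by rewrite addr_ge0 ?sqr_ge0. Qed.

Lemma intensity_le w : y w ^+ 2 <= 8 * sqmod x x' w ^+ 2 + 8 * beta ^+ 2.
Proof.
have y2 : y w <= 2 * (sqmod x x' w + beta).
  rewrite /intensity /sqmod.
  have := sqr_ge0 (lin x w - b1); have := sqr_ge0 (lin x' w - b2); nra.
have := sqr_ge0 (sqmod x x' w - beta).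
have : y w ^+ 2 <= (2 * (sqmod x x' w + beta)) ^+ 2.
  by rewrite lerXn2r ?nnegrE ?intensity_ge0// mulr_ge0// addr_ge0// sqmod_ge0.
by nra.
Qed.

(** In exp X <= 1 + X + X^2 exp X the minimum is kept only in the last exponent, where lam Lam <=
    1/16 leaves exp (s/16) with s = |a^* v|^2. Elsewhere it is bounded by the full intensity, so the
    first-order term is the exact mean. *)
Lemma mgf_clipped_intensity (lam Lam : R) :
  0 <= lam -> 0 <= Lam -> lam * Lam <= 16^-1 ->
  (\int[P]_w (expR (lam * (Num.min (y w) Lam * sqmod c c' w)))%:E <=
   (expR (lam * (beta + 2) + lam ^+ 2 * (10 ^+ 7 * (1 + beta ^+ 2))))%:E)%E.
Proof.
move=> lam0 Lam0 lamLam.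
pose h w := 1 + lam * (y w * sqmod c c' w).
have fyc := finite_moments_intensity mg mgf x x' c c' b1 b2.
have fh : finite_moments P h.
  by apply: finite_momentsD => //; apply: finite_momentsM.
have nc1' : sqnorm c' <= 1 by rewrite nc'.
have nx1' : sqnorm x' <= 1 by rewrite nx'.
have my : measurable_fun setT y by exact: measurable_intensity.
have mc : measurable_fun setT (sqmod c c') by exact: measurable_sqmod.
apply: le_trans.
  apply: (@ge0_integral_le_affine _ _ _ P _ h (fun w => expR (sqmod x x' w / 4))
    (fun w => expR (sqmod c c' w / 4)) (lam ^+ 2 * ((64 * 64) * 64))
    (lam ^+ 2 * ((64 * 64) * (64 + beta ^+ 2)))) => //.
  - apply: measurableT_comp => //; apply: measurable_funM => //.
    by apply: measurable_funM => //; exact: measurable_minr.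
  - exact: measurable_exp_sqmod.
  - exact: measurable_exp_sqmod.
  - by rewrite mulr_ge0 ?sqr_ge0.
  - by rewrite mulr_ge0 ?sqr_ge0// mulr_ge0// addr_ge0// sqr_ge0.
  - by move=> w; rewrite addr_ge0// mulr_ge0// mulr_ge0 ?sqmod_ge0 ?intensity_ge0.
  - exact: integral_exp_sqmod.
  - exact: integral_exp_sqmod.
  move=> w; rewrite /h; have s0 := sqmod_ge0 g c c' w; have k0 := sqmod_ge0 g x x' w.
  have y0 := intensity_ge0 g x x' b1 b2 w; have yle := intensity_le w.
  move: (sqmod c c' w) (sqmod x x' w) (y w) s0 k0 y0 yle => s k yw s0 k0 y0 yle.
  set W := Num.min yw Lam * s.
  have W0 : 0 <= W by rewrite mulr_ge0// le_min y0.
  have W1 : W <= yw * s by rewrite ler_wpM2r// ge_min lexx.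
  have W2 : lam * W <= s / 16.
    rewrite /W mulrA [s / 16]mulrC ler_wpM2r//; apply: le_trans lamLam.
    by rewrite ler_wpM2l// ge_min lexx orbT.
  apply: (le_trans (expR_le_quadratic (mulr_ge0 lam0 W0))).
  rewrite -!addrA lerD2l; apply: lerD; first exact: ler_wpM2l.
  apply: (@le_trans _ _ (lam ^+ 2 * ((yw * s) ^+ 2 * expR (s / 16)))).
    have -> : (lam * W) ^+ 2 * expR (lam * W) = lam ^+ 2 * (W ^+ 2 * expR (lam * W)).
      by ring.
    apply: ler_wpM2l; first exact: sqr_ge0.
    apply: ler_pM; rewrite ?sqr_ge0 ?expR_ge0 ?ler_expR//.
    by apply: lerXn2r => //; rewrite nnegrE mulr_ge0.
  rewrite -[X in _ <= X + _](mulrA (lam ^+ 2)) -[X in _ <= _ + X](mulrA (lam ^+ 2)).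
  rewrite -mulrDr; apply: ler_wpM2l; first exact: sqr_ge0.
  (* The monomials are absorbed at rates k/8 and s/16; with the exp (s/16) already present this
     makes exp (k/8) exp (s/8), and 2 p q <= p^2 + q^2 ends at the integrable exp (k/4) and exp
     (s/4). *)
  have Ek : k ^+ 2 <= 128 * expR (k / 8).
    have := @expR_ge_monomial _ 2 (k / 8); rewrite divr_ge0// => /(_ isT).
    rewrite (_ : 2`! = 2)%N// => H.
    have -> : k ^+ 2 = 64 * (k / 8) ^+ 2 by field.
    by lra.
  have Es : s ^+ 2 <= 512 * expR (s / 16).
    have := @expR_ge_monomial _ 2 (s / 16); rewrite divr_ge0// => /(_ isT).
    rewrite (_ : 2`! = 2)%N// => H.
    have -> : s ^+ 2 = 256 * (s / 16) ^+ 2 by field.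
    by lra.
  have -> : s / 4 = s / 8 + s / 8 by field.
  have -> : k / 4 = k / 8 + k / 8 by field.
  rewrite !expRD; have e8 : expR (s / 8) = expR (s / 16) * expR (s / 16).
    by rewrite -expRD; congr expR; field.
  have e1 : 1 <= expR (s / 8) by rewrite -expR0 ler_expR divr_ge0.
  apply: (@le_trans _ _ ((8 * k ^+ 2 + 8 * beta ^+ 2) * (512 * expR (s / 8)))).
    rewrite exprMn -[leLHS](mulrA (yw ^+ 2)); apply: ler_pM => //.
    - exact: sqr_ge0.
    - by rewrite mulr_ge0 ?sqr_ge0 ?expR_ge0.
    by rewrite e8 [leRHS](mulrA 512) ler_wpM2r ?expR_ge0.
  move: Ek e1 (expR_gt0 (k / 8)) (sqr_ge0 (expR (k / 8) - expR (s / 8))) (sqr_ge0 beta).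
  move: (expR (k / 8)) (expR (s / 8)) (beta ^+ 2) (k ^+ 2) => ek es b k2 H1 H2 H3 H4 H5.
  have H6 : k2 * es <= 128 * ek * es by rewrite ler_wpM2r//; lra.
  have H7 : b * es <= b * (es * es) by rewrite ler_wpM2l// ler_peMr//; lra.
  by nra.
rewrite lee_fin -{1}[Ex P h]/(Ex P h).
have -> : Ex P h = 1 + lam * Ex P (fun w => y w * sqmod c c' w).
  rewrite /h ExD//; last by apply: finite_momentsM.
  by rewrite ExZ// Ex_cst.
have := Ex_intensity_le mg mgf b1 b2 nx nx' dx nc nc' dc.
set E := Ex _ _ => HE.
apply: le_trans (expR_ge1Dx _).
have : lam * E <= lam * (beta + 2) by rewrite ler_wpM2l.
have : 0 <= lam ^+ 2 by exact: sqr_ge0.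
have := sqr_ge0 beta.
move: (beta ^+ 2) (lam ^+ 2) (lam * E) (lam * (beta + 2)) => B l p q *.
have : 0 <= l * B by exact: mulr_ge0.
by lra.
Qed.

Lemma prob_sqmod_ge (tau : R) :
  (P [set w | (tau <= sqmod c c' w)%R] <= (3 / 2 * expR (- (tau / 4)))%:E)%E.
Proof.
have -> : [set w | tau <= sqmod c c' w] = [set w | tau / 4 <= sqmod c c' w / 4].
  by apply/seteqP; split => w /=; rewrite ler_pM2r.
apply: chernoff; last by apply: integral_exp_sqmod; rewrite ?nc'.
by apply: measurable_funM => //; exact: measurable_sqmod.
Qed.

Local Notation u1 := (fun w => lin x w + b1).
Local Notation u2 := (fun w => lin x' w + b2).

(** From the purely Gaussian part, p = a^* x, the term 2 (Re (p conj s))^2 is dropped; the rest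
    |p|^2 |s|^2 has expectation at least |x|^2 |c|^2 by the fourth-moment formula. Terms linear in b
    vanish by parity, those quadratic in b are kept exactly. *)
Lemma Ex_quartic_ge :
  sqnorm x * sqnorm c + 2 * beta * sqnorm c <=
  Ex P (fun w => quartic (lin c w) (lin c' w) (u1 w) (u2 w)).
Proof.
pose h w := 1 * (lin x w ^+ 2 * lin c w ^+ 2) + (1 * (lin x w ^+ 2 * lin c' w ^+ 2) +
  (1 * (lin x' w ^+ 2 * lin c w ^+ 2) + (1 * (lin x' w ^+ 2 * lin c' w ^+ 2) +
  (6 * b1 * (lin x w * lin c w ^+ 2) + (2 * b1 * (lin x w * lin c' w ^+ 2) +
  (4 * b2 * (lin x w * (lin c w * lin c' w)) + (6 * b2 * (lin x' w * lin c' w ^+ 2) +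
  (2 * b2 * (lin x' w * lin c w ^+ 2) + (4 * b1 * (lin x' w * (lin c w * lin c' w)) +
  ((3 * b1 ^+ 2 + b2 ^+ 2) * lin c w ^+ 2 + ((3 * b2 ^+ 2 + b1 ^+ 2) * lin c' w ^+ 2 +
  (4 * b1 * b2) * (lin c w * lin c' w)))))))))))).
apply: (@le_trans _ _ (Ex P h)); last first.
  apply: Ex_le; [rewrite /h; fmom|rewrite /quartic; do ! (fmom; try apply: finite_momentsN)|].
  move=> w; rewrite /quartic /h -subr_ge0.
  set s1 := lin c w; set s2 := lin c' w; set p1 := lin x w; set p2 := lin x' w.
  set D := (X in 0 <= X); have -> : D = 2 * (p1 * s1 + p2 * s2) ^+ 2.
    by rewrite /D; ring.
  by rewrite mulr_ge0// sqr_ge0.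
have -> : Ex P h = (sqnorm x * sqnorm c + 2 * dotf x c ^+ 2) / 4 +
   ((sqnorm x * sqnorm c + 2 * dotf x c' ^+ 2) / 4 +
   ((sqnorm x * sqnorm c + 2 * dotf x' c ^+ 2) / 4 +
   ((sqnorm x * sqnorm c + 2 * dotf x' c' ^+ 2) / 4 + 2 * beta * sqnorm c))).
  rewrite /h; do 12! (rewrite ExD; [|fmom|fmom]); rewrite !ExZ; try fmom.
  rewrite !Ex_lin_sqrM// !Ex_lin_lin_sqr// !Ex_lin_linM// !Ex_lin2// Ex_linM//.
  by rewrite nx' nc' dc; field.
have := sqr_ge0 (dotf x c); have := sqr_ge0 (dotf x c').
have := sqr_ge0 (dotf x' c); have := sqr_ge0 (dotf x' c').
by lra.
Qed.

End SampleTails.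

Lemma measurable_funV_pos {R : realType} {dT : measure_display} {T : measurableType dT}
    (f : T -> R) : measurable_fun setT f -> (forall w, 0 < f w) ->
  measurable_fun setT (fun w => (f w)^-1).
Proof.
move=> mf f0.
have -> : (fun w => (f w)^-1) = (fun w => expR (- ln (f w))).
  by apply/funext => w; rewrite expRN lnK// posrE.
apply: measurableT_comp => //; apply: measurableT_comp => //.
exact: measurableT_comp.
Qed.

Lemma measurable_shrink {R : realType} {dT : measure_display} {T : measurableType dT}
    (M : R) (f g : T -> R) : 0 < M -> measurable_fun setT f -> measurable_fun setT g ->
  measurable_fun setT (fun w => shrink M (f w) (g w)).
Proof.
move=> M0 mf mg; apply: measurable_funM => //.
apply: measurable_funV_pos; last by move=> w; rewrite lt_max M0.
by apply: measurable_maxr => //; apply: measurable_maxr; exact: measurableT_comp.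
Qed.

Lemma measurable_clipped_quartic {R : realType} {dT : measure_display}
    {T : measurableType dT} (M : R) (s1 s2 u1 u2 : T -> R) : 0 < M ->
  measurable_fun setT s1 -> measurable_fun setT s2 ->
  measurable_fun setT u1 -> measurable_fun setT u2 ->
  measurable_fun setT (fun w => clipped_quartic M (s1 w) (s2 w) (u1 w) (u2 w)).
Proof.
move=> M0 m1 m2 m3 m4; rewrite /clipped_quartic /quartic.
have ms := measurable_shrink M0 m1 m2; have mu := measurable_shrink M0 m3 m4.
apply: measurable_funD; first apply: measurable_funM => //.
  by apply: measurable_funX; apply: measurable_funD; apply: measurable_funM;
    exact: measurable_funM.
by apply: measurable_funX; apply: measurable_funB; apply: measurable_funM;
  exact: measurable_funM.
Qed.

Lemma finite_moments_bounded {R : realType} {dT : measure_display} {T : measurableType dT}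
    (P : probability T R) (f : T -> R) (B : R) :
  measurable_fun setT f -> (forall w, `|f w| <= B) -> finite_moments P f.
Proof.
move=> mf fB; apply: (@finite_moments_dominated _ _ _ _ _ (fun k _ => B ^+ k)) => //.
- by move=> k w; apply: lerXn2r => //; rewrite nnegrE// (le_trans _ (fB w)).
- by move=> k; rewrite (EFin_Ex (finite_moments_cst P _)) ltry.
Qed.

Section QuarticTail.
Context {R : realType} {dT : measure_display} {T : measurableType dT}.
Variables (P : probability T R) (K : finType) (g : K -> T -> R).
Hypothesis mg : forall k, measurable_fun setT (g k).
Hypothesis mgf : forall c,
  (\int[P]_w (expR (lin g c w))%:E = (expR (sqnorm c / 4))%:E)%E.
Local Notation lin := (lin g).
Local Notation sqmod := (sqmod g).

Let cst := finite_moments_cst P.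
Let fl := finite_moments_lin mg mgf.

Ltac fmom := repeat first [exact: cst | exact: fl | apply: finite_momentsD |
  apply: finite_momentsX | apply: finite_momentsM].

Variables (x x' c c' : K -> R) (b1 b2 : R).
Hypotheses (nx : sqnorm x <= 1) (nx' : sqnorm x' = sqnorm x) (dx : dotf x x' = 0).
Hypotheses (nc : sqnorm c <= 1) (nc' : sqnorm c' = sqnorm c) (dc : dotf c c' = 0).
Variable M : R.
Hypothesis M0 : 0 < M.

Local Notation beta := (b1 ^+ 2 + b2 ^+ 2).
Local Notation u1 := (fun w => lin x w + b1).
Local Notation u2 := (fun w => lin x' w + b2).
Local Notation Q := (fun w => quartic (lin c w) (lin c' w) (u1 w) (u2 w)).

Definition clipped_sample w := clipped_quartic M (lin c w) (lin c' w) (lin x w + b1) (lin x' w + b2).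
Local Notation H := clipped_sample.


Lemma measurable_clipped_sample : measurable_fun setT H.
Proof.
by apply: measurable_clipped_quartic => //; do ? (apply: measurable_funD => //);
  exact: measurable_lin.
Qed.

Lemma finite_moments_clipped_sample : finite_moments P H.
Proof.
apply: (finite_moments_bounded _ (B := 12 * M ^+ 4)); first exact: measurable_clipped_sample.
move=> w; rewrite ger0_norm ?clipped_quartic_ge0//; exact: clipped_quartic_bounded.
Qed.

Lemma finite_moments_quartic : finite_moments P Q.
Proof. by rewrite /quartic; do ! (fmom; try apply: finite_momentsN). Qed.

(** After [intensity_le] the degree-six gap only involves powers up to 4 of the two Gaussian moduli
    and beta^2, all dominated by exponentials at rate 1/4. *)
Lemma Ex_clipping_loss :
  Ex P (fun w => Q w + - 1 * H w) <= 10 ^+ 6 * (1 + beta ^+ 2) / M ^+ 2.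
Proof.
have nc1' : sqnorm c' <= 1 by rewrite nc'.
have nx1' : sqnorm x' <= 1 by rewrite nx'.
have fD : finite_moments P (fun w => Q w + - 1 * H w).
  apply: finite_momentsD; first exact: finite_moments_quartic.
  by apply: finite_momentsM => //; exact: finite_moments_clipped_sample.
have D0 w : 0 <= Q w + - 1 * H w by rewrite mulN1r subr_ge0; exact: clipped_quartic_le.
have M2 : 0 < M ^+ 2 by rewrite exprn_gt0.
rewrite -lee_fin -EFin_Ex//; apply: le_trans.
  apply: (@ge0_integral_le_affine _ _ _ P _ (fun=> 3 / M ^+ 2 * (4 * beta ^+ 2))
    (fun w => expR (sqmod x x' w / 4)) (fun w => expR (sqmod c c' w / 4))
    (3 / M ^+ 2 * (200 * 200)) (3 / M ^+ 2 * (64 * 64 + 32 * beta ^+ 2))) => //.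
  - exact: finite_moments_measurable fD.
  - exact: measurable_exp_sqmod.
  - exact: measurable_exp_sqmod.
  - by rewrite mulr_ge0// divr_ge0// ltW.
  - by rewrite mulr_ge0// ?divr_ge0// ?(ltW M2)// addr_ge0// mulr_ge0// sqr_ge0.
  - by move=> w; rewrite mulr_ge0// ?divr_ge0// ?(ltW M2)// mulr_ge0// sqr_ge0.
  - exact: integral_exp_sqmod.
  - exact: integral_exp_sqmod.
  move=> w; rewrite mulN1r; apply: (le_trans (quartic_sub_clipped_le M0 _ _ _ _)).
  rewrite -/(sqmod c c' w) -/(intensity g x x' b1 b2 w).
  have := sqmod_ge0 g c c' w; have := sqmod_ge0 g x x' w.
  have := intensity_ge0 g x x' b1 b2 w; have := intensity_le g x x' b1 b2 w.
  set u := intensity _ _ _ _ _ _; set s := sqmod c c' w; set k := sqmod x x' w.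
  move=> uk u0 k0 s0.
  set A := 200 * 200; set B := 64 * 64 + 32 * _; set r := 3 / M ^+ 2.
  have -> : r * (4 * beta ^+ 2) + (r * A * expR (k / 4) + r * B * expR (s / 4)) =
    r * (4 * beta ^+ 2 + (A * expR (k / 4) + B * expR (s / 4))) by ring.
  apply: ler_wpM2l; first by rewrite divr_ge0 ?(ltW M2).
  rewrite {}/A {}/B {}/r.
  have E4 (z : R) : 0 <= z -> z ^+ 4 <= 80 * 80 * expR (z / 4).
    move=> z0; have := @expR_ge_monomial _ 4 (z / 4); rewrite divr_ge0// => /(_ isT).
    rewrite (_ : 4`! = 24)%N// => h.
    have -> : z ^+ 4 = 16 * 16 * (z / 4) ^+ 4 by field.
    by have := expR_gt0 (z / 4); lra.
  have E2 (z : R) : 0 <= z -> z ^+ 2 <= 32 * expR (z / 4).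
    move=> z0; have := @expR_ge_monomial _ 2 (z / 4); rewrite divr_ge0// => /(_ isT).
    rewrite (_ : 2`! = 2)%N// => h.
    have -> : z ^+ 2 = 16 * (z / 4) ^+ 2 by field.
    by lra.
  have E1 (z : R) : z <= 4 * expR (z / 4).
    have := expR_ge1Dx (z / 4); lra.
  have := E4 _ s0; have := E4 _ k0; have := E2 _ s0; have := E2 _ k0; have := E1 s.
  have := expR_gt0 (s / 4); have := expR_gt0 (k / 4).
  have := sqr_ge0 beta.
  move: (expR (s / 4)) (expR (k / 4)) => es ek B0 ek0 es0 A1 A2 A3 A4 A5.
  have F1 : s ^+ 2 * u <= 1 / 2 * s ^+ 4 + 1 / 2 * u ^+ 2.
    by have := sqr_ge0 (s ^+ 2 - u); nra.
  have F2 : s * u ^+ 2 <= s * (8 * k ^+ 2 + 8 * beta ^+ 2) by rewrite ler_wpM2l.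
  have F3 : 8 * (s * k ^+ 2) <= 4 * s ^+ 2 + 4 * k ^+ 4.
    by have := sqr_ge0 (s - k ^+ 2); nra.
  have F4 : s * beta ^+ 2 <= 4 * es * beta ^+ 2 by rewrite ler_wpM2r.
  have -> : s * u * (s + u) = s ^+ 2 * u + s * u ^+ 2 by ring.
  move: F1 F2 F3 F4 A1 A2 A3 A4 A5 uk.
  rewrite mulrDr; move: (s ^+ 2 * u) (s * u ^+ 2) (s * k ^+ 2) (s ^+ 4) (k ^+ 4) (k ^+ 2) (s ^+ 2) (u ^+ 2)
    => *; lra.
rewrite Ex_cst lee_fin.
set B := beta ^+ 2; have B0 : 0 <= B by exact: sqr_ge0.
set L := (X in X <= _).
have -> : L = 3 * (4 * B + (200 * 200 + (64 * 64 + 32 * B)) * (3 / 2)) / M ^+ 2.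
  by rewrite /L -/B; field; rewrite gt_eqF.
by rewrite ler_pM2r ?invr_gt0//; lra.
Qed.

(** Since H >= 0, exp (- X) <= 1 - X + X^2 holds without any smallness of lam; the last term is
    bounded by the supremum 12 M^4 of H. *)
Lemma mgf_clipped_sample (lam : R) : 0 <= lam ->
  (\int[P]_w (expR (- (lam * H w)))%:E <=
   (expR (- lam * (sqnorm x * sqnorm c + 2 * beta * sqnorm c -
     10 ^+ 6 * (1 + beta ^+ 2) / M ^+ 2) + lam ^+ 2 * (144 * M ^+ 8)))%:E)%E.
Proof.
move=> lam0.
have H0 w : 0 <= H w by exact: clipped_quartic_ge0.
have mH := measurable_clipped_sample.
have fH := finite_moments_clipped_sample.
have fe : finite_moments P (fun w => expR (- (lam * H w))).
  apply: (@finite_moments_bounded _ _ _ _ _ 1).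
    by apply: measurableT_comp => //; apply: measurableT_comp => //; exact: measurable_funM.
  by move=> w; rewrite ger0_norm ?expR_ge0// expR_le1 oppr_le0 mulr_ge0.
rewrite EFin_Ex// lee_fin.
apply: (@le_trans _ _ (Ex P (fun w => (1 + lam ^+ 2 * (144 * M ^+ 8)) + - lam * H w))).
  apply: Ex_le => //.
    by apply: finite_momentsD => //; apply: finite_momentsM.
  move=> w; apply: (le_trans (expRN_le_quadratic (mulr_ge0 lam0 (H0 w)))).
  have : (lam * H w) ^+ 2 <= lam ^+ 2 * (144 * M ^+ 8).
    rewrite exprMn ler_wpM2l ?sqr_ge0//.
    have -> : 144 * M ^+ 8 = (12 * M ^+ 4) ^+ 2 by ring.
    rewrite lerXn2r ?nnegrE ?mulr_ge0 ?exprn_ge0 ?(ltW M0)//.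
    exact: clipped_quartic_bounded.
  by lra.
rewrite ExD//; last by apply: finite_momentsM.
rewrite Ex_cst ExZ//.
apply: le_trans (expR_ge1Dx _).
suff : lam * (sqnorm x * sqnorm c + 2 * beta * sqnorm c -
     10 ^+ 6 * (1 + beta ^+ 2) / M ^+ 2) <= lam * Ex P H by lra.
rewrite ler_wpM2l//.
have := Ex_clipping_loss; rewrite ExD//; last 2 first.
- exact: finite_moments_quartic.
- exact: finite_momentsM.
rewrite ExZ//; have := Ex_quartic_ge mg mgf b1 b2 nx' nc' dc.
lra.
Qed.

End QuarticTail.

(** * Nets and uniform bounds *)

Section Net.
Context {R : realType} (K : finType).
Variable k : nat.
Hypotheses (k0 : (0 < k)%N) (n0 : (0 < #|K|)%N).
Local Notation n := #|K|.
Let N := (n * k)%N.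
Let eps : R := k%:R^-1.
Let h : R := eps / Num.sqrt n%:R.

Let k0' : 0 < k%:R :> R. Proof. by rewrite ltr0n. Qed.
Let n0' : 0 < n%:R :> R. Proof. by rewrite ltr0n. Qed.
Let sn0 : 0 < Num.sqrt n%:R :> R. Proof. by rewrite sqrtr_gt0. Qed.
Let eps0 : 0 < eps. Proof. by rewrite invr_gt0. Qed.
Let h0 : 0 < h. Proof. by rewrite divr_gt0. Qed.
Let nh2 : n%:R * h ^+ 2 = eps ^+ 2.
Proof. by rewrite expr_div_n sqr_sqrtr ?(ltW n0')// mulrCA divff ?mulr1// gt_eqF. Qed.

(** A lattice point of step h, stored as a sign and an absolute value per coordinate. Zero has two
    codes, which is harmless for an upper count. *)
Let code := {ffun K -> bool * 'I_N.+1}.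
Let short : {set code} := [set f : code | (\sum_k (f k).2 <= N)%N].
Let point (f : code) : {ffun K -> R} :=
  [ffun k => (if (f k).1 then -1 else 1) * ((f k).2%:R * h)].

(** Each short code has weight 2^N prod_i 2^-|a_i| at least 1, while the weights of all codes factor
    into n sums of at most 4 (two signs, a geometric series). As N = n k, the base does not depend
    on the dimension. *)
Let card_short : (#|short| <= (2 ^ k * 4) ^ n)%N.
Proof.
rewrite -(ler_nat R).
have half (l : nat) : \sum_(i < l) 2^-1 ^+ i <= 2 :> R.
  suff -> : \sum_(i < l) 2^-1 ^+ i = 2 - 2 * 2^-1 ^+ l :> R.
    by rewrite lerBlDr lerDl mulr_ge0// exprn_ge0// invr_ge0.
  elim: l => [|l IH]; first by rewrite big_ord0 expr0 mulr1 subrr.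
  by rewrite big_ord_recr IH /= exprS; field.
apply: (@le_trans _ _ (\sum_(f : code) 2 ^+ N * \prod_k 2^-1 ^+ (f k).2)).
  rewrite -sum1_card natr_sum big_mkcond/=; apply: ler_sum => f _.
  case: ifPn => [|_]; last first.
    by rewrite mulr_ge0 ?exprn_ge0// prodr_ge0// => i _; rewrite exprn_ge0 ?invr_ge0.
  rewrite inE => fN; rewrite prodrXr exprVn ler_pdivlMr ?exprn_gt0// mul1r.
  by rewrite ler_weXn2l// ler1n.
rewrite -mulr_sumr -(bigA_distr_bigA (fun _ (j : bool * 'I_N.+1) => 2^-1 ^+ j.2)).
rewrite prodr_const natrX natrM natrX exprMn -exprM (mulnC k) -/N.
apply: ler_wpM2l; first exact: exprn_ge0.
apply: lerXn2r; rewrite ?nnegrE//.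
  by apply: sumr_ge0 => i _; rewrite exprn_ge0 ?invr_ge0.
rewrite -(pair_bigA _ (fun _ (j : 'I_N.+1) => 2^-1 ^+ j))/= big_bool/=.
by have := half N.+1; lra.
Qed.

(** Coordinates are rounded toward 0 in steps eps / sqrt n, so the errors add up to at most n h^2 =
    eps^2 and the norm can only drop. The bound on that drop is needed because the expectation at a
    net point is expressed through its norm. *)
Lemma euclidean_net : exists s : seq {ffun K -> R},
  [/\ (size s <= (2 ^ k * 4) ^ n)%N, (forall f, f \in s -> sqnorm f <= 1) &
   forall c : K -> R, sqnorm c <= 1 -> exists2 f, f \in s &
     sqnorm (fun i => c i - f i) <= eps ^+ 2 /\ sqnorm c - 2 * eps <= sqnorm f].
Proof.
exists [seq f : {ffun K -> R} <- [seq point f | f in short] | sqnorm f <= 1]; split.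
- rewrite size_filter (leq_trans (count_size _ _))// size_map -cardE.
  exact: card_short.
- by move=> f; rewrite mem_filter => /andP[].
move=> c c1; pose a i := Num.truncn (`|c i| / h).
have aP i : (a i)%:R * h <= `|c i| /\ `|c i| <= (a i)%:R * h + h.
  have /truncn_itv/andP[h1 h2] : 0 <= `|c i| / h by rewrite divr_ge0// ltW.
  split; first by rewrite -ler_pdivlMr.
  by move: h2; rewrite ltr_pdivrMr// -natr1 mulrDl mul1r => /ltW.
(* By AM-GM, |c_i| / h = k sqrt n |c_i| <= (k/2) (n c_i^2 + 1), and these sum to at most n k on the
   unit ball. *)
have suma : (\sum_i a i <= N)%N.
  rewrite -(ler_nat R) natr_sum.
  apply: (@le_trans _ _ (\sum_i (k%:R / 2 * (n%:R * c i ^+ 2 + 1)))).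
    apply: ler_sum => i _; have [h1 _] := aP i.
    rewrite -ler_pdivlMr// in h1; apply: (le_trans h1).
    rewrite /h /eps invf_div invrK mulrA.
    set x := `|c i|; have -> : c i ^+ 2 = x ^+ 2 by rewrite real_normK ?num_real.
    set q := Num.sqrt n%:R; have qn : n%:R = q ^+ 2 :> R by rewrite sqr_sqrtr ?ltW.
    rewrite [in leRHS]qn; have := sqr_ge0 (q * x - 1) => hq.
    have : 0 <= k%:R * (q * x - 1) ^+ 2 by rewrite mulr_ge0.
    by nra.
  rewrite -mulr_sumr big_split/= -mulr_sumr sumr_const -/(sqnorm c) natrM.
  have : n%:R * sqnorm c <= n%:R by rewrite ler_piMr// ltW.
  move: (n%:R * sqnorm c) => z zn.
  have : k%:R * z <= k%:R * n%:R by rewrite ler_pM2l.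
  by lra.
have aN i : (a i < N.+1)%N.
  by rewrite ltnS (leq_trans _ suma)// (bigD1 i)//= leq_addr.
pose f : code := [ffun i => (c i < 0, Ordinal (aN i))].
have fE i : point f i = (if c i < 0 then -1 else 1) * ((a i)%:R * h).
  by rewrite !ffunE.
have cfE i : c i - point f i = (if c i < 0 then -1 else 1) * (`|c i| - (a i)%:R * h).
  rewrite fE; case: ltrP => ci; first by rewrite ltr0_norm//; ring.
  by rewrite ger0_norm//; ring.
have sgn2 (b : bool) (y : R) : ((if b then -1 else 1) * y) ^+ 2 = y ^+ 2.
  by case: b; rewrite ?mul1r// mulN1r sqrrN.
have ptle : sqnorm (point f) <= sqnorm c.
  apply: ler_sum => i _; rewrite fE sgn2 -(real_normK (num_real (c i))).
  have [h1 h2] := aP i.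
  by apply: lerXn2r => //; rewrite nnegrE mulr_ge0// ltW.
exists (point f).
  rewrite mem_filter (le_trans ptle)//=; apply/mapP; exists f => //.
  rewrite mem_enum inE; under eq_bigr do rewrite ffunE/=; exact: suma.
split.
  rewrite -nh2 mulrC mulr_natr -sumr_const; apply: ler_sum => i _.
  rewrite cfE sgn2; have [h1 h2] := aP i.
  by apply: lerXn2r; rewrite ?nnegrE ?subr_ge0 ?(ltW h0)//; lra.
rewrite lerBlDr -lerBlDl /sqnorm -sumrB.
apply: (@le_trans _ _ (\sum_i (eps * c i ^+ 2 + h ^+ 2 / eps))).
  apply: ler_sum => i _; rewrite fE sgn2 -(real_normK (num_real (c i))).
  have [h1 h2] := aP i; have zge0 : 0 <= (a i)%:R * h by rewrite mulr_ge0// ltW.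
  move: (`|c i|) ((a i)%:R * h) h1 h2 zge0 (normr_ge0 (c i)) => x z h1 h2 zge0 x0.
  have z0 : 0 <= x - z by lra.
  apply: (@le_trans _ _ (2 * h * x)).
    have : (x - z) * (x + z) <= h * (x + x).
      by apply: ler_pM => //; lra.
    by nra.
  have -> : eps * x ^+ 2 + h ^+ 2 / eps = eps * (x ^+ 2 + (h / eps) ^+ 2).
    by field; rewrite gt_eqF.
  have -> : 2 * h * x = eps * (2 * (h / eps) * x) by field; rewrite gt_eqF.
  by rewrite ler_wpM2l ?(ltW eps0)//; have := sqr_ge0 (x - h / eps); nra.
rewrite big_split/= -mulr_sumr sumr_const -/(sqnorm c).
rewrite -[_ *+ #|_|]mulr_natl mulrA nh2.
have -> : eps ^+ 2 / eps = eps by field; rewrite gt_eqF.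
have : eps * sqnorm c <= eps by rewrite ler_piMr// ltW.
by lra.
Qed.

End Net.

Lemma union_bound {R : realType} {dT : measure_display} {T : measurableType dT}
    (P : probability T R) (J : eqType) (s : seq J) (A : J -> set T) (r : R) :
  (forall j, measurable (A j)) -> (forall j, j \in s -> (P (A j) <= r%:E)%E) ->
  exists G : set T, [/\ measurable G, (forall w, G w -> forall j, j \in s -> ~ A j w) &
    (P (~` G) <= ((size s)%:R * r)%:E)%E].
Proof.
move=> mA; elim: s => [_|j s IH Pr].
  by exists setT; split => //; rewrite setCT measure0 mul0r.
have [] := IH; first by move=> i si; apply: Pr; rewrite inE si orbT.
move=> G [mG GA PG]; exists (~` A j `&` G); split.
- by apply: measurableI => //; exact: measurableC.
- by move=> w [Aj Gw] i; rewrite inE => /orP[/eqP ->//|]; exact: GA.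
rewrite setCI setCK /= -natr1 mulrDl mul1r addrC EFinD.
apply: le_trans; first by apply: measureU2 => //; exact: measurableC.
by apply: leeD => //; apply: Pr; rewrite inE eqxx.
Qed.

(** * From i.i.d. real coordinates to independent samples *)

Section Law.
Context {R : realType} {dT : measure_display} {T : measurableType dT}.
Variables (P : probability T R) (V : T -> measurableTypeR R) (mV : measurable_fun setT V).
HB.instance Definition _ := isMeasurableFun.Build _ _ _ _ V mV.

Lemma ge0_integral_law (N : probability (measurableTypeR R) R) (f : measurableTypeR R -> \bar R) :
  (forall B : set (measurableTypeR R), measurable B -> P (V @^-1` B) = N B) ->
  measurable_fun setT f -> (forall x, (0 <= f x)%E) ->
  (\int[P]_w f (V w) = \int[N]_x f x)%E.
Proof.
move=> lawV mf f0.
transitivity (\int[distribution P V]_x f x)%E.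
  by rewrite ge0_integral_distribution.
by apply: eq_measure_integral => A mA _; exact: lawV.
Qed.

End Law.

Section Blocks.
Context {R : realType} {dT : measure_display} {T : measurableType dT}.
Variables (P : probability T R) (m d : nat) (X : 'I_m * 'I_d * bool -> T -> R).
Hypothesis iidX : iid_complex_gaussian P X.

Let mX i : measurable_fun setT (X i). Proof. by have [/(_ i)] := iidX. Qed.

Definition gblock (j : 'I_m) (k : 'I_d * bool) : T -> R := X (j, k.1, k.2).
Definition block (j : 'I_m) : {set 'I_m * 'I_d * bool} := [set i | i.1.1 == j].

Lemma measurable_gblock j k : measurable_fun setT (gblock j k).
Proof. exact: mX. Qed.

Lemma depends_on_gblock j k : depends_on X (block j) (gblock j k).
Proof.
apply: (depends_onS _ (@depends_on_coord _ _ _ _ X (j, k.1, k.2))).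
by apply/fintype.subsetP => i; rewrite !inE => /eqP ->/=.
Qed.

Lemma block_disjoint j j' : j != j' -> [disjoint block j & block j']%B.
Proof.
move=> jj'; rewrite finset.disjoints_subset; apply/fintype.subsetP => i.
by rewrite !inE => /eqP ->.
Qed.

Lemma coord_mgf i (t : R) :
  (\int[P]_w (expR (t * X i w))%:E = (expR (t ^+ 2 / 4))%:E)%E.
Proof.
have [_ lawX _] := iidX.
have s0 : Num.sqrt 2^-1 != 0 :> R by rewrite gt_eqF// sqrtr_gt0.
have -> : t ^+ 2 / 4 = t ^+ 2 * Num.sqrt 2^-1 ^+ 2 / 2 :> R.
  by rewrite sqr_sqrtr//; field.
rewrite -normal_mgf//.
apply: (ge0_integral_law (mX i) (N := normal_prob 0 (Num.sqrt 2^-1))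
  (f := fun x => (expR (t * x))%:E)).
- by move=> B mB; exact: lawX.
- by apply/measurable_EFinP; apply: measurableT_comp => //; exact: measurable_funM.
- by move=> x; rewrite lee_fin expR_ge0.
Qed.

Lemma block_mgf j (c : 'I_d * bool -> R) :
  (\int[P]_w (expR (lin (gblock j) c w))%:E = (expR (sqnorm c / 4))%:E)%E.
Proof.
have [_ _ ind] := iidX.
pose V k w := expR (c k * gblock j k w).
pose D (k : 'I_d * bool) : {set 'I_m * 'I_d * bool} := [set (j, k.1, k.2)]%SET.
transitivity (\int[P]_w (\prod_(k <- enum {: 'I_d * bool}) V k w)%:E)%E.
  apply: eq_integral => w _; congr EFin.
  by rewrite /lin /dotf expR_sum big_enum.
rewrite (ge0_integral_prod_indep mX ind (D := D)).
- rewrite (eq_bigr (fun k => (expR (c k ^+ 2 / 4))%:E)); last first.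
    by move=> k _; exact: coord_mgf.
  rewrite prodEFin -expR_sum; congr (expR _)%:E.
  by rewrite /sqnorm mulr_suml big_enum.
- exact: enum_uniq.
- move=> k k' kk'; rewrite finset.disjoints_subset; apply/fintype.subsetP => i.
  rewrite !inE => /eqP ->; apply: contra kk' => /eqP[k1 k2].
  by apply/eqP; case: k k' k1 k2 => [? ?] [? ?] /= -> ->.
- move=> k; apply: (@measurableT_comp _ _ _ _ _ _ expR) => //.
  by apply: measurable_funM => //; exact: depends_on_coord.
- by move=> k w; exact: expR_ge0.
Qed.

Lemma chernoff_sum (f : 'I_m -> T -> R) (A : 'I_m -> R) (a : R) :
  (forall j, depends_on X (block j) (f j)) ->
  (forall j, (\int[P]_w (expR (f j w))%:E <= (expR (A j))%:E)%E) ->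
  (P [set w | (a <= \sum_j f j w)%R] <= (expR (\sum_j A j - a))%:E)%E.
Proof.
move=> df fA; have [_ _ ind] := iidX.
rewrite expRD; apply: chernoff.
  by apply: measurable_sum => j; exact: depends_on_measurable (df j).
rewrite (eq_integral (fun w => (\prod_(j <- enum 'I_m) expR (f j w))%:E)); last first.
  by move=> w _; rewrite expR_sum big_enum.
rewrite (ge0_integral_prod_indep mX ind (D := block)).
- rewrite expR_sum -prodEFin big_enum/=.
  have F0 j : (0 <= \int[P]_w (expR (f j w))%:E)%E.
    by apply: integral_ge0 => w _; rewrite lee_fin expR_ge0.
  suff [] : (0 <= \prod_(j < m) \int[P]_w (expR (f j w))%:E)%E /\
    (\prod_(j < m) \int[P]_w (expR (f j w))%:E <= \prod_(j < m) (expR (A j))%:E)%E by [].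
  elim: (index_enum _) => [|j s [IH1 IH2]]; first by rewrite !big_nil.
  by rewrite !big_cons; split; [exact: mule_ge0|exact: lee_pmul].
- exact: enum_uniq.
- exact: block_disjoint.
- by move=> j; apply: (@measurableT_comp _ _ _ _ _ _ expR) => //; exact: df.
- by move=> j w; exact: expR_ge0.
Qed.

End Blocks.

Section SeminormNet.
Context {R : realType} (K : finType).
Variables (V : (K -> R) -> R) (B C : R) (k : nat) (s : seq {ffun K -> R}).
Hypothesis k4 : (4 <= k)%N.
Local Notation eps := (k%:R^-1 : R).
Hypothesis V0 : forall c, 0 <= V c.
Hypothesis VZ : forall t c, V (fun i => t * c i) = t ^+ 2 * V c.
Hypothesis VD : forall e a c, 0 < e ->
  V (fun i => a i + c i) <= (1 + e) * V a + (1 + e^-1) * V c.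
Hypothesis Vbound : forall c, sqnorm c <= 1 -> V c <= C.
Hypothesis net : forall c : K -> R, sqnorm c <= 1 -> exists2 f, f \in s &
  sqnorm (fun i => c i - f i) <= eps ^+ 2.
Hypothesis Vs : forall f, f \in s -> V f <= B.

(** [VD] is the squared triangle inequality with a Young parameter. With parameter eps, a remainder
    of norm eps contributes (1 + 1/eps) eps^2 = eps + eps^2 times the supremum S, which is absorbed
    on the left. C only ensures that S is finite and does not enter the bound. *)
Lemma seminorm_net c : sqnorm c <= 1 -> V c <= (1 + 5 * eps) * B.
Proof.
move=> c1; pose A := [set V c | c in [set c | sqnorm c <= 1]].
have supA : has_sup A.
  split; first by exists (V c); exists c.
  by exists C => _ [e e1 <-]; exact: Vbound.
pose S := sup A.
have VS e : sqnorm e <= 1 -> V e <= S.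
  by move=> e1; apply: sup_upper_bound => //; exists e.
have e0 : 0 < eps by rewrite invr_gt0 ltr0n (leq_trans _ k4).
have e4 : eps <= 4^-1 by rewrite lef_pV2 ?posrE ?ltr0n// ?(leq_trans _ k4)// ler_nat.
have key e : sqnorm e <= 1 -> V e <= (1 + eps) * B + (eps ^+ 2 + eps) * S.
  move=> e1; have [f fs fe] := net e1.
  have -> : e = (fun i => f i + (e i - f i)) by apply/funext => i; rewrite addrC subrK.
  apply: (le_trans (VD _ _ e0)); apply: lerD.
    by rewrite ler_wpM2l ?Vs// addr_ge0// ltW.
  have -> : (fun i => e i - f i) = (fun i => eps * (k%:R * (e i - f i))).
    by apply/funext => i; rewrite mulrA mulVf ?mul1r// pnatr_eq0 -lt0n (leq_trans _ k4).
  rewrite VZ mulrA; have -> : eps ^+ 2 + eps = (1 + eps^-1) * eps ^+ 2.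
    by field; rewrite pnatr_eq0 -lt0n (leq_trans _ k4).
  apply: ler_wpM2l.
    by rewrite mulr_ge0 ?sqr_ge0// addr_ge0// invr_ge0 ltW.
  apply: VS; rewrite sqnormZ.
  have k0 : 0 < k%:R :> R by rewrite ltr0n (leq_trans _ k4).
  have : k%:R ^+ 2 * sqnorm (fun i => e i - f i) <= k%:R ^+ 2 * eps ^+ 2.
    by rewrite ler_pM2l ?exprn_gt0.
  by rewrite -exprMn divff ?expr1n// gt_eqF.
have SB : S <= (1 + eps) * B + (eps ^+ 2 + eps) * S.
  by apply: ge_sup => [|_ [e e1 <-]]; [case: supA|exact: key].
have S0 : 0 <= S by rewrite (le_trans (V0 c))// VS.
have B0 : 0 <= B.
  have [f fs _] := net c1; exact: le_trans (V0 f) (Vs fs).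
apply: (le_trans (VS _ c1)).
have p0 : 0 < 1 - eps - eps ^+ 2 by nra.
have h1 : (1 - eps - eps ^+ 2) * S <= (1 + eps) * B by lra.
have h2 : 1 + eps <= (1 - eps - eps ^+ 2) * (1 + 5 * eps) by nra.
rewrite -(ler_pM2l p0); apply: (le_trans h1); rewrite mulrA.
by rewrite ler_wpM2r.
Qed.

End SeminormNet.

Section Rotation.
Context {R : realType} {d : nat}.
Implicit Types c : 'I_d * bool -> R.

(* In the real coordinates (Re v, Im v) of v, [rot] maps the coordinates of v
   to those of the functional a |-> Im (a^* v). *)
Definition rot c (k : 'I_d * bool) : R := if k.2 then - c (k.1, false) else c (k.1, true).

Lemma sum_pair_bool (F : 'I_d * bool -> R) :
  \sum_k F k = \sum_(i < d) (F (i, true) + F (i, false)).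
Proof.
rewrite (eq_bigr (fun k => F (k.1, k.2))); last by case.
rewrite -(pair_bigA _ (fun i b => F (i, b)))/=.
by apply: eq_bigr => i _; rewrite big_bool.
Qed.

Lemma sqnorm_rot c : sqnorm (rot c) = sqnorm c.
Proof.
rewrite /sqnorm !sum_pair_bool; apply: eq_bigr => i _.
by rewrite /rot/= sqrrN addrC.
Qed.

Lemma dotf_rot c : dotf c (rot c) = 0.
Proof.
by rewrite /dotf sum_pair_bool big1// => i _; rewrite /rot/=; ring.
Qed.

Lemma rotD a c : rot (fun k => a k + c k) = (fun k => rot a k + rot c k).
Proof. by apply/funext => -[i []]; rewrite /rot/= ?opprD. Qed.

Lemma rotB a c : rot (fun k => a k - c k) = (fun k => rot a k - rot c k).
Proof. by apply/funext => -[i []]; rewrite /rot/= ?opprD. Qed.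

Lemma rotZ t c : rot (fun k => t * c k) = (fun k => t * rot c k).
Proof. by apply/funext => -[i []]; rewrite /rot/= ?mulrN. Qed.

End Rotation.

Section Events.
Context {R : realType} {dT : measure_display} {T : measurableType dT}.
Variables (P : probability T R) (m d : nat) (X : 'I_m * 'I_d * bool -> T -> R).
Hypothesis iidX : iid_complex_gaussian P X.
Local Notation coords := ('I_d * bool -> R).

Let mg := measurable_gblock iidX.
Let mgf := block_mgf iidX.

Definition block_sqmod j (c : coords) w : R := sqmod (gblock X j) c (rot c) w.
Definition block_intensity (x : coords) (b1 b2 : 'I_m -> R) j w : R :=
  intensity (gblock X j) x (rot x) (b1 j) (b2 j) w.
Definition block_clipped (M : R) (c e : coords) (b1 b2 : 'I_m -> R) j w : R :=
  clipped_sample (gblock X j) e (rot e) c (rot c) (b1 j) (b2 j) M w.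

Section Fixed.
Variables (b1 b2 : 'I_m -> R) (c : coords).
Local Notation beta j := (b1 j ^+ 2 + b2 j ^+ 2).
Hypothesis c1 : sqnorm c <= 1.

Lemma depends_on_weighted (x : coords) (Lam : R) j :
  depends_on X (block d j) (fun w => Num.min (block_intensity x b1 b2 j w) Lam * block_sqmod j c w).
Proof.
(* Over the sigma-algebra of block j, the earlier measurability lemmas become statements of
   dependence on that block. *)
have mg' k : measurable_fun [set: g_sigma_algebraType (cylinder X (block d j))] (gblock X j k).
  exact: depends_on_gblock.
apply: measurable_funM.
  by apply: measurable_minr => //; exact: measurable_intensity mg' _ _ _ _.
exact: measurable_sqmod mg' _ _.
Qed.

Lemma depends_on_block_clipped M (e : coords) j : 0 < M ->
  depends_on X (block d j) (block_clipped M c e b1 b2 j).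
Proof.
move=> M0; have mg' k :
    measurable_fun [set: g_sigma_algebraType (cylinder X (block d j))] (gblock X j k).
  exact: depends_on_gblock.
exact: measurable_clipped_sample mg' _ _ _ _ _ _ _ M0.
Qed.

Lemma prob_weighted_large (x : coords) (Lam lam del : R) :
  sqnorm x <= 1 -> 0 <= Lam -> 0 < lam -> lam * Lam <= 16^-1 ->
  (P [set w | (\sum_j beta j + (2 + del) * m%:R <=
     \sum_j Num.min (block_intensity x b1 b2 j w) Lam * block_sqmod j c w)%R] <=
   (expR (- (lam * del * m%:R) + lam ^+ 2 * (10 ^+ 7 * (m%:R + \sum_j beta j ^+ 2))))%:E)%E.
Proof.
move=> x1 Lam0 lam0 lamLam.
pose f j w := lam * (Num.min (block_intensity x b1 b2 j w) Lam * block_sqmod j c w).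
pose A j := lam * (beta j + 2) + lam ^+ 2 * (10 ^+ 7 * (1 + beta j ^+ 2)).
have := @chernoff_sum _ _ _ _ _ _ _ iidX f A
  (lam * (\sum_j beta j + (2 + del) * m%:R)) _ _.
rewrite (_ : [set w | _] = [set w | (\sum_j beta j + (2 + del) * m%:R <=
     \sum_j Num.min (block_intensity x b1 b2 j w) Lam * block_sqmod j c w)%R]); last first.
  by apply/seteqP; split => w; rewrite /f/= -mulr_sumr ler_pM2l.
move=> H; apply: le_trans (H _ _) _ => {H}.
- move=> j; apply: measurable_funM => //; exact: depends_on_weighted.
- move=> j; apply: (mgf_clipped_intensity (mg j) (mgf j)) => //;
    by [exact: sqnorm_rot|exact: dotf_rot|exact: ltW].
rewrite lee_fin ler_expR /A big_split/= -!mulr_sumr !big_split/= !sumr_const card_ord.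
set s1 := \sum_(_ < m) _; set s2 := \sum_(_ < m) _; set s3 := \sum_(_ < m) _; lra.
Qed.

Lemma prob_block_clipped_small (M : R) (e : coords) (lam del : R) :
  0 < M -> sqnorm e <= 1 -> 0 < lam ->
  (P [set w | (\sum_j block_clipped M c e b1 b2 j w <=
     m%:R * (sqnorm e * sqnorm c) + 2 * sqnorm c * (\sum_j beta j) -
     10 ^+ 6 * (m%:R + \sum_j beta j ^+ 2) / M ^+ 2 - del * m%:R)%R] <=
   (expR (- (lam * del * m%:R) + lam ^+ 2 * (144 * M ^+ 8) * m%:R))%:E)%E.
Proof.
move=> M0 e1 lam0.
pose f j w := - (lam * block_clipped M c e b1 b2 j w).
pose A j := - lam * (sqnorm e * sqnorm c + 2 * beta j * sqnorm c -
     10 ^+ 6 * (1 + beta j ^+ 2) / M ^+ 2) + lam ^+ 2 * (144 * M ^+ 8).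
pose a := m%:R * (sqnorm e * sqnorm c) + 2 * sqnorm c * (\sum_j beta j) -
     10 ^+ 6 * (m%:R + \sum_j beta j ^+ 2) / M ^+ 2 - del * m%:R.
have := @chernoff_sum _ _ _ _ _ _ _ iidX f A (- (lam * a)) _ _.
rewrite (_ : [set w | _] = [set w | (\sum_j block_clipped M c e b1 b2 j w <= a)%R]); last first.
  by apply/seteqP; split => w; rewrite /f/= sumrN -mulr_sumr lerN2 ler_pM2l.
move=> H; apply: le_trans (H _ _) _ => {H}.
- move=> j; apply: measurable_funN.
  by apply: measurable_funM => //; exact: depends_on_block_clipped.
- move=> j; apply: (mgf_clipped_sample (mg j) (mgf j)) => //;
    by [exact: sqnorm_rot|exact: dotf_rot|exact: ltW].
rewrite lee_fin ler_expR.
have -> : \sum_j A j =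
    (- lam * (sqnorm e * sqnorm c - 10 ^+ 6 / M ^+ 2) + lam ^+ 2 * (144 * M ^+ 8)) * m%:R
    + (- lam * (2 * sqnorm c)) * \sum_j beta j
    + (lam * 10 ^+ 6 / M ^+ 2) * \sum_j beta j ^+ 2.
  rewrite /A; move: (sqnorm e) (sqnorm c) => ne nc.
  have cst (z : R) : z * m%:R = \sum_(j < m) z by rewrite sumr_const card_ord mulr_natr.
  rewrite !mulr_sumr cst -!big_split/=.
  by apply: eq_bigr => j _; ring.
rewrite /a; move: (\sum_j beta j) (\sum_j beta j ^+ 2) => s1 s2; rewrite le_eqVlt.
by apply/orP; left; apply/eqP; ring.
Qed.

End Fixed.
End Events.

Lemma measurable_ge_cst {R : realType} {dT : measure_display} {T : measurableType dT}
    (f : T -> R) (a : R) : measurable_fun setT f -> measurable [set w | a <= f w].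
Proof.
move=> mf; rewrite [X in measurable X](_ : _ = setT `&` f @^-1` `[a, +oo[).
  exact: mf.
by rewrite setTI; apply/seteqP; split => w; rewrite /= in_itv/= andbT.
Qed.

Lemma measurable_le_cst {R : realType} {dT : measure_display} {T : measurableType dT}
    (f : T -> R) (a : R) : measurable_fun setT f -> measurable [set w | f w <= a].
Proof.
move=> mf; rewrite [X in measurable X](_ : _ = setT `&` f @^-1` `]-oo, a]).
  exact: mf.
by rewrite setTI; apply/seteqP; split => w; rewrite /= in_itv.
Qed.

(** * Bounds uniform in the directions *)

Section Uniform.
Context {R : realType} {dT : measure_display} {T : measurableType dT}.
Variables (P : probability T R) (m d : nat) (X : 'I_m * 'I_d * bool -> T -> R).
Hypothesis iidX : iid_complex_gaussian P X.
Hypothesis d0 : (0 < d)%N.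
Local Notation coords := ('I_d * bool -> R).
Local Notation block_sqmod := (block_sqmod X).
Local Notation block_intensity := (block_intensity X).
Local Notation block_clipped := (block_clipped X).

Let mX i : measurable_fun setT (X i). Proof. by have [/(_ i)] := iidX. Qed.

Lemma sqm_ge0 j (c : coords) w : 0 <= block_sqmod j c w.
Proof. exact: sqmod_ge0. Qed.

Lemma sqmZ j t (c : coords) w : block_sqmod j (fun k => t * c k) w = t ^+ 2 * block_sqmod j c w.
Proof. by rewrite /block_sqmod rotZ /sqmod !linZ; ring. Qed.

Lemma sqmD_le j e (a c : coords) w : 0 < e ->
  block_sqmod j (fun k => a k + c k) w <= (1 + e) * block_sqmod j a w + (1 + e^-1) * block_sqmod j c w.
Proof.
move=> e0; rewrite /block_sqmod rotD /sqmod !linD.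
have key p q : (p + q) ^+ 2 <= (1 + e) * p ^+ 2 + (1 + e^-1) * q ^+ 2 :> R.
  rewrite -subr_ge0.
  have -> : (1 + e) * p ^+ 2 + (1 + e^-1) * q ^+ 2 - (p + q) ^+ 2 = e * (p - q / e) ^+ 2.
    by field; rewrite gt_eqF.
  by rewrite mulr_ge0 ?sqr_ge0// ltW.
by rewrite !mulrDr addrACA lerD.
Qed.

Lemma sqm_bounded j w : exists C, forall c : coords, sqnorm c <= 1 -> block_sqmod j c w <= C.
Proof.
pose S := \sum_k `|gblock X j k w|.
have S0 : 0 <= S by rewrite sumr_ge0.
have key (c : coords) : sqnorm c <= 1 -> lin (gblock X j) c w ^+ 2 <= S ^+ 2.
  move=> c1; rewrite -(real_normK (num_real (lin _ _ _))).
  apply: lerXn2r; rewrite ?nnegrE//; apply: (le_trans (ler_norm_sum _ _ _)).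
  apply: ler_sum => k _; rewrite normrM ler_piMl//.
  rewrite -(@expr_le1 _ 2)// real_normK ?num_real//; apply: le_trans c1.
  by rewrite /sqnorm (bigD1 k)//= lerDl sumr_ge0// => i _; exact: sqr_ge0.
exists (S ^+ 2 + S ^+ 2) => c c1; apply: lerD; first exact: key.
by apply: key; rewrite sqnorm_rot.
Qed.

Lemma card_coords : #|{: 'I_d * bool}| = (d * 2)%N.
Proof. by rewrite card_prod card_ord card_bool. Qed.

Let K0 : (0 < #|{: 'I_d * bool}|)%N.
Proof. by rewrite card_coords muln_gt0 d0. Qed.

(** The condition joining lam, K1 and del makes the second-order term of the Chernoff exponent at
    most half of the gain lam del m; the other half is left to pay for the net. *)
Lemma weighted_uniform (x : coords) (b1 b2 : 'I_m -> R) (K1 Lam lam del : R) (k : nat) :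
  sqnorm x <= 1 -> \sum_j (b1 j ^+ 2 + b2 j ^+ 2) ^+ 2 <= K1 * m%:R ->
  0 <= Lam -> 0 < lam -> lam * Lam <= 16^-1 ->
  lam * (10 ^+ 7 * (1 + K1)) <= del / 2 -> (4 <= k)%N ->
  exists G : set T, [/\ measurable G,
    forall w, G w -> forall c : coords, sqnorm c <= 1 ->
      \sum_j Num.min (block_intensity x b1 b2 j w) Lam * block_sqmod j c w <=
      (1 + 5 * k%:R^-1) * (\sum_j (b1 j ^+ 2 + b2 j ^+ 2) + (2 + del) * m%:R) &
    (P (~` G) <= (((2 ^ k * 4) ^ (d * 2))%:R * expR (- (lam * del / 2 * m%:R)))%:E)%E].
Proof.
move=> x1 bK Lam0 lam0 lamLam lamK k4.
have [s [sz s1 net]] := @euclidean_net R _ k (leq_trans (isT : 0 < 4)%N k4) K0.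
pose a := \sum_j (b1 j ^+ 2 + b2 j ^+ 2) + (2 + del) * m%:R.
pose V w (c : coords) := \sum_j Num.min (block_intensity x b1 b2 j w) Lam * block_sqmod j c w.
have mV c : measurable_fun setT (V ^~ c).
  apply: measurable_sum => j.
  by apply: (depends_on_measurable mX); exact: depends_on_weighted.
have [] := @union_bound _ _ _ P _ s (fun c => [set w | a <= V w c])
  (expR (- (lam * del / 2 * m%:R))).
- by move=> c; exact: measurable_ge_cst.
- move=> c cs; apply: le_trans.
    exact: (prob_weighted_large iidX b1 b2 (s1 _ cs) del x1 Lam0 lam0 lamLam).
  rewrite lee_fin ler_expR.
  have H : 10 ^+ 7 * (m%:R + \sum_j (b1 j ^+ 2 + b2 j ^+ 2) ^+ 2) <=
      10 ^+ 7 * (1 + K1) * m%:R :> R.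
    by rewrite -[leRHS]mulrA ler_wpM2l ?exprn_ge0// mulrDl mul1r lerD2l.
  have : lam ^+ 2 * (10 ^+ 7 * (m%:R + \sum_j (b1 j ^+ 2 + b2 j ^+ 2) ^+ 2)) <=
      lam * (del / 2) * m%:R.
    apply: (@le_trans _ _ (lam * (lam * (10 ^+ 7 * (1 + K1))) * m%:R)).
      rewrite [leRHS](_ : _ = lam ^+ 2 * (10 ^+ 7 * (1 + K1) * m%:R)); last by ring.
      by rewrite ler_wpM2l// sqr_ge0.
    by rewrite ler_wpM2r// ler_wpM2l// ltW.
  by lra.
move=> G [mG GV PG]; exists G; split => //.
- move=> w Gw c c1.
  have min0 j : 0 <= Num.min (block_intensity x b1 b2 j w) Lam by rewrite le_min intensity_ge0.
  have [C CP] := choice (fun j => sqm_bounded j w).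
  apply: (@seminorm_net _ _ (V w) a (\sum_j Num.min (block_intensity x b1 b2 j w) Lam * C j) k s) => //.
  + by move=> e; apply: sumr_ge0 => j _; rewrite mulr_ge0// sqm_ge0.
  + move=> t e; rewrite /V mulr_sumr; apply: eq_bigr => j _.
    by rewrite sqmZ mulrCA.
  + move=> e p q e0; rewrite /V !mulr_sumr -big_split/=; apply: ler_sum => j _.
    rewrite !(mulrCA _ (Num.min _ _)) -mulrDr ler_wpM2l//.
    exact: sqmD_le.
  + by move=> e e1; apply: ler_sum => j _; rewrite ler_wpM2l// CP.
  + by move=> e e1; have [f fs [fe _]] := net e e1; exists f.
  + move=> f fs; have := GV _ Gw f fs; rewrite /= => /negP.
    by rewrite -ltNge => /ltW.
- apply: (le_trans PG); rewrite lee_fin ler_wpM2r ?expR_ge0// ler_nat.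
  by rewrite card_coords in sz.
Qed.

(** Instance x = 0, b_j = 1 of [weighted_uniform]: the intensity truncated at 1 is then identically
    1, so the weighted form is the sum of |a_j^* c|^2. The bound (1 + 5/k) (1 + 2 + 1/2) m is at
    most 4 m for k >= 100. *)
Lemma operator_norm_uniform (k : nat) : (100 <= k)%N ->
  exists G : set T, [/\ measurable G,
    forall w, G w -> forall (c : coords) r, 0 < r -> sqnorm c <= r ^+ 2 ->
      \sum_j block_sqmod j c w <= 4 * r ^+ 2 * m%:R &
    (P (~` G) <= (((2 ^ k * 4) ^ (d * 2))%:R * expR (- ((10 ^+ 8)^-1 / 4 * m%:R)))%:E)%E].
Proof.
move=> k100.
have k4 : (4 <= k)%N by exact: leq_trans k100.
have lam0 : 0 < (10 ^+ 8)^-1 :> R by rewrite invr_gt0 exprn_gt0.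
pose x0 : coords := fun=> 0.
have [|||||||G [mG HG PG]] := @weighted_uniform x0 (fun=> 1) (fun=> 0) 1 1 (10 ^+ 8)^-1 (2^-1) k => //.
- by rewrite /sqnorm big1// => i _; rewrite expr0n.
- by rewrite expr0n addr0 !expr1n sumr_const card_ord mul1r.
- by rewrite mulr1; lra.
- by lra.
exists G; split => //; last first.
  by have -> : (10 ^+ 8)^-1 / 4 = (10 ^+ 8)^-1 * 2^-1 / 2 :> R by field.
move=> w Gw c r r0 cr.
have := HG w Gw (fun i => r^-1 * c i).
rewrite sqnormZ exprVn mulrC ler_pdivrMr ?exprn_gt0// mul1r => /(_ cr).
have y1 j : Num.min (block_intensity x0 (fun=> 1) (fun=> 0) j w) 1 = 1.
  apply/min_idPr; rewrite /block_intensity /intensity.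
  have -> : lin (gblock X j) x0 w = 0 by rewrite /lin /dotf big1// => i _; rewrite mul0r.
  by rewrite add0r expr1n lerDl sqr_ge0.
under eq_bigr do rewrite y1 mul1r sqmZ.
rewrite -mulr_sumr exprVn mulrC ler_pdivrMr ?exprn_gt0// => H.
apply: (le_trans H); rewrite [leRHS]mulrAC; apply: ler_wpM2r; first exact: sqr_ge0.
rewrite expr0n addr0 !expr1n sumr_const card_ord.
have : k%:R^-1 <= 100^-1 :> R.
  by rewrite lef_pV2 ?posrE ?ltr0n// ?ler_nat// (leq_trans _ k100).
have : 0 <= k%:R^-1 :> R by rewrite invr_ge0.
have : 0 <= m%:R :> R by [].
by move: (k%:R^-1) (m%:R) => p q *; nra.
Qed.

End Uniform.

Section UniformQuartic.
Context {R : realType} {dT : measure_display} {T : measurableType dT}.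
Variables (P : probability T R) (m d : nat) (X : 'I_m * 'I_d * bool -> T -> R).
Hypothesis iidX : iid_complex_gaussian P X.
Hypothesis d0 : (0 < d)%N.
Local Notation coords := ('I_d * bool -> R).
Local Notation block_sqmod := (block_sqmod X).
Local Notation block_clipped := (block_clipped X).

Variables (b1 b2 : 'I_m -> R) (K1 : R).
Local Notation beta j := (b1 j ^+ 2 + b2 j ^+ 2).
Hypothesis bK : \sum_j beta j ^+ 2 <= K1 * m%:R.
Variables (M : R) (k : nat).
Hypotheses (M0 : 0 < M) (k100 : (100 <= k)%N).
Local Notation eps := (k%:R^-1 : R).

Let mX i : measurable_fun setT (X i). Proof. by have [/(_ i)] := iidX. Qed.
Let K0 : (0 < #|{: 'I_d * bool}|)%N.
Proof. by rewrite card_coords muln_gt0 d0. Qed.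
Let k0 : (0 < k)%N. Proof. exact: leq_trans k100. Qed.
Let k0' : 0 < k%:R :> R. Proof. by rewrite ltr0n. Qed.

(** [c] stands for the direction v, and (e, t) for the point (z, |x|) scaled to the unit sphere,
    where t multiplies the normalized b. *)
Definition scaled_sum t (c e : coords) w :=
  \sum_j block_clipped M c e (fun j => t * b1 j) (fun j => t * b2 j) j w.

(** The bound is exported at a nearby net point only; returning to (c, e, t) takes a Lipschitz
    estimate that holds on another event. The weaker error with K1 covers all t at once, because t
    <= 1. *)
Lemma block_clipped_uniform (lam del : R) : 0 < lam -> 0 < del ->
  lam * (144 * M ^+ 8) <= del / 2 ->
  exists G : set T, [/\ measurable G,
    forall w, G w -> forall (c e : coords) (t : R), sqnorm c <= 1 -> sqnorm e <= 1 ->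
      0 <= t -> t <= 1 -> exists c' e' t',
      [/\ sqnorm c' <= 1 /\ sqnorm e' <= 1 , 0 <= t' <= t /\ t - t' <= eps,
          sqnorm (fun i => c i - c' i) <= eps ^+ 2 /\ sqnorm c - 2 * eps <= sqnorm c',
          sqnorm (fun i => e i - e' i) <= eps ^+ 2 /\ sqnorm e - 2 * eps <= sqnorm e' &
          m%:R * (sqnorm e' * sqnorm c') + 2 * sqnorm c' * (t' ^+ 2 * \sum_j beta j) -
          10 ^+ 6 * (1 + K1) * m%:R / M ^+ 2 - del * m%:R <= scaled_sum t' c' e' w] &
    (P (~` G) <= (((2 ^ k * 4) ^ (d * 2) * (2 ^ k * 4) ^ (d * 2) * k.+1)%:R *
      expR (- (lam * del / 2 * m%:R)))%:E)%E].
Proof.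
move=> lam0 del0 lamM.
have [s [sz s1 net]] := @euclidean_net R _ k k0 K0.
rewrite card_coords in sz.
pose lower t (c e : coords) := m%:R * (sqnorm e * sqnorm c) +
  2 * sqnorm c * (t ^+ 2 * \sum_j beta j) -
  10 ^+ 6 * (1 + K1) * m%:R / M ^+ 2 - del * m%:R.
(* The grid 0, 1/k, ..., 1 has k + 1 points, and rounding down keeps 0 <= t' <= t. *)
pose tk (i : nat) : R := i%:R / k%:R.
pose J := ({ffun 'I_d * bool -> R} * {ffun 'I_d * bool -> R} * nat)%type.
pose A (j : J) := [set w | scaled_sum (tk j.2) j.1.1 j.1.2 w <= lower (tk j.2) j.1.1 j.1.2].
pose il := iota 0 k.+1.
have il_le i : (i \in il) = (i <= k)%N by rewrite mem_iota add0n ltnS.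
pose sJ : seq J := [seq (p, i) | p <- [seq (f, g) | f <- s, g <- s], i <- il].
have msum t c e : measurable_fun setT (scaled_sum t c e).
  by apply: measurable_sum => j; apply: (depends_on_measurable mX); exact: depends_on_block_clipped.
have [] := @union_bound _ _ _ P _ sJ A (expR (- (lam * del / 2 * m%:R))).
- by move=> j; exact: measurable_le_cst.
- move=> [[f g] i] /allpairsP[[p i'] /= [/allpairsP[[f'' g''] /= [fs gs ->]] + [-> -> ->]]].
  rewrite il_le => ik.
  have t0 : 0 <= tk i' by rewrite divr_ge0.
  have t1 : tk i' <= 1 by rewrite ler_pdivrMr// mul1r ler_nat.
  have t21 : tk i' ^+ 2 <= 1 by rewrite exprn_ile1.
  set t := tk i' in t0 t1 t21 *.
  have b'E j : (t * b1 j) ^+ 2 + (t * b2 j) ^+ 2 = t ^+ 2 * beta j by ring.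
  have := prob_block_clipped_small iidX (fun j => t * b1 j) (fun j => t * b2 j) (s1 _ fs) del
    M0 (s1 _ gs) lam0.
  under eq_bigr do rewrite b'E.
  under [X in 10 ^+ 6 * (_ + X)]eq_bigr do rewrite b'E.
  rewrite -mulr_sumr => H.
  apply: (@le_trans _ _ (P [set w | scaled_sum t f'' g'' w <=
     m%:R * (sqnorm g'' * sqnorm f'') + 2 * sqnorm f'' * (t ^+ 2 * \sum_j beta j) -
     10 ^+ 6 * (m%:R + \sum_j (t ^+ 2 * beta j) ^+ 2) / M ^+ 2 - del * m%:R])).
    apply: le_measure; rewrite ?inE; [exact: measurable_le_cst|exact: measurable_le_cst|].
    move=> w; rewrite /A/= -/t => h; apply: (le_trans h); rewrite /lower lerD2r lerD2l lerN2.
    rewrite ler_wpM2r ?invr_ge0 ?sqr_ge0// -mulrA ler_wpM2l ?exprn_ge0//.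
    rewrite mulrDl mul1r lerD2l; apply: le_trans bK; apply: ler_sum => j _.
    apply: lerXn2r; rewrite ?nnegrE ?mulr_ge0 ?addr_ge0 ?sqr_ge0//.
    by rewrite ler_piMl// addr_ge0 ?sqr_ge0.
  apply: (le_trans H); rewrite lee_fin ler_expR.
  have : lam * (lam * (144 * M ^+ 8)) * m%:R <= lam * (del / 2) * m%:R.
    by rewrite ler_wpM2r// ler_wpM2l// ltW.
  by lra.
move=> G [mG GA PG]; exists G; split => //.
- move=> w Gw c e t c1 e1 t0 t1.
  have [f fs [cf fn]] := net c c1; have [g gs [eg gn]] := net e e1.
  pose i := Num.truncn (t * k%:R).
  have /truncn_itv/andP[h1 h2] : 0 <= t * k%:R by rewrite mulr_ge0.
  have it : tk i <= t by rewrite ler_pdivrMr.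
  exists f, g, (tk i); split => //.
  + by split; apply: s1.
  + rewrite divr_ge0//=; split => //; rewrite /tk lerBlDl.
    have -> : i%:R / k%:R + eps = i.+1%:R / k%:R by rewrite -natr1 mulrDl mul1r.
    by rewrite ler_pdivlMr// ltW.
  have jJ : ((f, g), i) \in sJ.
    apply/allpairsP; exists ((f, g), i); split => //=.
      by apply/allpairsP; exists (f, g).
    rewrite il_le -(ler_nat R); apply: (le_trans h1).
    by rewrite ler_piMl.
  have := GA _ Gw _ jJ; rewrite /A/= => /negP; rewrite -ltNge => /ltW.
  by [].
- apply: (le_trans PG); rewrite lee_fin ler_wpM2r ?expR_ge0// ler_nat.
  by rewrite /sJ !size_allpairs size_iota leq_mul2r leq_mul// orbT.
Qed.

(** |z| <= z^2 / (2 r) + r / 2 converts a quadratic bound at scale r into a bound on absolute values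
    of the same scale. *)
Lemma norm_sum_le (x y : 'I_m -> R) (r V : R) : 0 < r ->
  \sum_j (x j ^+ 2 + y j ^+ 2) <= V * r ^+ 2 * m%:R ->
  \sum_j (`|x j| + `|y j|) <= (V / 2 + 1) * r * m%:R.
Proof.
move=> r0 H.
have -> : (V / 2 + 1) * r * m%:R = (V * r ^+ 2 * m%:R) / (2 * r) + \sum_(j < m) r.
  by rewrite sumr_const card_ord -[r *+ m]mulr_natr; field; rewrite gt_eqF.
apply: (@le_trans _ _ (\sum_j (x j ^+ 2 + y j ^+ 2) / (2 * r) + \sum_(j < m) r)).
  rewrite -big_split/=; apply: ler_sum => j _.
  have key z : `|z| <= z ^+ 2 / (2 * r) + r / 2.
    rewrite -(real_normK (num_real z)); set u := `|z|.
    rewrite -subr_ge0; have -> : u ^+ 2 / (2 * r) + r / 2 - u = (u - r) ^+ 2 / (2 * r).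
      by field; rewrite gt_eqF.
    by rewrite divr_ge0 ?sqr_ge0// mulr_ge0// ltW.
  have := key (x j); have := key (y j); rewrite mulrDl; lra.
by rewrite -mulr_suml lerD2r ler_wpM2r// invr_ge0 mulr_ge0// ltW.
Qed.

End UniformQuartic.

Section QuarticLower.
Context {R : realType} {dT : measure_display} {T : measurableType dT}.
Variables (m d : nat) (X : 'I_m * 'I_d * bool -> T -> R).
Local Notation coords := ('I_d * bool -> R).
Local Notation block_sqmod := (block_sqmod X).
Local Notation block_clipped := (block_clipped X).

Variables (b1 b2 : 'I_m -> R) (K1 : R).
Hypothesis K10 : 0 <= K1.
Local Notation beta j := (b1 j ^+ 2 + b2 j ^+ 2).
Hypothesis bK : \sum_j beta j ^+ 2 <= K1 * m%:R.

Lemma sum_beta_le : \sum_j beta j <= (1 + K1) / 2 * m%:R.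
Proof.
apply: (@le_trans _ _ (\sum_j (1 / 2 + 1 / 2 * beta j ^+ 2))).
  by apply: ler_sum => j _; have := sqr_ge0 (beta j - 1); lra.
have cst (z : R) : \sum_(j < m) z = z * m%:R by rewrite sumr_const card_ord mulr_natr.
by rewrite big_split/= cst -mulr_sumr; have := bK; move: (\sum_j beta j ^+ 2) => S h; lra.
Qed.

Definition quartic_sum (c e : coords) t w :=
  \sum_j quartic (lin (gblock X j) c w) (lin (gblock X j) (rot c) w)
    (lin (gblock X j) e w + t * b1 j) (lin (gblock X j) (rot e) w + t * b2 j).

Variables (M : R) (k : nat).
Hypotheses (M0 : 0 < M) (k100 : (100 <= k)%N).
Local Notation eps := (k%:R^-1 : R).

Let k0 : (0 < k)%N. Proof. exact: leq_trans k100. Qed.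
Let k0' : 0 < k%:R :> R. Proof. by rewrite ltr0n. Qed.
Let eps0 : 0 < eps. Proof. by rewrite invr_gt0. Qed.

Variables (w : T) (del : R).
Hypothesis opw : forall (c : coords) r, 0 < r -> sqnorm c <= r ^+ 2 ->
  \sum_j block_sqmod j c w <= 4 * r ^+ 2 * m%:R.

(** The change per sample is at most 128 M^3 times a sum of absolute increments; [norm_sum_le]
    bounds their totals by eps m, from [opw] for the Gaussian increments and [sum_beta_le] for those
    in t. *)
Lemma scaled_sum_lipschitz (c e c' e' : coords) t t' :
  sqnorm (fun i => c i - c' i) <= eps ^+ 2 ->
  sqnorm (fun i => e i - e' i) <= eps ^+ 2 -> `|t - t'| <= eps ->
  scaled_sum X b1 b2 M t' c' e' w <= scaled_sum X b1 b2 M t c e w +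
    128 * M ^+ 3 * (eps * (8 + K1) * m%:R).
Proof.
move=> cc ee tt.
pose D (a : coords) j := `|lin (gblock X j) a w| + `|lin (gblock X j) (rot a) w|.
have HD (a : coords) : sqnorm a <= eps ^+ 2 -> \sum_j D a j <= (4 / 2 + 1) * eps * m%:R.
  by move=> ha; apply: norm_sum_le => //; exact: opw.
have Hb : \sum_j (`|b1 j| + `|b2 j|) <= ((1 + K1) / 2 / 2 + 1) * 1 * m%:R.
  by apply: norm_sum_le => //; rewrite expr1n mulr1; exact: sum_beta_le.
pose dc i := c i - c' i; pose de i := e i - e' i.
have step : scaled_sum X b1 b2 M t' c' e' w - scaled_sum X b1 b2 M t c e w <=
    128 * M ^+ 3 * (\sum_j D dc j + (\sum_j D de j + eps * \sum_j (`|b1 j| + `|b2 j|))).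
  rewrite mulr_sumr -!big_split/= mulr_sumr /scaled_sum -sumrB.
  apply: ler_sum => j _; apply: (le_trans (ler_norm _)); rewrite distrC.
  apply: (le_trans (clipped_quartic_lipschitz M0 _ _ _ _ _ _ _ _)).
  apply: ler_wpM2l; first by rewrite mulr_ge0 ?exprn_ge0// ltW.
  apply: lerD; first by rewrite /D /dc rotB !linB.
  rewrite /D /de rotB !linB mulrDr addrACA; apply: lerD.
    have -> : lin (gblock X j) e w + t * b1 j - (lin (gblock X j) e' w + t' * b1 j) =
      lin (gblock X j) e w - lin (gblock X j) e' w + (t - t') * b1 j by ring.
    by rewrite (le_trans (ler_normD _ _))// lerD2l normrM ler_wpM2r.
  set p := lin _ (rot e) w; set q := lin _ (rot e') w.
  have -> : p + t * b2 j - (q + t' * b2 j) = p - q + (t - t') * b2 j by ring.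
  by rewrite (le_trans (ler_normD _ _))// lerD2l normrM ler_wpM2r.
rewrite -lerBlDl; apply: (le_trans step); apply: ler_wpM2l.
  by rewrite mulr_ge0 ?exprn_ge0// ltW.
have := HD _ cc; have := HD _ ee; rewrite -/dc -/de.
have : eps * (\sum_j (`|b1 j| + `|b2 j|)) <= eps * (((1 + K1) / 2 / 2 + 1) * 1 * m%:R).
  by rewrite ler_wpM2l// ltW.
move: (\sum_j D dc j) (\sum_j D de j) (\sum_j (`|b1 j| + `|b2 j|)) => x y z.
have : 0 <= eps * K1 * m%:R by rewrite !mulr_ge0// ltW.
have : 0 <= eps * m%:R by rewrite !mulr_ge0// ltW.
by lra.
Qed.

Hypothesis block_clippedw : forall (c e : coords) (t : R), sqnorm c <= 1 -> sqnorm e <= 1 ->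
  0 <= t -> t <= 1 -> exists c' e' t',
  [/\ sqnorm c' <= 1 /\ sqnorm e' <= 1 , 0 <= t' <= t /\ t - t' <= eps,
      sqnorm (fun i => c i - c' i) <= eps ^+ 2 /\ sqnorm c - 2 * eps <= sqnorm c',
      sqnorm (fun i => e i - e' i) <= eps ^+ 2 /\ sqnorm e - 2 * eps <= sqnorm e' &
      m%:R * (sqnorm e' * sqnorm c') + 2 * sqnorm c' * (t' ^+ 2 * \sum_j beta j) -
      10 ^+ 6 * (1 + K1) * m%:R / M ^+ 2 - del * m%:R <= scaled_sum X b1 b2 M t' c' e' w].

(** The net error is paid twice, in the clipped sum and in its expected value, where the norms of
    c', e' and t' have dropped by O(eps). Removing the clipping is free, since it can only increase
    the sum. *)
Lemma quartic_sum_lower (c e : coords) t : sqnorm c = 1 -> sqnorm e + t ^+ 2 = 1 -> 0 <= t ->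
  m%:R * sqnorm e + 2 * t ^+ 2 * \sum_j beta j -
  (eps * (8 + 4 * K1 + 128 * M ^+ 3 * (8 + K1)) + 10 ^+ 6 * (1 + K1) / M ^+ 2 + del) * m%:R
  <= quartic_sum c e t w.
Proof.
move=> c1 et1 t0.
have e0 := sqnorm_ge0 e.
have t21 : t ^+ 2 <= 1 by lra.
have t1 : t <= 1 by rewrite -(@expr_le1 _ 2).
have e1 : sqnorm e <= 1 by have := sqr_ge0 t; lra.
have c1' : sqnorm c <= 1 by rewrite c1.
have [c' [e' [t' [[c'1 e'1] [/andP[t'0 t't] tt'] [cc cn] [ee en] low]]]] := block_clippedw c1' e1 t0 t1.
have tt : `|t - t'| <= eps by rewrite ger0_norm ?subr_ge0.
have lip := scaled_sum_lipschitz cc ee tt.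
have S0 : 0 <= \sum_j beta j by apply: sumr_ge0 => j _; rewrite addr_ge0 ?sqr_ge0.
have SK := sum_beta_le.
have up : scaled_sum X b1 b2 M t c e w <= quartic_sum c e t w.
  by apply: ler_sum => j _; exact: clipped_quartic_le.
apply: le_trans up; rewrite -lerBlDr in lip; apply: le_trans lip.
rewrite -lerBlDr opprK -/eps; apply: le_trans low.
have n0 : 0 <= m%:R :> R by [].
rewrite c1 in cn; have c'0 := sqnorm_ge0 c'; have e'0 := sqnorm_ge0 e'.
have h1 : sqnorm e - 4 * eps <= sqnorm e' * sqnorm c'.
  have : sqnorm e' * (1 - 2 * eps) <= sqnorm e' * sqnorm c' by rewrite ler_wpM2l.
  have : sqnorm e' * eps <= eps by rewrite ler_piMl// ltW.
  by lra.
have h2 : t ^+ 2 - 4 * eps <= sqnorm c' * t' ^+ 2.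
  have t'2 : t' ^+ 2 <= 1 by rewrite exprn_ile1// (le_trans t't).
  have g1 : t ^+ 2 - t' ^+ 2 <= 2 * eps.
    have -> : t ^+ 2 - t' ^+ 2 = (t - t') * (t + t') by ring.
    rewrite (mulrC 2); apply: ler_pM => //; first by rewrite subr_ge0.
      by rewrite addr_ge0.
    by have := le_trans t't t1; lra.
  have : (1 - 2 * eps) * t' ^+ 2 <= sqnorm c' * t' ^+ 2 by rewrite ler_wpM2r ?sqr_ge0.
  have : eps * t' ^+ 2 <= eps by rewrite ler_piMr// ltW.
  by lra.
have h1' : m%:R * (sqnorm e - 4 * eps) <= m%:R * (sqnorm e' * sqnorm c') by rewrite ler_wpM2l.
have h2' : (t ^+ 2 - 4 * eps) * \sum_j beta j <= sqnorm c' * t' ^+ 2 * \sum_j beta j.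
  by rewrite ler_wpM2r.
have h3 : eps * \sum_j beta j <= eps * ((1 + K1) / 2 * m%:R) by rewrite ler_wpM2l// ltW.
have -> : 10 ^+ 6 * (1 + K1) * m%:R / M ^+ 2 = 10 ^+ 6 * (1 + K1) / M ^+ 2 * m%:R by rewrite mulrAC.
move: (\sum_j beta j) (10 ^+ 6 * (1 + K1) / M ^+ 2) S0 SK h2' h3 => S z S0 SK h2' h3.
move: h1' h2' h3; move: (sqnorm e') (sqnorm c') (sqnorm e) (t ^+ 2) (t' ^+ 2) (M ^+ 3) => *; nra.
Qed.

End QuarticLower.

Lemma probability_setCI {R : realType} {dT : measure_display} {T : measurableType dT}
    (P : probability T R) (A B : set T) (a b : R) : measurable A -> measurable B ->
  (P (~` A) <= a%:E)%E -> (P (~` B) <= b%:E)%E -> (P (~` (A `&` B)) <= (a + b)%:E)%E.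
Proof.
move=> mA mB PA PB; rewrite setCI EFinD; apply: le_trans.
  by apply: measureU2; exact: measurableC.
exact: leeD.
Qed.

Lemma quartic_uniform (R : realType) (K1 : R) : 0 <= K1 ->
  exists (D : nat) (a : R), [/\ (0 < D)%N, 0 < a &
  forall (dT : measure_display) (T : measurableType dT) (P : probability T R) (m d : nat)
    (X : 'I_m * 'I_d * bool -> T -> R) (b1 b2 : 'I_m -> R),
  iid_complex_gaussian P X -> (0 < d)%N ->
  \sum_j (b1 j ^+ 2 + b2 j ^+ 2) ^+ 2 <= K1 * m%:R ->
  exists G : set T, [/\ measurable G,
    forall w, G w -> forall (c e : 'I_d * bool -> R) t,
      sqnorm c = 1 -> sqnorm e + t ^+ 2 = 1 -> 0 <= t ->
      m%:R * sqnorm e + 2 * t ^+ 2 * (\sum_j (b1 j ^+ 2 + b2 j ^+ 2)) - 20^-1 * m%:R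
      <= quartic_sum X b1 b2 c e t w &
    (P (~` G) <= ((D ^ d)%:R * expR (- (a * m%:R)))%:E)%E]].
Proof.
(* Budget for the error 1/20: this M keeps the clipping loss within 1/100, k will keep the net error
   within 1/40, and del is 1/100. *)
move=> K10; pose M : R := 10 ^+ 4 * (1 + K1).
have K11 : 0 < 1 + K1 by rewrite ltr_pwDl.
have M0 : 0 < M by rewrite mulr_gt0// exprn_gt0.
pose B0 := 8 + 4 * K1 + 128 * M ^+ 3 * (8 + K1).
have M30 : 0 <= 128 * M ^+ 3 * (8 + K1).
  by rewrite mulr_ge0 ?addr_ge0// mulr_ge0// exprn_ge0// ltW.
have B00 : 0 < B0 by rewrite /B0; lra.
have [k [k100 kB]] : exists k : nat, (100 <= k)%N /\ k%:R^-1 * B0 <= 40^-1.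
  pose k := (100 + Num.truncn (40 * B0))%N; exists k.
  have k100 : (100 <= k)%N by rewrite leq_addr.
  have k0 : 0 < k%:R :> R by rewrite ltr0n (leq_trans _ k100).
  split => //.
  rewrite mulrC ler_pdivrMr// mulrC ler_pdivlMr// mulrC.
  have /truncn_itv/andP[_ h] : 0 <= 40 * B0 by rewrite mulr_ge0// ltW.
  by apply: (le_trans (ltW h)); rewrite ler_nat /k -addn1 addnC leq_add2r.
pose lam1 : R := (10 ^+ 8)^-1 / 4.
pose del : R := 100^-1.
have M80 : 0 < 144 * M ^+ 8 by rewrite mulr_gt0// exprn_gt0.
pose lam : R := del / 2 / (144 * M ^+ 8).
have del0 : 0 < del by rewrite invr_gt0.
have lam0 : 0 < lam by rewrite !divr_gt0.
pose a := Num.min lam1 (lam * del / 2).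
have lam10 : 0 < lam1 by rewrite divr_gt0// invr_gt0 exprn_gt0.
have [E [E0 EE]] : exists E, (0 < E)%N /\ E = (2 ^ k * 4)%N.
  by exists (2 ^ k * 4)%N; rewrite muln_gt0 expn_gt0.
(* The nets have at most E^(2d) and E^(4d) (k + 1) points; together at most E^(4d) (k + 2), hence
   (E^4 (k + 2))^d as d >= 1. *)
exists (E ^ 4 * k.+2)%N, a; split.
- by rewrite muln_gt0 expn_gt0 E0.
- by rewrite lt_min lam10/= divr_gt0// mulr_gt0.
move=> dT T P m d X b1 b2 iidX d0 bK.
have [G1 [mG1 HG1 PG1]] := operator_norm_uniform iidX d0 k100.
have lamM : lam * (144 * M ^+ 8) <= del / 2 by rewrite /lam divfK// gt_eqF.
have [G2 [mG2 HG2 PG2]] := block_clipped_uniform iidX d0 bK M0 k100 lam0 del0 lamM.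
exists (G1 `&` G2); split; first exact: measurableI.
- move=> w [Gw1 Gw2] c e t c1 et t0.
  apply: le_trans (quartic_sum_lower K10 bK M0 k100 (HG1 _ Gw1) (HG2 _ Gw2) c1 et t0).
  rewrite lerD2l lerN2 ler_wpM2r//.
  have : 10 ^+ 6 * (1 + K1) / M ^+ 2 <= 100^-1.
    rewrite ler_pdivrMr ?exprn_gt0// /M exprMn.
    have -> : 100^-1 * ((10 ^+ 4) ^+ 2 * (1 + K1) ^+ 2) = 10 ^+ 6 * (1 + K1) * (1 + K1) :> R.
      by field.
    by rewrite ler_peMr ?lerDl// mulr_ge0 ?exprn_ge0// ltW.
  move: kB; rewrite -/B0 /del; move: (_ / M ^+ 2) (_ * B0) => x y hx hy.
  by lra.
- apply: (le_trans (probability_setCI mG1 mG2 PG1 PG2)); rewrite lee_fin.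
  have e1 : expR (- (lam1 * m%:R)) <= expR (- (a * m%:R)).
    by rewrite ler_expR lerN2 ler_wpM2r// ge_min lexx.
  have e2 : expR (- (lam * del / 2 * m%:R)) <= expR (- (a * m%:R)).
    by rewrite ler_expR lerN2 ler_wpM2r// ge_min lexx orbT.
  rewrite -EE; apply: (@le_trans _ _ ((E ^ (d * 2))%:R * expR (- (a * m%:R)) +
    (E ^ (d * 2) * E ^ (d * 2) * k.+1)%:R * expR (- (a * m%:R)))).
    by apply: lerD; apply: ler_wpM2l.
  rewrite -mulrDl ler_wpM2r ?expR_ge0// -natrD ler_nat.
  rewrite -expnD -mulnDr expnMn -expnM (mulnC 4 d).
  apply: (@leq_trans (E ^ (d * 4) * k.+2)).
    rewrite [in leqRHS]mulnS leq_add// ?leq_mul2l ?leqnSn ?orbT//.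
    by rewrite leq_pexp2l// leq_mul2l orbT.
  rewrite leq_mul2l -{1}(expn1 k.+2) leq_pexp2l ?orbT//.
Qed.

Lemma intensity_uniform (R : realType) (K1 K2 : R) : 0 <= K1 ->
  exists (D : nat) (a : R), [/\ (0 < D)%N, 0 < a &
  forall (dT : measure_display) (T : measurableType dT) (P : probability T R) (m d : nat)
    (X : 'I_m * 'I_d * bool -> T -> R) (x : 'I_d * bool -> R) (b1 b2 : 'I_m -> R),
  iid_complex_gaussian P X -> (0 < d)%N -> 1 <= ln (m%:R : R) -> sqnorm x <= 1 ->
  \sum_j (b1 j ^+ 2 + b2 j ^+ 2) ^+ 2 <= K1 * m%:R ->
  (forall j, b1 j ^+ 2 + b2 j ^+ 2 <= K2 ^+ 2 * ln m%:R) ->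
  exists G : set T, [/\ measurable G,
    forall w, G w -> forall c : 'I_d * bool -> R, sqnorm c <= 1 ->
      \sum_j block_intensity X x b1 b2 j w * block_sqmod X j c w <=
      \sum_j (b1 j ^+ 2 + b2 j ^+ 2) + (2 + 20^-1) * m%:R &
    (P (~` G) <= ((D ^ d)%:R * expR (- (a * (m%:R / ln m%:R))) + 2 / m%:R)%:E)%E]].
Proof.
move=> K10; have K11 : 0 < 1 + K1 by rewrite ltr_pwDl.
(* The first summand makes lam small enough for del = 1/100. The others put the level L0 ln m above
   y_j whenever |a_j^* x|^2 < 8 ln m, because y_j <= 2 (|a_j^* x|^2 + |b_j|^2). *)
pose L0 : R := 10 ^+ 9 * (1 + K1) + 16 + 2 * K2 ^+ 2.
have L1 : 10 ^+ 9 * (1 + K1) <= L0.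
  by rewrite /L0; have := sqr_ge0 K2; lra.
have L2 : 16 + 2 * K2 ^+ 2 <= L0.
  have : 0 <= 10 ^+ 9 * (1 + K1) by rewrite mulr_ge0 ?exprn_ge0// ltW.
  by rewrite /L0; lra.
have L00 : 0 < L0 by apply: lt_le_trans L2; have := sqr_ge0 K2; lra.
(* The net factor 5/k acts on a total of at most (4 + K1) m, so it costs at most m/25; with del =
   1/100 this makes exactly 1/20. *)
have [k [k100 kK]] : exists k : nat, (100 <= k)%N /\ k%:R^-1 * (125 * (4 + K1)) <= 1.
  pose k := (100 + Num.truncn (125 * (4 + K1)))%N; exists k.
  have k100 : (100 <= k)%N by rewrite leq_addr.
  have k0 : 0 < k%:R :> R by rewrite ltr0n (leq_trans _ k100).
  split => //.
  rewrite mulrC ler_pdivrMr// mul1r.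
  have /truncn_itv/andP[_ h] : 0 <= 125 * (4 + K1) by rewrite mulr_ge0// addr_ge0.
  by apply: (le_trans (ltW h)); rewrite ler_nat /k -addn1 addnC leq_add2r.
have [E [E0 EE]] : exists E, (0 < E)%N /\ E = (2 ^ k * 4)%N.
  by exists (2 ^ k * 4)%N; rewrite muln_gt0 expn_gt0.
exists (E ^ 2)%N, (16 * L0 * 200)^-1; split.
- by rewrite expn_gt0 E0.
- by rewrite invr_gt0 mulr_gt0// mulr_gt0.
move=> dT T P m d X x b1 b2 iidX d0 lnm x1 bK bmax.
have lnm0 : 0 < ln (m%:R : R) by exact: lt_le_trans lnm.
have m0 : 0 < m%:R :> R.
  by rewrite ltr0n lt0n; apply: contraTneq lnm0 => ->; rewrite ln0// ltxx.
pose Lam := L0 * ln m%:R.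
have Lam0 : 0 < Lam by rewrite mulr_gt0.
pose lam := (16 * Lam)^-1.
have lam0 : 0 < lam by rewrite invr_gt0 mulr_gt0.
have lamLam : lam * Lam <= 16^-1 by rewrite /lam invfM -mulrA mulVf ?mulr1// gt_eqF.
have lamK : lam * (10 ^+ 7 * (1 + K1)) <= 100^-1 / 2.
  rewrite /lam mulrC ler_pdivrMr ?mulr_gt0//.
  have : 10 ^+ 9 * (1 + K1) <= Lam.
    by apply: (le_trans L1); rewrite ler_peMr// ltW.
  have -> : 10 ^+ 9 = 100 * 10 ^+ 7 :> R by ring.
  have : 0 <= 10 ^+ 7 * (1 + K1) by rewrite mulr_ge0 ?exprn_ge0// ltW.
  rewrite -mulrA; move: (_ * (1 + K1)) => z z0 h.
  by lra.
have k4 : (4 <= k)%N by exact: leq_trans k100.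
have [G1 [mG1 HG1 PG1]] := weighted_uniform iidX d0 x1 bK (ltW Lam0) lam0 lamLam lamK k4.
(* At this threshold each tail is at most 3/2 m^-2, so that m of them cost at most 2/m. *)
pose A j := [set w | 8 * ln m%:R <= sqmod (gblock X j) x (rot x) w].
have [] := @union_bound _ _ _ P _ (enum 'I_m) A (3 / 2 * expR (- (8 * ln m%:R / 4))).
- move=> j; apply: measurable_ge_cst.
  exact: measurable_sqmod (measurable_gblock iidX j) _ _.
- move=> j _; apply: prob_sqmod_ge => //.
  + exact: measurable_gblock iidX j.
  + exact: block_mgf iidX j.
  + exact: sqnorm_rot.
move=> G2 [mG2 HG2 PG2]; exists (G1 `&` G2); split; first exact: measurableI.
- move=> w [Gw1 Gw2] c c1.
  have ymin j : Num.min (block_intensity X x b1 b2 j w) Lam = block_intensity X x b1 b2 j w.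
    apply/min_idPl.
    have : sqmod (gblock X j) x (rot x) w < 8 * ln m%:R.
      have := HG2 _ Gw2 j; rewrite mem_enum => /(_ isT).
      by rewrite /A/= => /negP; rewrite -ltNge.
    have h : block_intensity X x b1 b2 j w <= 2 * (sqmod (gblock X j) x (rot x) w + (b1 j ^+ 2 + b2 j ^+ 2)).
      rewrite /block_intensity /intensity /sqmod.
      have := sqr_ge0 (lin (gblock X j) x w - b1 j).
      have := sqr_ge0 (lin (gblock X j) (rot x) w - b2 j); nra.
    have : (16 + 2 * K2 ^+ 2) * ln m%:R <= Lam by rewrite ler_wpM2r// ltW.
    by have := bmax j; lra.
  have := HG1 _ Gw1 c c1; under eq_bigr do rewrite ymin; move=> H.
  apply: (le_trans H).
  have SK := sum_beta_le bK.
  have S0 : 0 <= \sum_j (b1 j ^+ 2 + b2 j ^+ 2).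
    by apply: sumr_ge0 => j _; rewrite addr_ge0 ?sqr_ge0.
  move: (\sum_j (b1 j ^+ 2 + b2 j ^+ 2)) SK S0 => S SK S0.
  have h1 : k%:R^-1 * (S + (2 + 100^-1) * m%:R) <= k%:R^-1 * ((4 + K1) * m%:R).
    apply: ler_wpM2l; first by rewrite invr_ge0.
    have : 0 <= K1 * m%:R by rewrite mulr_ge0// ltW.
    by lra.
  have h2 : k%:R^-1 * (125 * (4 + K1)) * m%:R <= 1 * m%:R by rewrite ler_wpM2r// ltW.
  by lra.
- have fin := probability_setCI mG1 mG2 PG1 PG2.
  apply: (le_trans fin); rewrite lee_fin; apply: lerD.
    rewrite -EE -expnM (mulnC 2 d) ler_wpM2l// ler_expR lerN2.
    rewrite le_eqVlt; apply/orP; left; apply/eqP; rewrite /lam /Lam.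
    by field; rewrite !gt_eqF.
  rewrite size_enum_ord.
  have -> : 8 * ln m%:R / 4 = ln m%:R + ln m%:R :> R by field.
  rewrite opprD expRD expRN lnK ?posrE//.
  rewrite (_ : m%:R * _ = 3 / 2 / m%:R :> R); last by field; rewrite gt_eqF.
  by rewrite ler_pM2r ?invr_gt0//; lra.
Qed.

(** * Comparison of m / ln m with d *)

Section Growth.
Context {R : realType}.

Lemma expR1_le4 : expR 1 <= 4 :> R.
Proof.
have h : 1 / 2 <= expR (- (1 / 2)) :> R by have := expR_ge1Dx (- (1 / 2) : R); lra.
have p : 0 < expR (1 / 2) :> R by exact: expR_gt0.
have e2 : expR (1 / 2) <= 2 :> R.
  have : 1 / 2 * expR (1 / 2) <= 1 :> R.
    by rewrite -[leRHS](@expRxMexpNx_1 R (1 / 2)) mulrC ler_wpM2l// ltW.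
  by lra.
have -> : 1 = 1 / 2 + 1 / 2 :> R by field.
by rewrite expRD; have := ler_pM (ltW p) (ltW p) e2 e2; lra.
Qed.

Lemma ln_ge1 (x : R) : 4 <= x -> 1 <= ln x.
Proof.
move=> x4; have x0 : 0 < x by lra.
by rewrite -ler_expR lnK ?posrE// (le_trans expR1_le4).
Qed.

Lemma ln_le_sub1 (x : R) : 0 < x -> ln x <= x - 1.
Proof.
by move=> x0; have := expR_ge1Dx (ln x); rewrite lnK ?posrE//; lra.
Qed.

Lemma ln2_ge_half : 1 / 2 <= ln 2 :> R.
Proof.
have h : 0 < 2^-1 :> R by rewrite invr_gt0.
by have := ln_le_sub1 h; rewrite lnV ?posrE//; lra.
Qed.

(** If m <= d^4, then ln m <= 4 ln d and C >= 4 Q suffices. Otherwise r = m^(1/4) exceeds d and ln m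
    <= 4 r, so Q d ln m <= 4 Q sqrt m <= m, because m >= C >= 16 Q^2. The 4 in C gives m >= 4 and
    thus ln m >= 1. *)
Lemma div_ln_lower (Q : R) : 0 < Q -> exists C : R, 0 < C /\
  forall d m : nat, (2 <= d)%N -> C * d%:R * ln d%:R <= m%:R ->
  1 <= ln (m%:R : R) /\ Q * d%:R <= m%:R / ln m%:R.
Proof.
move=> Q0; pose C := 4 + 4 * Q + 16 * Q ^+ 2.
have Q20 : 0 <= Q ^+ 2 by exact: sqr_ge0.
have C0 : 0 < C by rewrite /C; lra.
exists C; split => // d m d2 Cm.
have d2' : 2 <= d%:R :> R by rewrite ler_nat.
have d0 : 0 < d%:R :> R by lra.
have lnd : 1 / 2 <= ln (d%:R : R).
  by apply: (le_trans ln2_ge_half); rewrite ler_ln ?posrE.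
have Cm' : C <= m%:R.
  apply: le_trans Cm; rewrite -mulrA ler_peMr// ?(ltW C0)//.
  have : 2 * (1 / 2) <= d%:R * ln (d%:R : R) by rewrite ler_pM//; lra.
  by lra.
have m4 : 4 <= m%:R :> R by apply: le_trans Cm'; rewrite /C; lra.
have lnm := ln_ge1 m4; split => //.
have lnm0 : 0 < ln (m%:R : R) by lra.
have m0 : 0 < m%:R :> R by lra.
rewrite ler_pdivlMr//.
have [md|md] := leP (m%:R : R) (d%:R ^+ 4).
  have lm : ln (m%:R : R) <= 4 * ln d%:R.
    have <- : ln (d%:R ^+ 4) = 4 * ln d%:R :> R.
      by rewrite lnXn// mulr_natl.
    by rewrite ler_ln ?posrE ?exprn_gt0.
  apply: le_trans Cm; apply: (@le_trans _ _ (Q * d%:R * (4 * ln d%:R))).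
    by rewrite ler_wpM2l// mulr_ge0// ltW.
  have : 0 <= d%:R * ln (d%:R : R) by rewrite mulr_ge0//; lra.
  have -> : Q * d%:R * (4 * ln d%:R) = 4 * Q * (d%:R * ln d%:R) by ring.
  rewrite -[C * _ * _]mulrA => h; rewrite ler_wpM2r// /C; lra.
pose q := Num.sqrt (m%:R : R); pose r := Num.sqrt q.
have q0 : 0 < q by rewrite sqrtr_gt0.
have r0 : 0 < r by rewrite sqrtr_gt0.
have rq : r ^+ 2 = q by rewrite sqr_sqrtr// ltW.
have qm : q ^+ 2 = m%:R by rewrite sqr_sqrtr// ltW.
have rm : r ^+ 4 = m%:R by rewrite -[4%N]/(2 * 2)%N exprM rq qm.
have dr : d%:R <= r.
  by rewrite -(@ler_pXn2r _ 4)// ?nnegrE ?rm ?(ltW r0)// ltW.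
have lm : ln (m%:R : R) <= 4 * r.
  have -> : ln (m%:R : R) = 4 * ln r by rewrite -rm lnXn// mulr_natl.
  rewrite ler_pM2l//.
  by apply: (le_trans (ln_le_sub1 r0)); lra.
have qQ : 4 * Q <= q.
  rewrite -(@ler_pXn2r _ 2)// ?nnegrE ?mulr_ge0 ?(ltW q0) ?(ltW Q0)//.
  by rewrite qm exprMn; apply: le_trans Cm'; rewrite /C; lra.
apply: (@le_trans _ _ (Q * r * (4 * r))).
  by apply: ler_pM => //; [rewrite mulr_ge0// ltW|exact: ltW|rewrite ler_wpM2l// ltW].
have -> : Q * r * (4 * r) = 4 * Q * r ^+ 2 by ring.
by rewrite -qm rq expr2 ler_wpM2r// ltW.
Qed.

Lemma expn_expR_absorb (D d : nat) (a Q L : R) :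
  (0 < D)%N -> 0 < a -> 2 * ln D%:R / a <= Q -> Q * d%:R <= L ->
  (D ^ d)%:R * expR (- (a * L)) <= expR (- (a / 2 * L)).
Proof.
move=> D0 a0 HQ HL.
have D0' : 0 < D%:R :> R by rewrite ltr0n.
rewrite natrX -[D%:R in X in X <= _]lnK ?posrE// -expRM_natl -expRD ler_expR.
have : d%:R * ln D%:R <= a / 2 * L.
  apply: (@le_trans _ _ (a / 2 * (Q * d%:R))); last by rewrite ler_wpM2l// divr_ge0 ?ltW.
  rewrite mulrA mulrC ler_wpM2r//.
  by move: HQ; rewrite ler_pdivrMr//; lra.
by lra.
Qed.

End Growth.

(** * Complex coordinates and the Hessian form *)

Section ComplexCoordinates.
Context {R : realType} {dT : measure_display} {T : measurableType dT}.
Variables (m d : nat) (X : 'I_m * 'I_d * bool -> T -> R).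
Local Notation C := R[i].

Definition coords (v : 'cV[C]_d) (k : 'I_d * bool) : R :=
  if k.2 then complex.Im (v k.1 0) else complex.Re (v k.1 0).

Lemma cabs_sqr (z : C) : cabs z ^+ 2 = complex.Re z ^+ 2 + complex.Im z ^+ 2.
Proof. by rewrite sqr_sqrtr// addr_ge0 ?sqr_ge0. Qed.

Lemma vnormE (v : 'cV[C]_d) : vnorm v = Num.sqrt (sqnorm (coords v)).
Proof.
rewrite /vnorm /sqnorm sum_pair_bool; congr Num.sqrt; apply: eq_bigr => i _.
by rewrite cabs_sqr /coords/= addrC.
Qed.

Lemma vnorm_sqr (v : 'cV[C]_d) : vnorm v ^+ 2 = sqnorm (coords v).
Proof. by rewrite vnormE sqr_sqrtr// sqnorm_ge0. Qed.

Lemma sum_Complex (I : finType) (f g : I -> R) :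
  \sum_i (Complex (f i) (g i) : C) = Complex (\sum_i f i) (\sum_i g i).
Proof.
elim: (index_enum I) => [|i s IH]; first by rewrite !big_nil.
by rewrite !big_cons IH.
Qed.

Lemma sc_adj_gvec (v : 'cV[C]_d) w j :
  sc (mxadj (gvec X w j) *m v) =
  Complex (lin (gblock X j) (coords v) w) (lin (gblock X j) (rot (coords v)) w).
Proof.
rewrite /sc mxE /lin /dotf !sum_pair_bool -sum_Complex; apply: eq_bigr => k _.
rewrite /mxadj !mxE /coords /rot /gblock/=.
case: (v k 0) => v1 v2 /=; apply/eqP; rewrite eq_complex/=.
by apply/andP; split; apply/eqP; ring.
Qed.

End ComplexCoordinates.

Section HessianForm.
Context {R : realType}.
Local Notation C := R[i].

Lemma sc_adj_swap d (a v : 'cV[C]_d) : sc (mxadj v *m a) = conjc (sc (mxadj a *m v)).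
Proof.
rewrite /sc !mxE rmorph_sum; apply: eq_bigr => k _.
by rewrite /mxadj !mxE rmorphM/= conjcK mulrC.
Qed.

(** Every block is a multiple of a rank-one product, so the form splits into products of a^* v and
    its conjugate. *)
Lemma hess_form_block d (a v : 'cV[C]_d) (al u2 u2' : C) :
  let s := sc (mxadj a *m v) in
  sc (mxadj (col_mx v (mxconj v)) *m
    block_mx (al *: (a *m mxadj a)) (u2 *: (a *m a^T))
             (u2' *: (mxconj a *m mxadj a)) (al *: (mxconj a *m a^T)) *m
    col_mx v (mxconj v)) =
  al * (conjc s * s) + u2' * (s * s) + (u2 * (conjc s * conjc s) + al * (s * conjc s)).
Proof.
move=> s.
have -> : mxadj (col_mx v (mxconj v)) = row_mx (mxadj v) v^T.
  rewrite /mxadj tr_col_mx map_row_mx; congr row_mx.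
  by apply/matrixP => i j; rewrite !mxE conjcK.
have sc11 (A B : 'M[C]_1) : sc (A *m B) = sc A * sc B.
  by rewrite /sc mxE big_ord1.
have scD (A B : 'M[C]_1) : sc (A + B) = sc A + sc B by rewrite /sc mxE.
have scZ k (A : 'M[C]_1) : sc (k *: A) = k * sc A by rewrite /sc mxE.
have s1 : sc (mxadj v *m a) = conjc s by exact: sc_adj_swap.
have s2 : sc (v^T *m mxconj a) = s.
  by rewrite /s /sc !mxE; apply: eq_bigr => k _; rewrite /mxadj /mxconj !mxE mulrC.
have s3 : sc (a^T *m mxconj v) = conjc s.
  rewrite -s1 /sc !mxE; apply: eq_bigr => k _; rewrite /mxadj /mxconj !mxE mulrC.
  by [].
have rank1 (r : 'rV[C]_d) (k : C) (p : 'cV[C]_d) (q : 'rV[C]_d) (t : 'cV[C]_d) :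
    sc (r *m (k *: (p *m q)) *m t) = k * (sc (r *m p) * sc (q *m t)).
  by rewrite -scalemxAr -scalemxAl scZ -sc11 !mulmxA.
rewrite mul_row_block mul_row_col !mulmxDl !scD !rank1 s1 s2 s3 -/s.
by ring.
Qed.

End HessianForm.

Section HessianFormula.
Context {R : realType} {dT : measure_display} {T : measurableType dT}.
Variables (m d : nat) (X : 'I_m * 'I_d * bool -> T -> R).
Local Notation C := R[i].

(** A sample contributes 2 (2 |u|^2 - y) |s|^2 + 2 Re (u^2 conj(s)^2), and Re (u^2 conj(s)^2) = 2
    (Re (u conj s))^2 - |u|^2 |s|^2. *)
Lemma hess_form_gvec (b : 'cV[C]_m) (y : 'I_m -> R) (v z : 'cV[C]_d) w : (0 < m)%N ->
  hess_form (wirtinger_hessian (gvec X w) b y z) v =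
  rC (2 / m%:R * (\sum_j (quartic (lin (gblock X j) (coords v) w)
      (lin (gblock X j) (rot (coords v)) w)
      (lin (gblock X j) (coords z) w + complex.Re (b j 0))
      (lin (gblock X j) (rot (coords z)) w + complex.Im (b j 0)) -
    y j * block_sqmod X j (coords v) w))).
Proof.
move=> m0; rewrite /hess_form /wirtinger_hessian.
rewrite -scalemxAr -scalemxAl mulmx_sumr mulmx_suml {1}/sc mxE summxE.
under eq_bigr => j _.
  rewrite -/(sc _) hess_form_block sc_adj_gvec.
  rewrite (sc_adj_swap (gvec X w j) z) !sc_adj_gvec.
  over.
have m0' : m%:R != 0 :> R by rewrite pnatr_eq0 -lt0n.
have -> : (rC (m%:R : R))^-1 = rC (m%:R^-1).
  apply: (@mulfI _ (rC m%:R)); first by rewrite eq_complex/= negb_and m0'.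
  rewrite mulfV; last by rewrite eq_complex/= negb_and m0'.
  by apply/eqP; rewrite eq_complex/= mul0r subr0 mulfV// mulr0 mul0r addr0 !eqxx.
have rCM (a c : R) : rC a * rC c = rC (a * c).
  by apply/eqP; rewrite eq_complex/= !mulr0 mul0r subr0 addr0 !eqxx.
have sumrC (F : 'I_m -> R) : \sum_j rC (F j) = rC (\sum_j F j).
  by rewrite /rC sum_Complex; congr Complex; rewrite big1.
rewrite (eq_bigr (fun j => rC (2 * (quartic (lin (gblock X j) (coords v) w)
      (lin (gblock X j) (rot (coords v)) w)
      (lin (gblock X j) (coords z) w + complex.Re (b j 0))
      (lin (gblock X j) (rot (coords z)) w + complex.Im (b j 0)) -
    y j * block_sqmod X j (coords v) w)))); last first.
  move=> j _; rewrite /block_sqmod /sqmod /quartic.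
  move: (lin _ (coords v) w) (lin _ (rot (coords v)) w) (lin _ (coords z) w)
    (lin _ (rot (coords z)) w) (b j 0) => s1 s2 p1 p2 [q1 q2].
  rewrite cabs_sqr ![_ ^+ 2 * (_ * _)]mulrA !expr2 /=.
  by apply/eqP; rewrite eq_complex/=; apply/andP; split; apply/eqP; ring.
rewrite sumrC rCM -mulr_sumr; congr rC.
by rewrite mulrA; congr (_ * _); rewrite mulrC.
Qed.

End HessianFormula.

(** * The deterministic conclusion on the good event *)

Section Deterministic.
Context {R : realType} {dT : measure_display} {T : measurableType dT}.
Variables (m d : nat) (X : 'I_m * 'I_d * bool -> T -> R).
Local Notation C := R[i].
Variables (x : 'cV[C]_d) (b : 'cV[C]_m).
Hypothesis x0 : 0 < vnorm x.
Local Notation r := (vnorm x).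

Definition xdir (k : 'I_d * bool) : R := r^-1 * coords x k.
Definition bre (j : 'I_m) : R := complex.Re (b j 0) / r.
Definition bim (j : 'I_m) : R := complex.Im (b j 0) / r.
Local Notation beta j := (bre j ^+ 2 + bim j ^+ 2).

Lemma sqnorm_xdir : sqnorm xdir = 1.
Proof. by rewrite sqnormZ -vnorm_sqr exprVn mulVf// gt_eqF// exprn_gt0. Qed.

Lemma betaE j : beta j = cabs (b j 0) ^+ 2 / r ^+ 2.
Proof. by rewrite cabs_sqr /bre /bim; field; rewrite gt_eqF. Qed.

Lemma meas_gvec w j : meas (gvec X w) b x j = r ^+ 2 * block_intensity X xdir bre bim j w.
Proof.
rewrite /meas cabs_sqr sc_adj_gvec /block_intensity /intensity /xdir rotZ !linZ /bre /bim.
by case: (b j 0) => q1 q2 /=; field; rewrite gt_eqF.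
Qed.

Lemma quartic_homog (c ez : 'I_d * bool -> R) (N : R) w j : 0 < N ->
  quartic (lin (gblock X j) c w) (lin (gblock X j) (rot c) w)
    (lin (gblock X j) ez w + complex.Re (b j 0))
    (lin (gblock X j) (rot ez) w + complex.Im (b j 0)) =
  N ^+ 2 * quartic (lin (gblock X j) c w) (lin (gblock X j) (rot c) w)
    (lin (gblock X j) (fun k => N^-1 * ez k) w + r / N * bre j)
    (lin (gblock X j) (rot (fun k => N^-1 * ez k)) w + r / N * bim j).
Proof.
move=> N0; rewrite -[N ^+ 2]mul1r -[X in X * _ * _](expr1n _ 2) -quarticZ !mul1r.
by rewrite rotZ !linZ /bre /bim; congr quartic; field; rewrite !gt_eqF.
Qed.

(** With r = |x|, Z = |z|^2 and S the sum of the beta_j, scaling back by N^2 = Z + r^2 gives m Z + 2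
    r^2 S - (Z + r^2) m/20. Subtracting r^2 (S + 2.05 m) leaves at least r^2 (S - 2.1 m), the
    surplus 0.95 m Z being nonnegative: hence no restriction on z. *)
Lemma curvature_lower (w : T) (c0 : R) : (0 < m)%N ->
  c0 ^+ 2 * m%:R <= \sum_j beta j ->
  (forall c : 'I_d * bool -> R, sqnorm c <= 1 ->
    \sum_j block_intensity X xdir bre bim j w * block_sqmod X j c w <= \sum_j beta j + (2 + 20^-1) * m%:R) ->
  (forall (c e : 'I_d * bool -> R) t, sqnorm c = 1 -> sqnorm e + t ^+ 2 = 1 -> 0 <= t ->
    m%:R * sqnorm e + 2 * t ^+ 2 * (\sum_j beta j) - 20^-1 * m%:R <=
    quartic_sum X bre bim c e t w) ->
  forall v z : 'cV[C]_d, vnorm v = 1 ->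
    rC ((196%:R / 100%:R * c0 ^+ 2 - 44%:R / 10%:R) * r ^+ 2) <=
    hess_form (wirtinger_hessian (gvec X w) b (meas (gvec X w) b x) z) v.
Proof.
move=> m0 c0S HA HB v z v1.
have m0' : 0 < m%:R :> R by rewrite ltr0n.
(* The order of R[i] demands equal imaginary parts; both sides are images of [rC], so a real
   inequality remains. *)
rewrite hess_form_gvec// lecE/= eqxx/=.
set c := coords v; have c1 : sqnorm c = 1 by rewrite -vnorm_sqr v1 expr1n.
set ez := coords z; set Z := sqnorm ez; have Z0 : 0 <= Z := sqnorm_ge0 _.
pose N := Num.sqrt (Z + r ^+ 2).
have r20 : 0 < r ^+ 2 by rewrite exprn_gt0.
have N2 : N ^+ 2 = Z + r ^+ 2 by rewrite sqr_sqrtr// addr_ge0// ltW.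
have N0 : 0 < N by rewrite sqrtr_gt0 ltr_wpDl.
have N20 : 0 < N ^+ 2 by rewrite exprn_gt0.
pose e k := N^-1 * ez k; pose t := r / N.
have eE : sqnorm e = Z / N ^+ 2 by rewrite sqnormZ exprVn mulrC.
have tE : t ^+ 2 = r ^+ 2 / N ^+ 2 by rewrite /t expr_div_n.
have et : sqnorm e + t ^+ 2 = 1 by rewrite eE tE -mulrDl -N2 mulfV// gt_eqF.
have t0 : 0 <= t by rewrite divr_ge0 ?ltW.
have c1' : sqnorm c <= 1 by rewrite c1.
have hA := HA c c1'; have hB := HB c e t c1 et t0.
rewrite sumrB.
have -> : \sum_j quartic (lin (gblock X j) c w) (lin (gblock X j) (rot c) w)
    (lin (gblock X j) ez w + complex.Re (b j 0))
    (lin (gblock X j) (rot ez) w + complex.Im (b j 0)) =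
    N ^+ 2 * quartic_sum X bre bim c e t w.
  by rewrite mulr_sumr; apply: eq_bigr => j _; exact: quartic_homog.
have -> : \sum_j meas (gvec X w) b x j * block_sqmod X j c w =
    r ^+ 2 * \sum_j block_intensity X xdir bre bim j w * block_sqmod X j c w.
  by rewrite mulr_sumr; apply: eq_bigr => j _; rewrite meas_gvec mulrA.
move: (\sum_j block_intensity _ _ _ _ _ _ * _) (quartic_sum _ _ _ _ _ _ _) hA hB => Y Q hA hB.
move: (\sum_j beta j) c0S hA hB => S c0S hA hB.
have hA' : r ^+ 2 * Y <= r ^+ 2 * (S + (2 + 20^-1) * m%:R) by rewrite ler_wpM2l// ltW.
have hB' : m%:R * Z + 2 * r ^+ 2 * S - 20^-1 * m%:R * (Z + r ^+ 2) <= N ^+ 2 * Q.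
  have -> : m%:R * Z + 2 * r ^+ 2 * S - 20^-1 * m%:R * (Z + r ^+ 2) =
      N ^+ 2 * (m%:R * sqnorm e + 2 * t ^+ 2 * S - 20^-1 * m%:R).
    by rewrite eE tE -N2; field; rewrite gt_eqF.
  by rewrite ler_wpM2l// ltW.
have hS : r ^+ 2 * (c0 ^+ 2 * m%:R) <= r ^+ 2 * S by rewrite ler_wpM2l// ltW.
rewrite [leRHS]mulrAC ler_pdivlMr//.
have mZ : 0 <= m%:R * Z by rewrite mulr_ge0// ltW.
have : 0 <= c0 ^+ 2 * (m%:R * r ^+ 2) by rewrite mulr_ge0 ?sqr_ge0// mulr_ge0// ltW.
have : 0 <= m%:R * r ^+ 2 by rewrite mulr_ge0// ltW.
move: (N ^+ 2 * Q) (r ^+ 2 * Y) hA' hB' => q y hA' hB'.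
move: hS hA' hB'; move: (c0 ^+ 2) (r ^+ 2) => C0 r2 *.
by lra.
Qed.

End Deterministic.

Lemma cabs_le_vinfnorm (R : realType) m (b : 'cV[R[i]]_m) j : cabs (b j 0) <= vinfnorm b.
Proof. by rewrite /vinfnorm (bigD1 j)//= le_max lexx. Qed.

(** Normalization by |x| is impossible here, but the fourth-power bound forces b = 0, hence y = 0,
    and a sum of nonnegative quartics is compared with 0. *)
Lemma hess_form_x0 (R : realType) (dT : measure_display) (T : measurableType dT)
    (m d : nat) (X : 'I_m * 'I_d * bool -> T -> R) (x : 'cV[R[i]]_d) (b : 'cV[R[i]]_m)
    (K1 a : R) w (v z : 'cV[R[i]]_d) : (0 < m)%N -> vnorm x = 0 ->
  \sum_(j < m) cabs (b j 0) ^+ 4 <= K1 * m%:R * vnorm x ^+ 4 ->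
  rC (a * vnorm x ^+ 2) <=
  hess_form (wirtinger_hessian (gvec X w) b (meas (gvec X w) b x) z) v.
Proof.
move=> m0 x0; rewrite x0 !expr0n/= !mulr0 => b4.
have cx k : coords x k = 0.
  have : \sum_k coords x k ^+ 2 = 0 by rewrite -/(sqnorm _) -vnorm_sqr x0 expr0n.
  move/eqP; rewrite psumr_eq0; last by move=> i _; exact: sqr_ge0.
  by move/allP/(_ k); rewrite mem_index_enum sqrf_eq0 => /(_ isT)/eqP.
have lx0 j c : (forall k, c k = 0) -> lin (gblock X j) c w = 0.
  by move=> c0; rewrite /lin /dotf big1// => k _; rewrite c0 mul0r.
have y0 j : meas (gvec X w) b x j = 0.
  rewrite /meas sc_adj_gvec !lx0//; last by case=> i []; rewrite /rot/= cx ?oppr0.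
  have b4j : cabs (b j 0) ^+ 4 = 0.
    apply/eqP; rewrite eq_le exprn_ge0 ?sqrtr_ge0// andbT; apply: le_trans b4.
    by rewrite (bigD1 j)//= lerDl sumr_ge0// => i _; rewrite exprn_ge0 ?sqrtr_ge0.
  move/eqP: b4j; rewrite expf_eq0/= => /eqP bj; rewrite (_ : _ + b j 0 = b j 0); first by rewrite bj expr0n.
  by case: (b j 0) => p q; apply/eqP; rewrite eq_complex/= !add0r !eqxx.
rewrite hess_form_gvec// lecE/= eqxx/= mulr_ge0//.
by apply: sumr_ge0 => j _; rewrite y0 mul0r subr0 quartic_ge0.
Qed.

(** * Choice of the constants and assembly of the good events *)

Unset Implicit Arguments. Set Strict Implicit.

Theorem theorem2 (R : realType) (c0 K1 K2 : R) :
  Num.sqrt ((44%:R / 10%:R) / (196%:R / 100%:R)) < c0 -> 0 < K1 -> 0 < K2 ->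
  exists (C ca cb cc cd : R),
    [/\ 0 < C, 0 < ca, 0 < cb, 0 < cc & 0 < cd] /\
    forall (d m : nat) (x : 'cV[R[i]]_d) (b : 'cV[R[i]]_m),
      (0 < m)%N ->
      c0 * Num.sqrt (m%:R) * vnorm x <= vnorm b ->
      \sum_(j < m) cabs (b j 0) ^+ 4 <= K1 * m%:R * vnorm x ^+ 4 ->
      vinfnorm b <= K2 * Num.sqrt (ln (m%:R)) * vnorm x ->
      C * d%:R * ln (d%:R) <= m%:R ->
      forall (dT : measure_display) (T : measurableType dT) (P : probability T R)
             (X : 'I_m * 'I_d * bool -> T -> R),
        iid_complex_gaussian P X ->
        exists E : set T,
          [/\ measurable E,
              E `<=` [set w | forall v z : 'cV[R[i]]_d, vnorm v = 1 ->
                  rC ((196%:R / 100%:R * c0 ^+ 2 - 44%:R / 10%:R) * vnorm x ^+ 2)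
                  <= hess_form (wirtinger_hessian (gvec X w) b
                                  (meas (gvec X w) b x) z) v]
            & ((1 - ca / m%:R - 18%:R * expR (- (cd * d%:R))
                - cb * expR (- (cc * m%:R / ln (m%:R))))%:E <= P E)%E].
Proof.
move=> c0gt K10 K20.
have c00 : 0 < c0 by apply: le_lt_trans c0gt; exact: sqrtr_ge0.
have [D1 [a1 [D10 a10 HA]]] := intensity_uniform K2 (ltW K10).
have [D2 [a2 [D20 a20 HB]]] := quartic_uniform (ltW K10).
have lnD (D : nat) : (0 < D)%N -> 0 <= ln (D%:R : R).
  by move=> D0; apply: ln_ge0; rewrite ler1n.
(* Once Q d <= m / ln m, half of either exponent absorbs its net factor; the summand 1 keeps Q
   positive. *)
pose Q := 1 + 2 * ln D1%:R / a1 + 2 * ln D2%:R / a2.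
have Q1 : 0 <= 2 * ln D1%:R / a1 by rewrite divr_ge0 ?mulr_ge0 ?lnD// ltW.
have Q2 : 0 <= 2 * ln D2%:R / a2 by rewrite divr_ge0 ?mulr_ge0 ?lnD// ltW.
have Q0 : 0 < Q by rewrite /Q; lra.
have [C [C0 HC]] := div_ln_lower Q0.
pose cc := Num.min (a1 / 2) (a2 / 2).
(* The first 2 is the truncation loss 2/m, the second counts the two absorbed net bounds, and cc is
   the smaller of the two halved rates. *)
exists C, 2, 2, cc, 1; split.
  by split => //; rewrite lt_min !divr_gt0.
move=> d m x b m0 bL b4 binf Cm dT T P X iidX.
have m0' : 0 < m%:R :> R by rewrite ltr0n.
have e0 : 0 <= 2 * expR (- (cc * m%:R / ln m%:R)) by rewrite mulr_ge0// expR_ge0.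
have em0 : 0 <= 2 / m%:R :> R by rewrite divr_ge0// ltW.
have ed0 : 0 <= 18 * expR (- (1 * d%:R)) :> R by rewrite mulr_ge0// expR_ge0.
have [d1|d2] := leqP d 1.
  exists set0; split => //.
  rewrite measure0 lee_fin.
  have : 1 / 4 <= expR (- (1 * d%:R)) :> R.
    rewrite expRN -div1r; apply: (@le_trans _ _ (1 / expR 1)).
      by rewrite !div1r lef_pV2 ?posrE ?expR_gt0 ?expR1_le4.
    by rewrite !div1r lef_pV2 ?posrE ?expR_gt0// ler_expR mul1r lern1.
  by lra.
have d0 : (0 < d)%N by exact: leq_trans d2.
have [lnm QL] := HC _ _ d2 Cm.
have lnm0 : 0 < ln (m%:R : R) by lra.
have xge0 : 0 <= vnorm x by exact: sqrtr_ge0.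
have [x0|xn0] := eqVneq (vnorm x) 0.
  exists setT; split => //; first by move=> w _ v z _; exact: hess_form_x0 b4.
  by rewrite probability_setT lee_fin; lra.
have x0 : 0 < vnorm x by rewrite lt_def xn0.
have r20 : 0 < vnorm x ^+ 2 by rewrite exprn_gt0.
have r40 : 0 < vnorm x ^+ 4 by rewrite exprn_gt0.
have bK : \sum_j (bre x b j ^+ 2 + bim x b j ^+ 2) ^+ 2 <= K1 * m%:R.
  rewrite -(ler_pM2r r40); apply: le_trans b4; rewrite mulr_suml le_eqVlt.
  apply/orP; left; apply/eqP; apply: eq_bigr => j _.
  by rewrite betaE//; field; rewrite gt_eqF.
have bmax j : bre x b j ^+ 2 + bim x b j ^+ 2 <= K2 ^+ 2 * ln m%:R.
  rewrite betaE// ler_pdivrMr//.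
  have -> : K2 ^+ 2 * ln m%:R * vnorm x ^+ 2 = (K2 * Num.sqrt (ln m%:R) * vnorm x) ^+ 2.
    by rewrite !exprMn (sqr_sqrtr (ltW lnm0)).
  have h := le_trans (cabs_le_vinfnorm b j) binf.
  apply: lerXn2r => //; first by rewrite nnegrE sqrtr_ge0.
  by rewrite nnegrE !mulr_ge0 ?sqrtr_ge0 ?(ltW K20).
have bS : c0 ^+ 2 * m%:R <= \sum_j (bre x b j ^+ 2 + bim x b j ^+ 2).
  rewrite -(ler_pM2r r20).
  have -> : c0 ^+ 2 * m%:R * vnorm x ^+ 2 = (c0 * Num.sqrt m%:R * vnorm x) ^+ 2.
    by rewrite !exprMn (sqr_sqrtr (ltW m0')).
  apply: (@le_trans _ _ (vnorm b ^+ 2)).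
    by apply: lerXn2r => //; rewrite nnegrE ?sqrtr_ge0// !mulr_ge0 ?sqrtr_ge0 ?(ltW c00).
  rewrite sqr_sqrtr; last by apply: sumr_ge0 => j _; rewrite sqr_ge0.
  rewrite mulr_suml; apply: ler_sum => j _; rewrite betaE// divfK// gt_eqF//.
have x1 : sqnorm (xdir x) <= 1 by rewrite sqnorm_xdir.
have [G1 [mG1 HG1 PG1]] := HA _ _ P m d X (xdir x) (bre x b) (bim x b) iidX d0 lnm x1 bK bmax.
have [G2 [mG2 HG2 PG2]] := HB _ _ P m d X (bre x b) (bim x b) iidX d0 bK.
exists (G1 `&` G2); split; first exact: measurableI.
  move=> w [Gw1 Gw2]; apply: curvature_lower => //.
  - exact: HG1.
  - exact: HG2.
have := probability_setCI mG1 mG2 PG1 PG2.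
rewrite probability_setC; last exact: measurableI.
have mG : measurable (G1 `&` G2) by exact: measurableI.
have [p pE] : exists p, P (G1 `&` G2) = p%:E.
  by exists (fine (P (G1 `&` G2))); rewrite fineK// fin_num_measure.
rewrite pE -EFinB !lee_fin => H.
have L0 : 0 <= m%:R / ln m%:R :> R by rewrite divr_ge0// ltW.
have b1 : (D1 ^ d)%:R * expR (- (a1 * (m%:R / ln m%:R))) <= expR (- (cc * m%:R / ln m%:R)).
  apply: (le_trans (expn_expR_absorb D10 a10 _ QL)); first by rewrite /Q; lra.
  by rewrite ler_expR lerN2 -mulrA ler_wpM2r// ge_min lexx.
have b2 : (D2 ^ d)%:R * expR (- (a2 * m%:R)) <= expR (- (cc * m%:R / ln m%:R)).
  (* The exponent of order m is weakened to m / ln m, which is allowed as ln m >= 1. *)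
  apply: (@le_trans _ _ ((D2 ^ d)%:R * expR (- (a2 * (m%:R / ln m%:R))))).
    rewrite ler_wpM2l// ler_expR lerN2 ler_wpM2l ?(ltW a20)//.
    by rewrite ler_pdivrMr// ler_peMr// ltW.
  apply: (le_trans (expn_expR_absorb D20 a20 _ QL)); first by rewrite /Q; lra.
  by rewrite ler_expR lerN2 -mulrA ler_wpM2r// ge_min lexx orbT.
move: H b1 b2 ed0; move: (_ * expR (- (a1 * _))) (_ * expR (- (a2 * _))) (_ / m%:R)
  (expR (- (cc * _ / _))) (expR (- (1 * _))) => *; lra.
Qed.
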